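(* Let $0<d<1$. (i) Suppose $S\subset\mathbb{R}$ is a compact set and $\Lambda\subset\mathbb{R}$ is a uniformly discrete set. If there exist functions $f_\xi\in PW_S$, $\xi\in\Lambda$, and constants $C>0$ and $0<\gamma<1$ such that $$\|f_\xi|_\Lambda-\delta_\xi\|_{l^2(\Lambda)}\le d\quad\text{and}\quad \|f_\xi\|_{L^2(\mathbb{R})}\le C e^{|\xi|^\gamma}\quad\text{for every }\xi\in\Lambda,$$ then $$m(S)\ge 2\pi(1-d^2)\,D^*(\Lambda).$$ (ii) For every $\epsilon>0$ there exist a compact set $S\subset\mathbb{R}$ with $m(S)<\epsilon$, a uniformly discrete set $\Lambda=\{\lambda_n:n\in\mathbb{Z}\}\subset\mathbb{R}$ with $\lambda_n=n+o(1)$ as $|n|\to\infty$, functions $f_\xi\in PW_S$, $\xi\in\Lambda$, and a constant $C>0$ such that $$\|f_\xi|_\Lambda-\delta_\xi\|_{l^2(\Lambda)}\le d\quad\text{and}\quad \|f_\xi\|_{L^2(\mathbb{R})}\le C e^{|\xi|}\quad\text{for every }\xi\in\Lambda.$$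
   Context: $m$ denotes Lebesgue measure on $\mathbb{R}$. The Fourier transform is $\hat F(x)=\int_{\mathbb{R}}e^{itx}F(t)\,dt$. For a compact set $S\subset\mathbb{R}$, the Paley--Wiener space is $PW_S=\{f\in L^2(\mathbb{R}): f=\hat F,\ F=0 \text{ on }\mathbb{R}\setminus S\}$ (with $F\in L^2(\mathbb{R})$), endowed with the $L^2(\mathbb{R})$-norm; its elements extend to entire functions, so restrictions to $\Lambda$ are defined pointwise. A set $\Lambda\subset\mathbb{R}$ is uniformly discrete if $\inf_{\lambda,\lambda'\in\Lambda,\lambda\ne\lambda'}|\lambda-\lambda'|>0$. For $\xi\in\Lambda$, $\delta_\xi:\Lambda\to\{0,1\}$ is the function with $\delta_\xi(\xi)=1$ and $\delta_\xi(\lambda)=0$ for $\lambda\in\Lambda$, $\lambda\neq\xi$. The upper density $D^*$ is $$D^*(\Lambda)=\limsup_{a\to\infty}\frac{\mathrm{card}(\Lambda\cap(-a,a))}{2a}.$$ *)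

(* Defs.v *)
From mathcomp Require Import all_boot all_order all_algebra.
From mathcomp Require Import all_classical all_reals all_analysis.
From mathcomp Require Import complex.

Set Implicit Arguments.
Unset Strict Implicit.
Unset Printing Implicit Defensive.

Import Order.TTheory GRing.Theory Num.Theory.
Import numFieldNormedType.Exports.

Local Open Scope classical_set_scope.
Local Open Scope ring_scope.
Local Open Scope complex_scope.

Definition expi {R : realType} (x : R) : R[i] := cos x +i* sin x.

(* The integral of a complex function is taken on real and imaginary parts.
   [Rintegral] gives junk on non-integrable functions, but a function in L^2
   with bounded support is integrable, which is the only case needed below. *)
Definition Cintegral {R : realType} (g : R -> R[i]) : R[i] :=
  Rintegral (@lebesgue_measure R) setT (fun t => complex.Re (g t)) +i*
  Rintegral (@lebesgue_measure R) setT (fun t => complex.Im (g t)).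

Definition fourier {R : realType} (F : R -> R[i]) (x : R) : R[i] :=
  Cintegral (fun t => expi (t * x) * F t).

Definition L2norm {R : realType} (f : R -> R[i]) : \bar R :=
  Lnorm (@lebesgue_measure R) 2%:E (fun x => (Normc.normc (f x))%:E).

Definition inL2 {R : realType} (f : R -> R[i]) : Prop :=
  [/\ measurable_fun setT (fun x => complex.Re (f x)),
      measurable_fun setT (fun x => complex.Im (f x)) &
      (L2norm f < +oo)%E].

(* Elements are the everywhere-defined (entire) representatives: f is equal
   to the Fourier integral at every point, not just almost everywhere. *)
Definition PW {R : realType} (S : set R) : set (R -> R[i]) :=
  [set f | inL2 f /\
     exists F : R -> R[i],
       [/\ inL2 F, (forall t, ~ S t -> F t = 0) &
           forall x, f x = fourier F x]].

(* ereal_inf set0 = +oo, so sets with at most one point qualify. *)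
Definition uniformly_discrete {R : realType} (Lambda : set R) : Prop :=
  (0 < ereal_inf [set r : \bar R | exists x y : R,
          [/\ Lambda x, Lambda y, x <> y & r = `|x - y|%:E]])%E.

Definition kronecker {R : realType} (xi l : R) : R[i] :=
  if l == xi then 1 else 0.

Definition l2norm {R : realType} (Lambda : set R) (u : R -> R[i]) : \bar R :=
  ((\esum_(l in Lambda) ((Normc.normc (u l)) ^+ 2)%:E) `^ 2^-1)%E.

(* [counting] is +oo on infinite sets. *)
Definition upper_density {R : realType} (Lambda : set R) : \bar R :=
  limf_esup
    (fun a : R => (counting (Lambda `&` [set x : R | - a < x < a]%R) *
                   ((2 * a)^-1)%:E)%E)
    (pinfty_nbhs R).

(* Main.v *)
Require Import Defs.
From mathcomp Require Import all_boot all_order all_algebra.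
From mathcomp Require Import all_classical all_reals all_analysis.
From mathcomp Require Import measurable_realfun complex ring lra zify.

(** The two parts show that the growth allowed to the norms of the almost
    interpolating functions decides whether the measure of the spectrum bounds
    the density of the nodes.

    For the density bound, localise: multiplying [f xi] by a high power of a
    Fejer factor centred at [xi] enlarges the spectrum to an open set of almost
    the same measure, keeps the almost-interpolation, and makes the function negligible outside
    a slightly larger interval.  The power can be taken proportional to the
    radius [r], so the gain is exponential in [r] and beats the factor
    [exp (r `^ gamma)]; this is where [gamma < 1] enters ([nodes_count],
    [tail_vanishes]).

    Count: there remain [N] functions, one for each node of the interval of
    radius [r], with spectra in a set of measure [m], concentrated on that
    interval.  If they were orthonormal, Bessel's inequality for evaluation
    at a point would bound the sum of their squared moduli by [m] everywhere,
    and integration over the interval would give [2 pi N <= 2 r m].  In general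
    they are orthogonalised by the spectral theorem, and the energies [g k] are
    compensated by weights [1 / (g k + l)]; the loss is [2 pi l] times the trace
    of the resolvent of the Gram matrix.  Almost-interpolation enters exactly
    there: the trace is at most [N (m + d^2 / l)], whence a main loss
    [2 pi N d^2] ([resolvent_coordinate], [concentration_count]).  The Plancherel
    inequality used on the way is proved with the Poisson kernel
    ([plancherel_ge]).  Letting [r] tend to infinity and [l] be small gives
    [density_bound].

    For the spectra of small measure, the functions are products of sines,
    normalised at their node, times a sinc that makes them square-integrable.  A sine of frequency [pi] only moves
    frequencies along the multiples of [pi], and slow sines hardly move them; a
    fixed number of the former and slow sines of small total frequency give a
    spectrum in finitely many short bands around multiples of [pi]
    ([sprods_PW]).

    The nodes are small perturbations of the integers, constant on every
    residue class modulo [q ^ 2] inside each of a sequence of geometrically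
    growing shells, and much smaller from one shell to the next.  To build the
    function of a node in the [i]-th shell, whose radius is [X] up to powers of
    [q], kill the other residue classes of its shell and the whole preceding
    shell with sines of frequency [pi], one for each class; kill its own class,
    and the old shells, with [O(X)] slow sines; and put a zero of order
    [q ^ 2] at the integers, which makes the function tiny on the outer shells,
    whose nodes are extremely close to integers ([inner_zero],
    [node_fun_outer]).  The zeros of the class of the node are [q ^ 2] apart,
    and the bandwidth is of order [eps / q ^ 2], so killing them costs
    [exp (O(X / eps))] ([slow_product_ge]).  The node being at least of size
    [q X], a large [q] brings all the costs below [exp |xi|]
    ([amplitude_le]). *)

Set Implicit Arguments.
Unset Strict Implicit.
Unset Printing Implicit Defensive.

Import Order.TTheory GRing.Theory Num.Theory.
Import numFieldNormedType.Exports.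

Local Open Scope classical_set_scope.
Local Open Scope ring_scope.

Implicit Types R : realType.

(** * Integrable functions on the line *)

Lemma le_of_eq (R : numDomainType) (x y : R) : x = y -> x <= y.
Proof. by move=> ->. Qed.

Local Notation mu := (@lebesgue_measure _).

Definition L1 R (f : R -> R) : Prop :=
  mu.-integrable setT (EFin \o f).

Lemma L1_measurable R (f : R -> R) : L1 f -> measurable_fun setT f.
Proof. by move=> /integrableP[/measurable_EFinP]. Qed.

Lemma eq_L1 R (f g : R -> R) : f =1 g -> L1 f -> L1 g.
Proof. by move=> /funext ->. Qed.

Lemma L1_dominated R (f g : R -> R) :
  measurable_fun setT f -> (forall x, `|f x| <= g x) -> L1 g -> L1 f.
Proof.
move=> mf fg ig; apply: le_integrable ig => //; first exact/measurable_EFinP.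
by move=> x _ /=; rewrite lee_fin (le_trans (fg x))// ler_norm.
Qed.

Lemma L1D R (f g : R -> R) :
  L1 f -> L1 g -> L1 (fun x => f x + g x).
Proof. by move=> fi gi; have := integrableD measurableT fi gi. Qed.

Lemma L1Z R (c : R) (f : R -> R) :
  L1 f -> L1 (fun x => c * f x).
Proof. by move=> fi; have := integrableZl measurableT c fi. Qed.

Lemma L1N R (f : R -> R) : L1 f -> L1 (fun x => - f x).
Proof. by move=> fi; have := integrableN fi. Qed.

Lemma L1B R (f g : R -> R) :
  L1 f -> L1 g -> L1 (fun x => f x - g x).
Proof. by move=> fi gi; apply: L1D => //; apply: L1N. Qed.

Lemma L1_norm R (f : R -> R) : L1 f -> L1 (fun x => `|f x|).
Proof. by move=> fi; have := integrable_norm fi. Qed.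

Lemma L1_sum R (I : Type) (s : seq I) (P : pred I) (f : I -> R -> R) :
  (forall i, L1 (f i)) -> L1 (fun x => \sum_(i <- s | P i) f i x).
Proof.
move=> fi; elim: s => [|i s IH].
  rewrite (_ : (fun x => _) = cst 0); first exact: integrable0.
  by apply/funext => x; rewrite big_nil.
rewrite (_ : (fun x => _) = fun x => (if P i then f i x else 0) +
   \sum_(i <- s | P i) f i x).
  apply: L1D => //; case: (P i) => //; exact: integrable0.
by apply/funext => x; rewrite big_cons; case: (P i) => //; rewrite add0r.
Qed.

Lemma L1_mul_bounded R (f g : R -> R) (K : R) :
  measurable_fun setT f -> (forall x, `|f x| <= K) -> L1 g ->
  L1 (fun x => f x * g x).
Proof.
move=> mf fK ig; apply: (@L1_dominated _ _ (fun x => K * `|g x|)).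
- by apply: measurable_funM => //; exact: L1_measurable.
- by move=> x; rewrite normrM ler_wpM2r.
- by apply: L1Z; apply: L1_norm.
Qed.

Lemma RintD R (f g : R -> R) : L1 f -> L1 g ->
  \int[mu]_x (f x + g x) = \int[mu]_x f x + \int[mu]_x g x.
Proof. exact: RintegralD. Qed.

Lemma RintB R (f g : R -> R) : L1 f -> L1 g ->
  \int[mu]_x (f x - g x) = \int[mu]_x f x - \int[mu]_x g x.
Proof. exact: RintegralB. Qed.

Lemma RintZ R (c : R) (f : R -> R) : L1 f ->
  \int[mu]_x (c * f x) = c * \int[mu]_x f x.
Proof. exact: RintegralZl. Qed.

Lemma Rint_addE R (f g h : R -> R) : L1 f -> L1 g ->
  (forall x, h x = f x + g x) ->
  \int[mu]_x h x = \int[mu]_x f x + \int[mu]_x g x.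
Proof. by move=> fi gi /funext ->; exact: RintD. Qed.

Lemma Rint_subE R (f g h : R -> R) : L1 f -> L1 g ->
  (forall x, h x = f x - g x) ->
  \int[mu]_x h x = \int[mu]_x f x - \int[mu]_x g x.
Proof. by move=> fi gi /funext ->; exact: RintB. Qed.

Lemma RintN R (f : R -> R) : L1 f ->
  \int[mu]_x (- f x) = - \int[mu]_x f x.
Proof.
move=> fi; rewrite -[RHS]mulN1r -RintZ//.
by apply: eq_Rintegral => x _; rewrite mulN1r.
Qed.

Lemma eq_Rint R (f g : R -> R) : f =1 g ->
  \int[mu]_x f x = \int[mu]_x g x.
Proof. by move=> fg; apply: eq_Rintegral => x _. Qed.

Lemma Rint0 R : \int[mu]_(x in [set: R]) (0 : R) = 0.
Proof. by rewrite /Rintegral integral0. Qed.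

Lemma Rint_sum R (I : Type) (s : seq I) (P : pred I) (f : I -> R -> R) :
  (forall i, L1 (f i)) ->
  \int[mu]_x (\sum_(i <- s | P i) f i x) = \sum_(i <- s | P i) \int[mu]_x f i x.
Proof.
move=> fi; elim: s => [|i s IH].
  by rewrite big_nil -[RHS]Rint0; apply: eq_Rint => x; rewrite big_nil.
rewrite big_cons -IH; case: ifP => Pi.
  by rewrite -RintD//; [apply: eq_Rint => x; rewrite big_cons Pi|apply: L1_sum].
by apply: eq_Rint => x; rewrite big_cons Pi.
Qed.

Lemma le_Rint R (f g : R -> R) : L1 f -> L1 g ->
  (forall x, f x <= g x) -> \int[mu]_x f x <= \int[mu]_x g x.
Proof. by move=> fi gi fg; apply: le_Rintegral. Qed.

Lemma Rint_ge0 R (f : R -> R) :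
  (forall x, 0 <= f x) -> 0 <= \int[mu]_x f x.
Proof. by move=> f0; apply: Rintegral_ge0. Qed.

Lemma norm_Rint R (f : R -> R) : L1 f ->
  `|\int[mu]_x f x| <= \int[mu]_x `|f x|.
Proof. by move=> fi; apply: le_normr_Rintegral. Qed.

Lemma L1_restrict_itv R (a b : R) (f : R -> R) :
  continuous f -> L1 (f \_ `[a, b]).
Proof.
move=> cf; rewrite /L1 -restrict_EFin.
have := @integrable_restrict _ _ R mu `[a, b] (measurable_itv _) setT measurableT (EFin \o f).
rewrite setTI => /iffLR; apply.
apply: continuous_compact_integrable; first exact: segment_compact.
exact: continuous_subspaceT.
Qed.

Lemma L1_ge0 R (f : R -> R) : measurable_fun setT f ->
  (forall x, 0 <= f x) -> (\int[mu]_x (f x)%:E < +oo)%E -> L1 f.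
Proof.
move=> mf f0 fi; apply/integrableP; split; first exact/measurable_EFinP.
by under eq_integral => x _ do rewrite gee0_abs ?lee_fin//.
Qed.

Lemma L1_ge0_fin R (f : R -> R) :
  L1 f -> (\int[mu]_x (f x)%:E)%E = (\int[mu]_x f x)%:E.
Proof.
move=> fi; rewrite /Rintegral fineK//; exact: integrable_fin_num.
Qed.

(** Fubini's theorem for a kernel that is merely bounded and measurable. *)
Lemma Rint_swap R (F G : R -> R) (w : R * R -> R) (K : R) :
  L1 F -> L1 G -> measurable_fun setT w -> (forall p, `|w p| <= K) ->
  L1 (fun t => G t * \int[mu]_u (F u * w (t, u))) /\
  \int[mu]_t (G t * \int[mu]_u (F u * w (t, u))) =
  \int[mu]_u (F u * \int[mu]_t (G t * w (t, u))).
Proof.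
move=> iF iG mw wK.
have mF := L1_measurable iF; have mG := L1_measurable iG.
pose f (p : R * R) : \bar R := (G p.1 * F p.2 * w p)%:E.
have mf : measurable_fun [set: R * R] f.
  apply/measurable_EFinP; apply: measurable_funM => //.
  apply: measurable_funM; [exact: measurableT_comp mG _|exact: measurableT_comp mF _].
have iFw t : L1 (fun u => F u * w (t, u)).
  rewrite (_ : (fun u => _) = fun u => w (t, u) * F u); last first.
    by apply/funext => u; rewrite mulrC.
  apply: (@L1_mul_bounded _ _ _ K) => //.
  exact: measurableT_comp mw (pair1_measurable _).
have iGw u : L1 (fun t => G t * w (t, u)).
  rewrite (_ : (fun t => _) = fun t => w (t, u) * G t); last first.
    by apply/funext => t; rewrite mulrC.
  apply: (@L1_mul_bounded _ _ _ K) => //.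
  exact: measurableT_comp mw (pair2_measurable _).
have intf : (mu \x mu)%E.-integrable [set: R * R] f.
  apply/integrable12ltyP => //.
  apply: (@le_lt_trans _ _ (\int[mu]_t (`|G t| * (K * \int[mu]_u `|F u|))%:E)%E).
    apply: ge0_le_integral => //.
    - by move=> x _; apply: integral_ge0.
    - apply: (@measurable_fun_fubini_tonelli_F _ _ _ _ _ mu (abse \o f)) => //=.
      exact: measurableT_comp.
    - by apply/measurable_EFinP; apply: measurable_funM => //; apply: measurableT_comp.
    - move=> t _ /=.
      have -> : (`|G t| * (K * \int[mu]_u `|F u|))%:E =
                (\int[mu]_u (`|G t| * K * `|F u|)%:E)%E.
        by rewrite L1_ge0_fin ?RintZ ?mulrA//; [apply: L1_norm|apply: L1Z; apply: L1_norm].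
      apply: ge0_le_integral => //.
      + apply/measurable_EFinP; under eq_fun => x do rewrite -mulrA.
        by apply: measurableT_comp => //; apply: L1_measurable; apply: L1Z.
      + apply/measurable_EFinP; apply: measurable_funM => //.
        exact: measurableT_comp.
      + move=> u _; rewrite lee_fin !normrM.
        by rewrite -mulrA -[leRHS]mulrA ler_wpM2l// mulrC ler_wpM2r.
  rewrite L1_ge0_fin ?ltry//.
  rewrite (_ : (fun t => _) = fun t => (K * \int[mu]_u `|F u|) * `|G t|).
    by apply: L1Z; apply: L1_norm.
  by apply/funext => t; rewrite mulrC.
have E1 t : (\int[mu]_u f (t, u) = (G t * \int[mu]_u (F u * w (t, u)))%:E)%E.
  rewrite /f /= -RintZ// -L1_ge0_fin; last exact: L1Z.
  by apply: eq_integral => u _; rewrite mulrA.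
have E2 u : (\int[mu]_t f (t, u) = (F u * \int[mu]_t (G t * w (t, u)))%:E)%E.
  rewrite /f /= -RintZ// -L1_ge0_fin; last exact: L1Z.
  by apply: eq_integral => t _; congr EFin; ring.
split.
  have := integrable_fubini_F intf; rewrite /fubini_F.
  by apply: eq_integrable => // t _; rewrite E1.
have := Fubini intf.
under eq_integral do rewrite E1.
under [X in _ = X -> _]eq_integral do rewrite E2.
by rewrite /Rintegral => ->.
Qed.

Lemma Rint_FTC R (f F : R -> R) (a b : R) : a <= b ->
  (forall x, is_derive x (1:R) F (f x)) -> continuous f ->
  \int[mu]_(x in `[a, b]) f x = F b - F a.
Proof.
move=> ab dF cf; have cF : continuous F.
  by move=> x; apply/differentiable_continuous/derivable1_diffP; exact: (@ex_derive _ _ _ _ _ _ _ (dF x)).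
move: ab; rewrite le_eqVlt => /predU1P[<-|ab].
  by rewrite set_itv1 Rintegral_set1 subrr.
rewrite /Rintegral (@continuous_FTC2 _ _ F)//.
- exact: continuous_subspaceT.
- split.
  + by move=> x _; exact: (@ex_derive _ _ _ _ _ _ _ (dF x)).
  + by apply: cvg_at_right_filter; exact: cF.
  + by apply: cvg_at_left_filter; exact: cF.
- by move=> x _; rewrite derive1E; exact: (@derive_val _ _ _ _ _ _ _ (dF x)).
Qed.

Lemma continuous_integrable_itv R (f : R -> R) (a b : R) :
  continuous f -> mu.-integrable `[a, b] (EFin \o f).
Proof.
move=> cf; apply: continuous_compact_integrable; first exact: segment_compact.
exact: continuous_subspaceT.
Qed.

Lemma Rint_cst_itv R (c p q : R) : p <= q ->
  \int[mu]_(x in `[p, q]) c = c * (q - p).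
Proof.
rewrite le_eqVlt => /predU1P[->|pq].
  by rewrite set_itv1 Rintegral_set1 subrr mulr0.
by rewrite Rintegral_cst//= lebesgue_measure_itv/= lte_fin pq -EFinD.
Qed.

Lemma Rint_itv_split R (f : R -> R) (a b c : R) : a <= b -> b <= c ->
  continuous f ->
  \int[mu]_(x in `[a, c]) f x =
  \int[mu]_(x in `[a, b]) f x + \int[mu]_(x in `[b, c]) f x.
Proof.
move=> ab bc cf; have fi p q := continuous_integrable_itv p q cf.
have := @Rintegral_itvB R f (BLeft a) (BRight c) b (fi _ _).
rewrite !bnd_simp => /(_ ab bc) /eqP; rewrite subr_eq addrC => /eqP ->.
congr (_ + _); rewrite Rintegral_itv_obnd_cbnd//.
by apply: integrableS (fi b c) => //; exact: subset_itv_oc_cc.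
Qed.

(** * The triangle and its Fourier transform *)

(** The triangle of half-width [a] and unit area; [hat_ft] is its Fourier
    transform, by [hat_cos], and decays quadratically. *)
Definition hat R (a v : R) : R := Num.max 0 (1 - `|v| / a) / a.

Definition hat_ft R (a y : R) : R :=
  if y == 0 then 1 else 2 * (1 - cos (a * y)) / (a * y) ^+ 2.

Lemma continuous_hat R (a : R) : continuous (hat a).
Proof.
move=> v; apply: cvgM; last exact: cvg_cst.
apply: (@continuous_max _ _ (cst 0) (fun v => 1 - `|v| / a)); first exact: cvg_cst.
apply: cvgB; first exact: cvg_cst.
by apply: cvgM; [exact: norm_continuous|exact: cvg_cst].
Qed.

Lemma hat_ge0 R (a v : R) : 0 < a -> 0 <= hat a v.
Proof. by move=> a0; apply: divr_ge0; [rewrite le_max lexx|exact: ltW]. Qed.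

Lemma hat_out R (a v : R) : 0 < a -> a <= `|v| -> hat a v = 0.
Proof.
move=> a0 av; rewrite /hat max_l ?mul0r// subr_le0.
by rewrite ler_pdivlMr// mul1r.
Qed.

Lemma hat_le R (a v : R) : 0 < a -> hat a v <= a^-1.
Proof.
move=> a0; rewrite /hat ler_pdivrMr// mulVf ?gt_eqF// ge_max ler01 /=.
by rewrite gerBl divr_ge0// ltW.
Qed.

Lemma hat_lip R (a v w : R) : 0 < a ->
  `|hat a v - hat a w| <= a ^- 2 * `|v - w|.
Proof.
move=> a0; rewrite /hat -mulrBl normrM (gtr0_norm (x := a^-1)) ?invr_gt0//.
rewrite expr2 invfM -mulrA [leRHS]mulrC ler_wpM2r//; first by rewrite invr_ge0 ltW.
have : `|v| / a - `|w| / a <= a^-1 * `|v - w| /\ `|w| / a - `|v| / a <= a^-1 * `|v - w|.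
  rewrite -!mulrBl ![_ / a]mulrC !ler_pM2l ?invr_gt0//; split.
    exact: lerB_dist.
  by rewrite distrC lerB_dist.
have : 0 <= a^-1 * `|v - w| by rewrite mulr_ge0// invr_ge0 ltW.
set p := `|v| / a; set q := `|w| / a; set r := _ * _ => r0 [h1 h2].
rewrite ler_norml !/Order.max.
by case: ifPn => c1; case: ifPn => c2; lra.
Qed.

Lemma hatE_left R (a u t : R) : 0 < a -> u - a <= t <= u ->
  hat a (t - u) = (1 + (t - u) / a) / a.
Proof.
move=> a0 /andP[t1 t2]; rewrite /hat ler0_norm ?subr_le0// max_r mulNr ?opprK//.
have -> : 1 + (t - u) / a = (t - (u - a)) / a by field; rewrite gt_eqF.
by rewrite divr_ge0 ?subr_ge0// ltW.
Qed.

Lemma hatE_right R (a u t : R) : 0 < a -> u <= t <= u + a ->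
  hat a (t - u) = (1 - (t - u) / a) / a.
Proof.
move=> a0 /andP[t1 t2]; rewrite /hat ger0_norm ?subr_ge0// max_r//.
have -> : 1 - (t - u) / a = (u + a - t) / a by field; rewrite gt_eqF.
by rewrite divr_ge0 ?subr_ge0// ltW.
Qed.

(** On each half of its support the triangle is affine, so the integrand has an
    explicit primitive; the phase [q] covers the cosine and the sine transforms
    of all the translates at once. *)
Lemma hat_cos R (a u y q : R) : 0 < a ->
  \int[mu]_t (hat a (t - u) * cos (t * y + q)) = hat_ft a y * cos (u * y + q).
Proof.
move=> a0; have an0 : a != 0 by rewrite gt_eqF.
have c_lin p r : continuous (fun t : R => t * p + r).
  by move=> x; apply: cvgD; [apply: cvgM; [exact: cvg_id|exact: cvg_cst]|exact: cvg_cst].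
have c_cos : continuous (fun t : R => cos (t * y + q)).
  by move=> x; apply: continuous_comp; [exact: c_lin|exact: continuous_cos].
have c_hat : continuous (fun t : R => hat a (t - u)).
  move=> x; apply: (@continuous_comp _ _ _ (fun t => t - u) (hat a)); last exact: continuous_hat.
  by apply: cvgB; [exact: cvg_id|exact: cvg_cst].
have c_prod : continuous (fun t : R => hat a (t - u) * cos (t * y + q)).
  by move=> x; apply: cvgM; [exact: c_hat|exact: c_cos].
have -> : \int[mu]_t (hat a (t - u) * cos (t * y + q)) =
    \int[mu]_(t in `[u - a, u + a]) (hat a (t - u) * cos (t * y + q)).
  rewrite [RHS]Rintegral_mkcond; apply: eq_Rint => t /=.
  rewrite patchE; case: ifPn => // tn; rewrite hat_out ?mul0r// leNgt.
  apply: contra tn => tn; rewrite inE/= in_itv/=.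
  by move: tn; rewrite ltr_norml => /andP[? ?]; apply/andP; split; lra.
rewrite (@Rint_itv_split _ _ _ u); [|lra|lra|by []].
have -> : \int[mu]_(t in `[(u - a), u]) (hat a (t - u) * cos (t * y + q)) =
  \int[mu]_(t in `[(u - a), u]) ((1 + (t - u) / a) / a * cos (t * y + q)).
  by apply: eq_Rintegral => t; rewrite inE/= in_itv/= => tI; rewrite hatE_left.
have -> : \int[mu]_(t in `[u, (u + a)]) (hat a (t - u) * cos (t * y + q)) =
  \int[mu]_(t in `[u, (u + a)]) ((1 - (t - u) / a) / a * cos (t * y + q)).
  by apply: eq_Rintegral => t; rewrite inE/= in_itv/= => tI; rewrite hatE_right.
have c1 : continuous (fun t => (1 + (t - u) / a) / a * cos (t * y + q)).
  rewrite (_ : (fun t => _) = fun t => (t * (a^-1/a) + ((1 - u / a) / a)) * cos (t * y + q)).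
    by move=> x; apply: cvgM; [exact: c_lin|exact: c_cos].
  by apply/funext => t; ring.
have c2 : continuous (fun t => (1 - (t - u) / a) / a * cos (t * y + q)).
  rewrite (_ : (fun t => _) = fun t => (t * (- (a^-1/a)) + ((1 + u / a) / a)) * cos (t * y + q)).
    by move=> x; apply: cvgM; [exact: c_lin|exact: c_cos].
  by apply/funext => t; ring.
rewrite /hat_ft; case: eqP => [y0|/eqP y0].
  rewrite y0 in c1 c2 *.
  have -> : \int[mu]_(t in `[u - a, u]) ((1 + (t - u) / a) / a * cos (t * 0 + q)) = cos q / 2.
    pose F t := (t + (t - u) ^+ 2 / (2 * a)) / a * cos q.
    rewrite (_ : cos q / 2 = F u - F (u - a)); last by rewrite /F; field.
    apply: Rint_FTC => //; first by lra.
    move=> x; rewrite mulr0 add0r; apply: is_derive_eq.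
    by rewrite /GRing.scale/=; field.
  have -> : \int[mu]_(t in `[u, u + a]) ((1 - (t - u) / a) / a * cos (t * 0 + q)) = cos q / 2.
    pose F t := (t - (t - u) ^+ 2 / (2 * a)) / a * cos q.
    rewrite (_ : cos q / 2 = F (u + a) - F u); last by rewrite /F; field.
    apply: Rint_FTC => //; first by lra.
    move=> x; rewrite mulr0 add0r; apply: is_derive_eq.
    by rewrite /GRing.scale/=; field.
  by rewrite mulr0 add0r; field.
pose F t := (1 + (t - u) / a) / a * (sin (t * y + q) / y) + cos (t * y + q) / (a ^+ 2 * y ^+ 2).
have -> : \int[mu]_(t in `[u - a, u]) ((1 + (t - u) / a) / a * cos (t * y + q)) = F u - F (u - a).
  apply: Rint_FTC => //; first by lra.
  by move=> x; apply: is_derive_eq; rewrite /GRing.scale/=; field; rewrite an0 y0.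
pose G t := (1 - (t - u) / a) / a * (sin (t * y + q) / y) - cos (t * y + q) / (a ^+ 2 * y ^+ 2).
have -> : \int[mu]_(t in `[u, u + a]) ((1 - (t - u) / a) / a * cos (t * y + q)) = G (u + a) - G u.
  apply: Rint_FTC => //; first by lra.
  by move=> x; apply: is_derive_eq; rewrite /GRing.scale/=; field; rewrite an0 y0.
rewrite /F /G.
have -> : (u - a) * y + q = (u * y + q) - a * y by ring.
have -> : (u + a) * y + q = (u * y + q) + a * y by ring.
move: (u * y + q) => s; rewrite cosB cosD; field; by rewrite an0 y0.
Qed.

Lemma hat_sin R (a u y : R) : 0 < a ->
  \int[mu]_t (hat a (t - u) * sin (t * y)) = hat_ft a y * sin (u * y).
Proof.
move=> a0; rewrite -[in RHS]cosBpihalf -hat_cos//.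
by apply: eq_Rint => t; rewrite cosBpihalf.
Qed.

Lemma hat_ft0 R (a : R) : hat_ft a 0 = 1.
Proof. by rewrite /hat_ft eqxx. Qed.

Lemma L1_hat R (a u : R) : 0 < a -> L1 (fun t => hat a (t - u)).
Proof.
move=> a0; have -> : (fun t => hat a (t - u)) = (fun t => hat a (t - u)) \_ `[u - a, u + a].
  apply/funext => t; rewrite patchE; case: ifPn => // tn; rewrite hat_out// leNgt.
  apply: contra tn => tn; rewrite inE/= in_itv/=.
  by move: tn; rewrite ltr_norml => /andP[? ?]; apply/andP; split; lra.
apply: L1_restrict_itv => x.
apply: (@continuous_comp _ _ _ (fun t => t - u) (hat a)); last exact: continuous_hat.
by apply: cvgB; [exact: cvg_id|exact: cvg_cst].
Qed.

Lemma hat_ft_ge0 R (a y : R) : 0 <= hat_ft a y.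
Proof.
rewrite /hat_ft; case: ifP => // _; by rewrite divr_ge0 ?sqr_ge0// mulr_ge0// subr_ge0 cos_le1.
Qed.

Lemma hat_ft_le1 R (a y : R) : 0 < a -> hat_ft a y <= 1.
Proof.
move=> a0; have := hat_cos 0 y 0 a0; rewrite mul0r add0r cos0 mulr1 => <-.
have := hat_cos 0 0 0 a0; rewrite mul0r add0r cos0 mulr1 hat_ft0 => <-.
apply: le_Rint.
- rewrite (_ : (fun t => _) = fun t => cos (t * y + 0) * hat a (t - 0)); last first.
    by apply/funext => t; rewrite mulrC.
  apply: (@L1_mul_bounded _ _ _ 1); last exact: L1_hat.
    apply: (measurableT_comp (continuous_measurable_fun (@continuous_cos R))).
    by apply: measurable_funD => //; apply: measurable_funM.
  by move=> x; exact: cos_max.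
- rewrite (_ : (fun t => _) = fun t => hat a (t - 0)); first exact: L1_hat.
  by apply/funext => t; rewrite mulr0 addr0 cos0 mulr1.
- by move=> t; rewrite !addr0 mulr0 cos0 ler_wpM2l ?cos_le1// hat_ge0.
Qed.

Lemma hat_ft_decay R (a y : R) : 0 < a -> y != 0 ->
  hat_ft a y <= 4 / (a * y) ^+ 2.
Proof.
move=> a0 y0; rewrite /hat_ft (negPf y0) ler_pM2r.
  by have := cos_geN1 (a * y); lra.
by rewrite invr_gt0 exprn_even_gt0//= mulf_neq0// gt_eqF.
Qed.

(** * Cosine and sine transforms *)

Definition cosT R (a : R -> R) (x : R) : R := \int[mu]_t (a t * cos (t * x)).
Definition sinT R (a : R -> R) (x : R) : R := \int[mu]_t (a t * sin (t * x)).

Lemma measurable_comp_mul R (f : R -> R) : continuous f ->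
  measurable_fun setT (fun p : R * R => f (p.2 * p.1)).
Proof.
move=> cf; apply: (measurableT_comp (continuous_measurable_fun cf)).
exact: measurable_funM.
Qed.

Lemma L1_mul_comp R (W f : R -> R) (t : R) : continuous f ->
  (forall x, `|f x| <= 1) -> L1 W -> L1 (fun x => W x * f (t * x)).
Proof.
move=> cf f1 iW; rewrite (_ : (fun x => _) = fun x => f (t * x) * W x); last first.
  by apply/funext => x; rewrite mulrC.
apply: (@L1_mul_bounded _ _ _ 1) => //.
apply: (measurableT_comp (continuous_measurable_fun cf)).
exact: measurable_funM.
Qed.

(** A weighted integral of a product of two transforms is a double integral
    against the transform of the weight: this is what reduces Plancherel's
    inequality to a property of the Poisson kernel. *)
Lemma bilinear_swap R (W a b f g : R -> R) :
  L1 W -> L1 a -> L1 b -> continuous f -> continuous g ->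
  (forall x, `|f x| <= 1) -> (forall x, `|g x| <= 1) ->
  let A x := \int[mu]_t (a t * f (t * x)) in
  let B x := \int[mu]_s (b s * g (s * x)) in
  let K t s := \int[mu]_x (W x * (f (t * x) * g (s * x))) in
  [/\ L1 (fun x => W x * (A x * B x)),
      forall t, L1 (fun s => b s * K t s),
      L1 (fun t => a t * \int[mu]_s (b s * K t s)) &
   \int[mu]_x (W x * (A x * B x)) =
   \int[mu]_t (a t * \int[mu]_s (b s * K t s))].
Proof.
move=> iW ia ib cf cg f1 g1 A B K.
have mf := measurable_comp_mul cf; have mg := measurable_comp_mul cg.
have [iWB _] := @Rint_swap _ b W _ 1 ib iW mg (fun p => g1 _).
have [iWBA EWBA] := @Rint_swap _ a (fun x => W x * B x) _ 1 ia iWB mf (fun p => f1 _).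
have iWf t : L1 (fun x => W x * f (t * x)) by exact: L1_mul_comp.
have in1 t : \int[mu]_x (W x * B x * f (t * x)) = \int[mu]_s (b s * K t s).
  have [_] := @Rint_swap _ b (fun x => W x * f (t * x)) _ 1 ib (iWf t) mg (fun p => g1 _).
  under eq_Rint do rewrite /= -/(B _) mulrAC.
  move=> ->; apply: eq_Rint => s /=; congr (_ * _).
  by apply: eq_Rint => x; rewrite mulrA.
have EQ : (fun x => W x * (A x * B x)) = (fun x => W x * B x * A x).
  by apply/funext => x; ring.
split.
- by rewrite EQ.
- move=> t; have mwg : measurable_fun setT (fun p : R * R => g (p.1 * p.2)).
    apply: (measurableT_comp (continuous_measurable_fun cg)).
    exact: measurable_funM.
  have [+ _] := @Rint_swap _ (fun x => W x * f (t * x)) b _ 1 (iWf t) ib mwg (fun p => g1 _).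
  apply: eq_L1 => s; congr (_ * _).
  by apply: eq_Rint => x /=; rewrite mulrA.
- have mwf : measurable_fun setT (fun p : R * R => f (p.1 * p.2)).
    apply: (measurableT_comp (continuous_measurable_fun cf)).
    exact: measurable_funM.
  have [+ _] := @Rint_swap _ (fun x => W x * B x) a _ 1 iWB ia mwf (fun p => f1 _).
  by apply: eq_L1 => t; rewrite /= in1.
- rewrite EQ EWBA; apply: eq_Rint => t; congr (_ * _); exact: in1.
Qed.

(** * Plancherel's inequality through the Poisson kernel *)

(** The truncation keeps the integrals on a segment, where they have explicit
    primitives; for [X = e ^- 3] it only changes them by [O(e)]. *)
Definition poissonW R (e X : R) : R -> R :=
  (fun x => expR (- (e * `|x|))) \_ `[- X, X].

Lemma continuous_poisson R (e : R) : continuous (fun x : R => expR (- (e * `|x|))).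
Proof.
move=> x; apply: (@continuous_comp _ _ _ (fun x => - (e * `|x|)) expR); last exact: continuous_expR.
by apply: cvgN; apply: cvgM; [exact: cvg_cst|exact: norm_continuous].
Qed.

Lemma poissonW_split R (e X : R) (f : R -> R) : 0 < X -> continuous f ->
  \int[mu]_x (poissonW e X x * f x) =
  \int[mu]_(x in `[- X, 0]) (expR (e * x) * f x) +
  \int[mu]_(x in `[0, X]) (expR (- e * x) * f x).
Proof.
move=> X0 cf.
have -> : \int[mu]_x (poissonW e X x * f x) =
   \int[mu]_(x in `[- X, X]) (expR (- (e * `|x|)) * f x).
  rewrite [RHS]Rintegral_mkcond; apply: eq_Rint => x.
  by rewrite /poissonW !patchE; case: ifP => //; rewrite mul0r.
rewrite (@Rint_itv_split _ _ _ 0); [|lra|lra|]; last first.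
  by move=> x; apply: cvgM; [exact: continuous_poisson|exact: cf].
apply: (f_equal2 +%R).
  apply: eq_Rintegral => x; rewrite inE/= in_itv/= => /andP[x1 x2].
  by rewrite ler0_norm// mulrN opprK.
apply: eq_Rintegral => x; rewrite inE/= in_itv/= => /andP[x1 x2].
by rewrite ger0_norm// mulNr.
Qed.

Lemma continuous_expM R (e : R) : continuous (fun x : R => expR (e * x)).
Proof.
move=> x; apply: (@continuous_comp _ _ _ (fun x => e * x) expR); last exact: continuous_expR.
by apply: cvgM; [exact: cvg_cst|exact: cvg_id].
Qed.

Lemma continuous_trigM R (f : R -> R) (u : R) : continuous f ->
  continuous (fun x : R => f (u * x)).
Proof.
move=> cf x; apply: (@continuous_comp _ _ _ (fun x => u * x) f); last exact: cf.
by apply: cvgM; [exact: cvg_cst|exact: cvg_id].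
Qed.

Lemma poissonW_cos R (e X u : R) : 0 < e -> 0 < X ->
  \int[mu]_x (poissonW e X x * cos (u * x)) =
  2 * (e + expR (- e * X) * (u * sin (u * X) - e * cos (u * X))) / (e ^+ 2 + u ^+ 2).
Proof.
move=> e0 X0; have cc := @continuous_trigM R _ u (@continuous_cos R).
have en : e ^+ 2 + u ^+ 2 != 0.
  by rewrite gt_eqF// ltr_pwDl ?sqr_ge0// exprn_gt0.
rewrite poissonW_split//.
pose F x := expR (e * x) * ((u * sin (u * x) + e * cos (u * x)) / (e ^+ 2 + u ^+ 2)).
have -> : \int[mu]_(x in `[- X, 0]) (expR (e * x) * cos (u * x)) = F 0 - F (- X).
  apply: Rint_FTC; first by lra.
    by move=> x; apply: is_derive_eq; rewrite /GRing.scale/=; field.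
  by move=> x; apply: cvgM; [exact: continuous_expM|exact: cc].
pose G x := expR (- e * x) * ((u * sin (u * x) - e * cos (u * x)) / (e ^+ 2 + u ^+ 2)).
have -> : \int[mu]_(x in `[0, X]) (expR (- e * x) * cos (u * x)) = G X - G 0.
  apply: Rint_FTC; first by lra.
    by move=> x; apply: is_derive_eq; rewrite /GRing.scale/=; field.
  by move=> x; apply: cvgM; [exact: continuous_expM|exact: cc].
rewrite /F /G !mulr0 sin0 cos0 expR0 !mulrN sinN cosN -!mulNr.
by field.
Qed.

Lemma poissonW_sin R (e X u : R) : 0 < e -> 0 < X ->
  \int[mu]_x (poissonW e X x * sin (u * x)) = 0.
Proof.
move=> e0 X0; have cc := @continuous_trigM R _ u (@continuous_sin R).
have en : e ^+ 2 + u ^+ 2 != 0.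
  by rewrite gt_eqF// ltr_pwDl ?sqr_ge0// exprn_gt0.
rewrite poissonW_split//.
pose F x := expR (e * x) * ((e * sin (u * x) - u * cos (u * x)) / (e ^+ 2 + u ^+ 2)).
have -> : \int[mu]_(x in `[- X, 0]) (expR (e * x) * sin (u * x)) = F 0 - F (- X).
  apply: Rint_FTC; first by lra.
    by move=> x; apply: is_derive_eq; rewrite /GRing.scale/=; field.
  by move=> x; apply: cvgM; [exact: continuous_expM|exact: cc].
pose G x := expR (- e * x) * ((- e * sin (u * x) - u * cos (u * x)) / (e ^+ 2 + u ^+ 2)).
have -> : \int[mu]_(x in `[0, X]) (expR (- e * x) * sin (u * x)) = G X - G 0.
  apply: Rint_FTC; first by lra.
    by move=> x; apply: is_derive_eq; rewrite /GRing.scale/=; field.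
  by move=> x; apply: cvgM; [exact: continuous_expM|exact: cc].
rewrite /F /G !mulr0 sin0 cos0 expR0 !mulrN sinN cosN -!mulNr.
by field.
Qed.

Definition lipschitz_supp R (T L : R) (a : R -> R) : Prop :=
  (forall s t, `|a s - a t| <= L * `|s - t|) /\ (forall t, T < `|t| -> a t = 0).

Lemma lipschitz_supp_continuous R (T L : R) (a : R -> R) :
  lipschitz_supp T L a -> continuous a.
Proof.
move=> [la _] x; apply/cvgrPdist_le => /= e e0.
have d0 : 0 < e / (`|L| + 1) by rewrite divr_gt0// ltr_wpDl.
near=> y.
have xy : `|x - y| <= e / (`|L| + 1).
  by near: y; apply: cvgr_dist_le => //; exact: cvg_id.
apply: (le_trans (la x y)); apply: (le_trans (ler_norm _)).
rewrite normrM normr_id; apply: (@le_trans _ _ ((`|L| + 1) * (e / (`|L| + 1)))).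
  by apply: ler_pM => //; rewrite lerDl.
by rewrite mulrCA divff ?mulr1// gt_eqF// ltr_wpDl.
Unshelve. all: by end_near. Qed.

Lemma lipschitz_supp_L1 R (T L : R) (a : R -> R) :
  lipschitz_supp T L a -> L1 a.
Proof.
move=> la; have ca := lipschitz_supp_continuous la.
apply: eq_L1 (L1_restrict_itv (- T) T ca) => t; rewrite patchE; case: ifPn => // tn.
apply/esym; apply: la.2; rewrite ltNge; apply: contra tn => tn.
by rewrite inE/= in_itv/= -ler_norml.
Qed.

Lemma lipschitz_supp_bounded R (T L : R) (a : R -> R) (t : R) : 0 < T -> 0 <= L ->
  lipschitz_supp T L a -> `|a t| <= L * (3 * T).
Proof.
move=> T0 L0 [la a0]; have [tT|tT] := ltP T `|t|.
  by rewrite a0// normr0 mulr_ge0//; lra.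
have -> : a t = a t - a (2 * T).
  by rewrite (a0 (2 * T)) ?subr0// ger0_norm; lra.
apply: (le_trans (la _ _)); rewrite ler_wpM2l//.
by move: tT; rewrite !ler_norml => /andP[? ?]; apply/andP; split; lra.
Qed.

(** The Fourier transform of [exp (- e |x|)]. *)
Definition poisson R (e u : R) : R := 2 * e / (e ^+ 2 + u ^+ 2).

Lemma poisson_den_gt0 R (e u : R) : 0 < e -> 0 < e ^+ 2 + u ^+ 2.
Proof. by move=> e0; rewrite ltr_pwDl ?sqr_ge0// exprn_gt0. Qed.

Lemma poisson_ge0 R (e u : R) : 0 < e -> 0 <= poisson e u.
Proof. by move=> e0; rewrite divr_ge0// ltW// ?poisson_den_gt0// mulr_gt0. Qed.

Lemma continuous_poissonB R (e t : R) : 0 < e ->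
  continuous (fun s : R => poisson e (t - s)).
Proof.
move=> e0 s; apply: cvgM; first exact: cvg_cst.
apply: cvgV; first by rewrite gt_eqF// poisson_den_gt0.
apply: cvgD; first exact: cvg_cst.
by rewrite expr2; apply: cvgM; apply: cvgB; (try exact: cvg_cst); exact: cvg_id.
Qed.

Lemma Rint_poisson R (e t p q : R) : 0 < e -> p <= q ->
  \int[mu]_(s in `[p, q]) poisson e (t - s) =
  2 * (atan ((t - p) / e) - atan ((t - q) / e)).
Proof.
move=> e0 pq; pose F s := - 2 * atan ((t - s) / e).
have -> : 2 * (atan ((t - p) / e) - atan ((t - q) / e)) = F q - F p.
  by rewrite /F; ring.
apply: Rint_FTC => //; last exact: continuous_poissonB.
move=> x; apply: is_derive_eq; rewrite /GRing.scale/= /poisson.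
have := poisson_den_gt0 (t - x) e0 => /lt0r_neq0 en.
by field; rewrite en gt_eqF.
Qed.

(** A factor [|u|] is small against the Poisson kernel: [|u| <= h + u^2 / (4 h)]
    by the inequality of means, and [u^2] times the kernel is at most [2 e]. *)
Lemma poisson_abs R (e h u : R) : 0 < e -> 0 < h ->
  `|u| * poisson e u <= h * poisson e u + e / (2 * h).
Proof.
move=> e0 h0; have d0 := poisson_den_gt0 u e0; have p0 := poisson_ge0 u e0.
have hu : `|u| <= h + u ^+ 2 / (4 * h).
  have -> : h + u ^+ 2 / (4 * h) = `|u| + (`|u| - 2 * h) ^+ 2 / (4 * h).
    by rewrite -[u ^+ 2]real_normK ?num_real//; field; rewrite gt_eqF.
  by rewrite lerDl divr_ge0 ?sqr_ge0// mulr_ge0// ltW.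
apply: (le_trans (ler_wpM2r p0 hu)); rewrite mulrDl lerD2l.
rewrite /poisson.
have -> : u ^+ 2 / (4 * h) * (2 * e / (e ^+ 2 + u ^+ 2)) =
    e / (2 * h) * (u ^+ 2 / (e ^+ 2 + u ^+ 2)).
  by field; rewrite !gt_eqF.
rewrite ler_piMr//; first by rewrite divr_ge0 ?mulr_ge0// ltW.
by rewrite ler_pdivrMr// mul1r lerDr sqr_ge0.
Qed.

(** The boundary terms carry the factor [exp (- e ^- 2) <= e ^+ 2], in front of a
    quotient of size at most [2 / e]. *)
Lemma poissonW_cos_approx R (e u : R) : 0 < e ->
  `|\int[mu]_x (poissonW e (e ^- 3) x * cos (u * x)) - poisson e u| <= 4 * e.
Proof.
move=> e0; have X0 : 0 < e ^- 3 by rewrite invr_gt0 exprn_gt0.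
rewrite poissonW_cos//; have d0 := poisson_den_gt0 u e0.
set X := e ^- 3 in X0 *.
set N := u * sin (u * X) - e * cos (u * X).
have -> : 2 * (e + expR (- e * X) * N) / (e ^+ 2 + u ^+ 2) - poisson e u =
   2 * expR (- e * X) * (N / (e ^+ 2 + u ^+ 2)).
  by rewrite /poisson; field; rewrite gt_eqF.
have N1 : `|N / (e ^+ 2 + u ^+ 2)| <= 2 / e.
  rewrite normrM normfV (gtr0_norm d0) ler_pdivrMr//.
  apply: (@le_trans _ _ (`|u| + e)).
    rewrite /N (le_trans (ler_normB _ _))// !normrM (gtr0_norm e0).
    by apply: lerD; rewrite ler_piMr ?sin_max ?cos_max// ltW.
  have -> : 2 / e * (e ^+ 2 + u ^+ 2) = `|u| + e + (e - `|u| / 2) ^+ 2 / e + 7/4 * (`|u| ^+ 2 / e).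
    by rewrite -[u ^+ 2]real_normK ?num_real//; field; rewrite gt_eqF.
  have p1 : 0 <= (e - `|u| / 2) ^+ 2 / e by rewrite divr_ge0 ?sqr_ge0// ltW.
  have p2 : 0 <= `|u| ^+ 2 / e by rewrite divr_ge0 ?sqr_ge0// ltW.
  by lra.
have E1 : expR (- e * X) <= e ^+ 2.
  have -> : - e * X = - (e ^- 2) by rewrite /X; field; rewrite gt_eqF.
  rewrite expRN -[leRHS]invrK lef_pV2 ?posrE ?expR_gt0 ?invr_gt0 ?exprn_gt0//.
  by apply: le_trans (expR_ge1Dx _); rewrite lerDr.
rewrite normrM normrM (ger0_norm (expR_ge0 _)) ger0_norm//.
apply: (@le_trans _ _ (2 * e ^+ 2 * (2 / e))).
  by apply: ler_pM => //; rewrite ler_pM2l.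
by apply: le_of_eq; field; rewrite gt_eqF.
Qed.

(** The quadratic form of the Poisson kernel dominates the mass of the kernel
    times the squared norm, up to [O(h)]: replacing [a t * a s] by [a t ^+ 2]
    costs a multiple of [|t - s|], which [poisson_abs] absorbs.  For [t] in the
    support, the points [s] of modulus at most [2 T] carry a mass of at least
    [4 atan (T / e)], which tends to [2 pi]. *)
Lemma poisson_form_ge R (T L : R) (a : R -> R) : 0 < T -> 0 <= L ->
  lipschitz_supp T L a -> exists C : R, forall h, 0 < h <= 1 ->
  let e := h ^+ 2 in
  let K t s := \int[mu]_x (poissonW e (e ^- 3) x * cos ((t - s) * x)) in
  (forall t, L1 (fun s => a s * K t s)) -> L1 (fun t => a t * \int[mu]_s (a s * K t s)) ->
  4 * atan (T / e) * (\int[mu]_t (a t ^+ 2)) - C * h <=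
  \int[mu]_t (a t * \int[mu]_s (a s * K t s)).
Proof.
move=> T0 L0 la; have ca := lipschitz_supp_continuous la.
pose A := L * (3 * T).
have A0 : 0 <= A by rewrite /A mulr_ge0//; lra.
have aA t : `|a t| <= A by exact: lipschitz_supp_bounded.
have ia := lipschitz_supp_L1 la.
pose E := A * L * (2 * pi) + A * (L / 2 + A * 4) * (4 * T).
exists (E * (2 * T)) => h /andP[h0 h1] e K iK iaK.
have e0 : 0 < e by rewrite /e exprn_gt0.
have eh : e <= h by rewrite /e expr2 ler_piMr// ltW.
pose D : set R := [set` `[- T, T]].
have iD : L1 ((cst (E * h) : R -> R) \_ D) by apply: L1_restrict_itv; exact: cst_continuous.
have ia2 : L1 (fun t => a t ^+ 2).
  apply: eq_L1 (@L1_mul_bounded _ _ _ A (L1_measurable ia) aA ia) => t.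
  by rewrite expr2.
have -> : 4 * atan (T / e) * (\int[mu]_t (a t ^+ 2)) - E * (2 * T) * h =
   \int[mu]_t (4 * atan (T / e) * a t ^+ 2 - ((cst (E * h) : R -> R) \_ D) t).
  rewrite RintB//; last exact: L1Z.
  have -> : \int[mu]_t ((cst (E * h) : R -> R) \_ D) t = E * h * (T - - T).
    by rewrite -Rintegral_mkcond /cst Rint_cst_itv//; lra.
  by rewrite RintZ//; ring.
apply: le_Rint => //; first by apply: L1B => //; exact: L1Z.
move=> t; rewrite patchE; case: ifPn => tD; last first.
  rewrite la.2; first by rewrite expr0n/= mulr0 mul0r subr0.
  rewrite ltNge; apply: contra tD => tD.
  by rewrite /D inE/= in_itv/= -ler_norml.
move: tD; rewrite /D inE/= in_itv/= => /andP[t1 t2].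
rewrite -RintZ//.
pose g s := (a t ^+ 2 - A * L * h) * poisson e (t - s) - A * (L * (e / (2 * h)) + A * (4 * e)).
have cg : continuous g.
  move=> s; apply: cvgB; last exact: cvg_cst.
  by apply: cvgM; [exact: cvg_cst|exact: continuous_poissonB].
apply: (@le_trans _ _ (\int[mu]_s (g \_ `[- (2 * T), 2 * T]) s)); last first.
  apply: le_Rint; [exact: L1_restrict_itv|exact: L1Z|move=> s].
  rewrite patchE; case: ifPn => [sJ|sJ]; last first.
    rewrite (la.2 s) ?mul0r ?mulr0//.
    rewrite ltNge; apply: contra sJ; rewrite inE/= in_itv/= ler_norml => /andP[? ?].
    by apply/andP; split; lra.
  have KP : `|K t s - poisson e (t - s)| <= 4 * e by exact: poissonW_cos_approx.
  have p0 := poisson_ge0 (t - s) e0.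
  have pa := poisson_abs (t - s) e0 h0.
  have l1 : `|a t * (a t - a s)| <= A * (L * `|t - s|).
    by rewrite normrM; apply: ler_pM => //; exact: la.1.
  have l2 : `|a t * a s * (K t s - poisson e (t - s))| <= A * A * (4 * e).
    by rewrite !normrM; apply: ler_pM => //; apply: ler_pM.
  have -> : a t * (a s * K t s) = a t ^+ 2 * poisson e (t - s)
     - a t * (a t - a s) * poisson e (t - s)
     + a t * a s * (K t s - poisson e (t - s)) by ring.
  have l3 : a t * (a t - a s) * poisson e (t - s) <= A * L * (h * poisson e (t - s) + e / (2 * h)).
    apply: (@le_trans _ _ (A * (L * `|t - s|) * poisson e (t - s))).
      by apply: ler_wpM2r => //; apply: le_trans l1; exact: ler_norm.
    have -> : A * (L * `|t - s|) * poisson e (t - s) = A * L * (`|t - s| * poisson e (t - s)) by ring.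
    by apply: ler_wpM2l => //; rewrite mulr_ge0.
  move: l2; rewrite ler_norml => /andP[l2 _].
  rewrite /g; move: l2 l3.
  set x1 := a t * a s * _; set x2 := a t * (a t - a s) * _.
  set P := poisson _ _; set q := e / (2 * h).
  by move=> l2 l3; nra.
rewrite -Rintegral_mkcond.
have -> : \int[mu]_(s in `[- (2 * T), 2 * T]) g s =
  (a t ^+ 2 - A * L * h) * \int[mu]_(s in `[- (2 * T), 2 * T]) poisson e (t - s)
  - A * (L * (e / (2 * h)) + A * (4 * e)) * (4 * T).
  rewrite RintegralB//; last 2 first.
  - by apply: continuous_integrable_itv => s; apply: cvgM; [exact: cvg_cst|exact: continuous_poissonB].
  - by apply: continuous_integrable_itv; exact: cst_continuous.
  rewrite RintegralZl//; last by apply: continuous_integrable_itv; exact: continuous_poissonB.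
  rewrite Rint_cst_itv; last lra.
  by congr (_ - _ * _); ring.
rewrite Rint_poisson//; last lra.
set x := (t - - (2 * T)) / e; set y := (t - 2 * T) / e.
have x1 : atan (T / e) <= atan x.
  by apply: le_atan; rewrite /x ler_pM2r ?invr_gt0//; lra.
have y1 : atan y <= - atan (T / e).
  by rewrite -atanN; apply: le_atan; rewrite /y -[- (T / e)]mulNr ler_pM2r ?invr_gt0//; lra.
have x2 := atan_ltpi2 x; have y2 := atan_gtNpi2 y.
have -> : e / (2 * h) = h / 2 by rewrite /e; field; rewrite gt_eqF.
have b1 : 4 * atan (T / e) * a t ^+ 2 <= a t ^+ 2 * (2 * (atan x - atan y)).
  by rewrite mulrC ler_wpM2l ?sqr_ge0//; lra.
have b2 : A * L * h * (2 * (atan x - atan y)) <= A * L * h * (2 * pi).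
  by apply: ler_wpM2l; [rewrite !mulr_ge0// ltW|lra].
have b3 : A * A * T * e <= A * A * T * h by rewrite ler_wpM2l// !mulr_ge0// ltW.
rewrite /E /cst; move: b1 b2 b3; set w := atan x - atan y.
by rewrite mulrBl => b1 b2 b3; lra.
Qed.

Lemma poissonW_L1 R (e X : R) : L1 (poissonW e X).
Proof. apply: L1_restrict_itv; exact: continuous_poisson. Qed.

Lemma L1_mul_comp2 R (W f g : R -> R) (t s : R) : continuous f ->
  continuous g -> (forall x, `|f x| <= 1) -> (forall x, `|g x| <= 1) -> L1 W ->
  L1 (fun x => W x * (f (t * x) * g (s * x))).
Proof.
move=> cf cg f1 g1 iW; apply: eq_L1 (L1_mul_comp s cg g1 (L1_mul_comp t cf f1 iW)) => x.
by rewrite mulrA.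
Qed.

(** Expanding [cos ((t - s) x)] separates the variables. *)
Lemma poisson_form R (W a b : R -> R) : L1 W -> L1 a -> L1 b ->
  let K t s := \int[mu]_x (W x * cos ((t - s) * x)) in
  [/\ L1 (fun x => W x * (cosT a x * cosT b x + sinT a x * sinT b x)),
      forall t, L1 (fun s => b s * K t s),
      L1 (fun t => a t * \int[mu]_s (b s * K t s)) &
   \int[mu]_x (W x * (cosT a x * cosT b x + sinT a x * sinT b x)) =
   \int[mu]_t (a t * \int[mu]_s (b s * K t s))].
Proof.
move=> iW ia ib K; have cc := @continuous_cos R; have cs := @continuous_sin R.
have c1 := @cos_max R; have s1 := @sin_max R.
have [i1 i2 i3 E1] := bilinear_swap iW ia ib cc cc c1 c1.
have [j1 j2 j3 E2] := bilinear_swap iW ia ib cs cs s1 s1.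
have Kt t s : K t s = \int[mu]_x (W x * (cos (t * x) * cos (s * x))) +
    \int[mu]_x (W x * (sin (t * x) * sin (s * x))).
  rewrite -RintD; [|exact: L1_mul_comp2|exact: L1_mul_comp2].
  by apply: eq_Rint => x; rewrite mulrBl cosB mulrDr.
have in1 t : \int[mu]_s (b s * K t s) =
    \int[mu]_s (b s * \int[mu]_x (W x * (cos (t * x) * cos (s * x)))) +
    \int[mu]_s (b s * \int[mu]_x (W x * (sin (t * x) * sin (s * x)))).
  by apply: (Rint_addE (i2 t) (j2 t)) => s; rewrite Kt mulrDr.
split.
- by apply: eq_L1 (L1D i1 j1) => x; rewrite mulrDr.
- by move=> t; apply: eq_L1 (L1D (i2 t) (j2 t)) => s; rewrite Kt mulrDr.
- by apply: eq_L1 (L1D i3 j3) => t; rewrite in1 mulrDr.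
- etransitivity.
    by apply: (Rint_addE i1 j1) => x; rewrite mulrDr.
  etransitivity; first exact: (f_equal2 +%R E1 E2).
  by apply/esym; apply: (Rint_addE i3 j3) => t; rewrite in1 mulrDr.
Qed.

(** The cross terms in the squared modulus of the transform of [a + i b] vanish
    because the weight is even. *)
Lemma poisson_cross R (e X : R) (a b : R -> R) : 0 < e -> 0 < X -> L1 a -> L1 b ->
  L1 (fun x => poissonW e X x * (sinT a x * cosT b x - cosT a x * sinT b x)) /\
   \int[mu]_x (poissonW e X x * (sinT a x * cosT b x - cosT a x * sinT b x)) = 0.
Proof.
move=> e0 X0 ia ib; have cc := @continuous_cos R; have cs := @continuous_sin R.
have iW := @poissonW_L1 R e X; set W := poissonW e X in iW *.
have c1 := @cos_max R; have s1 := @sin_max R.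
have [i1 i2 i3 E1] := bilinear_swap iW ia ib cs cc s1 c1.
have [j1 j2 j3 E2] := bilinear_swap iW ia ib cc cs c1 s1.
have Kt t s : \int[mu]_x (W x * (sin (t * x) * cos (s * x))) =
    \int[mu]_x (W x * (cos (t * x) * sin (s * x))).
  apply/eqP; rewrite -subr_eq0 -RintB; [|exact: L1_mul_comp2|exact: L1_mul_comp2].
  apply/eqP; rewrite -(poissonW_sin (t - s) e0 X0); apply: eq_Rint => x.
  by rewrite mulrBl sinB mulrBr.
split; first by apply: eq_L1 (L1B i1 j1) => x; rewrite mulrBr.
etransitivity; first by apply: (Rint_subE i1 j1) => x; rewrite mulrBr.
etransitivity; first exact: (f_equal2 (fun x y => x - y) E1 E2).
apply/eqP; rewrite subr_eq0; apply/eqP; apply: eq_Rint => t.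
by apply: (f_equal (fun z => a t * z)); apply: eq_Rint => s; rewrite Kt.
Qed.

(** The squared modulus of the Fourier transform of [a + i b]. *)
Definition sqft R (a b : R -> R) (x : R) : R :=
  (cosT a x - sinT b x) ^+ 2 + (sinT a x + cosT b x) ^+ 2.

(** The weight [exp (- e |x|)] is at most one, so [poisson_form_ge] bounds the
    right-hand side from below for every [e]; let [e] tend to zero. *)
Lemma plancherel_ge R (T L : R) (a b : R -> R) : 0 < T -> 0 <= L ->
  lipschitz_supp T L a -> lipschitz_supp T L b -> L1 (sqft a b) ->
  2 * pi * \int[mu]_t (a t ^+ 2 + b t ^+ 2) <= \int[mu]_x sqft a b x.
Proof.
move=> T0 L0 la lb iab.
have ia := lipschitz_supp_L1 la; have ib := lipschitz_supp_L1 lb.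
have [Ca Ha] := poisson_form_ge T0 L0 la.
have [Cb Hb] := poisson_form_ge T0 L0 lb.
have i2 c : lipschitz_supp T L c -> L1 (fun t => c t ^+ 2).
  move=> lc; have ic := lipschitz_supp_L1 lc.
  apply: eq_L1 (L1_mul_bounded (L1_measurable ic) (fun t => lipschitz_supp_bounded t T0 L0 lc) ic) => t.
  by rewrite expr2.
rewrite RintD; [|exact: i2|exact: i2].
set N := _ + _; set M := \int[mu]_x _.
have key h : 0 < h <= 1 -> 4 * atan (T / h ^+ 2) * N - (Ca + Cb) * h <= M.
  move=> hh; have /andP[h0 _] := hh.
  have e0 : 0 < h ^+ 2 by rewrite exprn_gt0.
  have X0 : 0 < (h ^+ 2) ^- 3 by rewrite invr_gt0 exprn_gt0.
  pose W := poissonW (h ^+ 2) ((h ^+ 2) ^- 3); have iW : L1 W by exact: poissonW_L1.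
  have [a1 a2 a3 Ea] := poisson_form iW ia ia.
  have [b1 b2 b3 Eb] := poisson_form iW ib ib.
  have [c1 Ec] := poisson_cross e0 X0 ia ib.
  have := Ha h hh a2 a3; rewrite -Ea => {}Ha.
  have := Hb h hh b2 b3; rewrite -Eb => {}Hb.
  apply: (@le_trans _ _ (\int[mu]_x (W x * sqft a b x))).
    have -> : \int[mu]_x (W x * sqft a b x) =
      \int[mu]_x (W x * (cosT a x * cosT a x + sinT a x * sinT a x)) +
      \int[mu]_x (W x * (cosT b x * cosT b x + sinT b x * sinT b x)) +
      2 * \int[mu]_x (W x * (sinT a x * cosT b x - cosT a x * sinT b x)).
      rewrite -RintZ//; etransitivity.
        apply: (Rint_addE (L1D a1 b1) (L1Z 2 c1)) => x; rewrite /sqft -/W.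
        by move: (W x) (cosT a x) (sinT b x) (sinT a x) (cosT b x) => *; ring.
      by apply: (f_equal (fun z => z + _)); apply: (Rint_addE a1 b1).
    rewrite [X in _ + 2 * X]Ec mulr0 addr0.
    apply: le_trans (lerD Ha Hb); apply: le_of_eq.
    by rewrite /N mulrDr [(Ca + Cb) * h]mulrDl opprD addrACA.
  have W1 x : 0 <= W x <= 1.
    rewrite /W /poissonW patchE; case: ifP => _; last by rewrite lexx ler01.
    rewrite expR_ge0/= -[leRHS]expR0 ler_expR lerNl oppr0.
    by rewrite mulr_ge0// ltW.
  have mW : measurable_fun setT W by exact: L1_measurable.
  apply: le_Rint => //.
    apply: (@L1_mul_bounded _ _ _ 1) => // x.
    by have /andP[? ?] := W1 x; rewrite ger0_norm.
  move=> x; have /andP[? ?] := W1 x; rewrite ler_piMl//.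
  by rewrite addr_ge0// sqr_ge0.
have N0 : 0 <= N by rewrite addr_ge0// Rint_ge0// => x; exact: sqr_ge0.
rewrite leNgt; apply/negP => NM.
pose d := 2 * pi * N - M.
have d0 : 0 < d by rewrite subr_gt0.
pose r := d / (8 * (N + 1)).
have r0 : 0 < r by rewrite divr_gt0// mulr_gt0// ltr_wpDl.
have : \forall x \near +oo, pi / 2 - r < atan x.
  by apply: (cvgr_gt (pi / 2)); [exact: cvgy_atan|rewrite ltrBlDr ltrDl].
move=> [B [_ HB]].
pose h := Num.min 1 (Num.min (T / (`|B| + 1)) (d / (4 * (`|Ca + Cb| + 1)))).
have h0 : 0 < h.
  rewrite !lt_min ltr01 /= !divr_gt0// ?mulr_gt0//; exact: ltr_wpDl.
have h1 : h <= 1 by rewrite ge_min lexx.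
have hT : h <= T / (`|B| + 1) by rewrite !ge_min lexx /= orbT.
have hC : h <= d / (4 * (`|Ca + Cb| + 1)) by rewrite !ge_min lexx !orbT.
have := key h; rewrite h0 h1 => /(_ isT).
have : pi / 2 - r < atan (T / h ^+ 2).
  apply: HB; apply: (@lt_le_trans _ _ (`|B| + 1)).
    by apply: le_lt_trans (ler_norm _) _; rewrite ltrDl.
  rewrite ler_pdivlMr ?exprn_gt0//.
  move: hT; rewrite ler_pdivlMr ?ltr_wpDl// mulrC => hT; apply: le_trans hT.
  by rewrite ler_wpM2l ?addr_ge0// expr2 ler_piMr// ltW.
have q1 : (Ca + Cb) * h <= d / 4.
  apply: (@le_trans _ _ (`|Ca + Cb| * h)); first by rewrite ler_wpM2r ?ler_norm// ltW.
  move: hC; rewrite ler_pdivlMr ?mulr_gt0 ?ltr_wpDl// => hC.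
  rewrite ler_pdivlMr//; apply: le_trans hC.
  rewrite [leLHS](_ : _ = h * (4 * `|Ca + Cb|)); last by ring.
  by rewrite ler_wpM2l ?(ltW h0)// ler_wpM2l// lerDl.
have q2 : 4 * r * N <= d / 2.
  rewrite /r ler_pdivlMr// mulrAC [4 * _]mulrC -!mulrA ler_piMr// ?(ltW d0)//.
  rewrite invfM mulrCA.
  have : N / (N + 1) <= 1 by rewrite ler_pdivrMr ?mul1r ?lerDl// ltr_wpDl.
  have : 0 <= N / (N + 1) by rewrite divr_ge0// addr_ge0.
  lra.
move=> l1 l2.
have : (pi / 2 - r) * N <= atan (T / h ^+ 2) * N by rewrite ler_wpM2r// ltW.
rewrite /d in q1 q2 d0 *; move: q1 q2 d0 l2.
by nra.
Qed.

(** * Hermitian forms *)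

Local Open Scope complex_scope.

Definition sqmod R (z : R[i]) : R := complex.Re z ^+ 2 + complex.Im z ^+ 2.

Lemma sqmodE R (z : R[i]) : (sqmod z)%:C = z * z^*.
Proof. by case: z => x y; rewrite /sqmod/=; apply/eqP; rewrite eq_complex/=; apply/andP; split; apply/eqP; ring. Qed.

Lemma sqmod_ge0 R (z : R[i]) : 0 <= sqmod z.
Proof. by rewrite addr_ge0// sqr_ge0. Qed.

Lemma sqmodM R (z w : R[i]) : sqmod (z * w) = sqmod z * sqmod w.
Proof. by case: z w => [x y] [x' y']; rewrite /sqmod/=; ring. Qed.

Lemma sqmod_conj R (z : R[i]) : sqmod z^* = sqmod z.
Proof. by case: z => x y; rewrite /sqmod/= sqrrN. Qed.

Lemma sqmod_real R (x : R) : sqmod x%:C = x ^+ 2.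
Proof. by rewrite /sqmod/= expr0n addr0. Qed.

Lemma Re_amgm R (l : R) (z w : R[i]) : 0 < l ->
  `|complex.Re (z * w)| <= (l * sqmod z + sqmod w / l) / 2.
Proof.
move=> l0; have [x [y xE]] : exists x y, z = x +i* y by case: z => x y; exists x, y.
have [x' [y' wE]] : exists x y, w = x +i* y by case: w => x' y'; exists x', y'.
rewrite {}xE {}wE /sqmod/=.
have e1 : (l * (x ^+ 2 + y ^+ 2) + (x' ^+ 2 + y' ^+ 2) / l) / 2 =
   (x * x' - y * y') + ((l * x - x') ^+ 2 + (l * y + y') ^+ 2) / (2 * l).
  by field; rewrite gt_eqF.
have e2 : (l * (x ^+ 2 + y ^+ 2) + (x' ^+ 2 + y' ^+ 2) / l) / 2 =
   - (x * x' - y * y') + ((l * x + x') ^+ 2 + (l * y - y') ^+ 2) / (2 * l).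
  by field; rewrite gt_eqF.
have p a b : 0 <= (a ^+ 2 + b ^+ 2) / (2 * l).
  by rewrite divr_ge0 ?addr_ge0 ?sqr_ge0// mulr_ge0// ltW.
have := p (l * x - x') (l * y + y'); have := p (l * x + x') (l * y - y').
by rewrite ler_norml; move=> p1 p2; apply/andP; split; lra.
Qed.

Lemma Re_sum R (I : Type) (s : seq I) (P : pred I) (f : I -> R[i]) :
  complex.Re (\sum_(i <- s | P i) f i) = \sum_(i <- s | P i) complex.Re (f i).
Proof. by apply: (big_morph _ _ _) => // -[? ?] [? ?]. Qed.

Lemma Im_sum R (I : Type) (s : seq I) (P : pred I) (f : I -> R[i]) :
  complex.Im (\sum_(i <- s | P i) f i) = \sum_(i <- s | P i) complex.Im (f i).
Proof. by apply: (big_morph _ _ _) => // -[? ?] [? ?]. Qed.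

Lemma conjc_sum R (I : Type) (s : seq I) (P : pred I) (f : I -> R[i]) :
  (\sum_(i <- s | P i) f i)^* = \sum_(i <- s | P i) (f i)^*.
Proof. exact: raddf_sum. Qed.

Lemma realc_sum R (I : Type) (s : seq I) (P : pred I) (f : I -> R) :
  (\sum_(i <- s | P i) f i)%:C = \sum_(i <- s | P i) (f i)%:C :> R[i].
Proof. exact: rmorph_sum. Qed.

Definition unitary_family R (N : nat) (p : 'I_N -> 'I_N -> R[i]) : Prop :=
  (forall k l, \sum_j p k j * (p l j)^* = (k == l)%:R) /\
  (forall i j, \sum_k (p k i)^* * p k j = (i == j)%:R).

(** The spectral theorem, read on vectors: a Gram matrix becomes diagonal after
    a unitary change of the family. *)
Lemma spectral_family R (N : nat) (G : 'I_N -> 'I_N -> R[i]) :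
  (forall i j, G i j = (G j i)^*) ->
  exists (p : 'I_N -> 'I_N -> R[i]) (g : 'I_N -> R), unitary_family p /\
   forall k l, \sum_i \sum_j p k i * G i j * (p l j)^* = (g k)%:C *+ (k == l).
Proof.
move=> Gh; pose A : 'M[R[i]]_N := \matrix_(i, j) G i j.
have Ah : A \is hermsymmx.
  apply/is_hermitianmxP; rewrite expr0 scale1r; apply/matrixP => i j.
  by rewrite !mxE Gh.
have An := hermitian_normalmx Ah.
have Dr := hermitian_spectral_diag_real Ah.
have AE := orthomx_spectralP An.
have Pu := spectral_unitarymx A.
set P := spectralmx A in AE Pu.
set D := spectral_diag A in AE Dr.
have PPt : P *m (P ^t*)%sesqui = 1%:M by apply/unitarymxP.
have PtP : (P ^t*)%sesqui *m P = 1%:M by apply: mulmx1C.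
have PAP : P *m A *m (P ^t*)%sesqui = diag_mx D.
  rewrite AE invmx_unitary// !mulmxA PPt mul1mx -mulmxA PPt mulmx1//.
exists (fun k j => P k j), (fun k => complex.Re (D 0 k)); split; first split.
- move=> k l; have /matrixP/(_ k l) := PPt; rewrite !mxE => <-.
  by apply: eq_bigr => j _; rewrite !mxE.
- move=> i j; have /matrixP/(_ i j) := PtP; rewrite !mxE => <-.
  by apply: eq_bigr => k _; rewrite !mxE.
- move=> k l; have /matrixP/(_ k l) := PAP; rewrite !mxE.
  have -> : (complex.Re (D 0 k))%:C = D 0 k.
    by apply: RRe_real; have /mxOverP/(_ 0 k) := Dr.
  move=> <-; rewrite exchange_big /=; apply: eq_bigr => j _; rewrite !mxE mulr_suml.
  by apply: eq_bigr => i _; rewrite !mxE.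
Qed.

(** Testing the hypothesis on [conj (psi k) / (g k + l)] gives [b^2 <= m b] for
    the sum [b] to be bounded; [l] makes the division harmless where [g k]
    vanishes. *)
Lemma bessel_regularized R (N : nat) (g : 'I_N -> R) (psi : 'I_N -> R[i]) (l m : R) :
  0 < l -> (forall k, 0 <= g k) ->
  (forall a : 'I_N -> R[i], sqmod (\sum_k a k * psi k) <= m * \sum_k sqmod (a k) * g k) ->
  0 <= m -> \sum_k sqmod (psi k) / (g k + l) <= m.
Proof.
move=> l0 g0 H m0; set b := \sum_k _.
have gl k : 0 < g k + l by rewrite ltr_wpDl.
have b0 : 0 <= b by apply: sumr_ge0 => k _; rewrite divr_ge0 ?sqmod_ge0// ltW.
have := H (fun k => (psi k)^* * ((g k + l)^-1)%:C).
have -> : \sum_k (psi k)^* * ((g k + l)^-1)%:C * psi k = b%:C.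
  rewrite realc_sum; apply: eq_bigr => k _.
  by rewrite rmorphM/= sqmodE mulrAC [psi k * _]mulrC.
have : \sum_k sqmod ((psi k)^* * ((g k + l)^-1)%:C) * g k <= b.
  apply: ler_sum => k _; rewrite sqmodM sqmod_conj sqmod_real -mulrA ler_wpM2l ?sqmod_ge0//.
  rewrite expr2 -mulrA ler_piMr ?invr_ge0 ?(ltW (gl k))// mulrC ler_pdivrMr// mul1r lerDl.
  exact: ltW.
set S := \sum_k _ => Sb; rewrite sqmod_real => bS.
have [->//|bn] := eqVneq b 0.
have bp : 0 < b by rewrite lt_def bn.
rewrite -(ler_pM2r bp) -expr2; apply: (le_trans bS); exact: ler_wpM2l.
Qed.

(** The [j]-th column of [p] is [psi] up to the image of the defect [e].
    Testing the
    hypothesis on [a k = conj (p k j) / (g k + l)] and splitting both products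
    by the inequality of means gives
    [b <= (A + m) / 2 + (l B + |e|^2 / l) / 2] for the sum [b] to be bounded,
    where [A + l B = b]. *)
Lemma resolvent_coordinate R (N : nat) (p : 'I_N -> 'I_N -> R[i])
    (g : 'I_N -> R) (psi e : 'I_N -> R[i]) (j : 'I_N) (l m : R) :
  unitary_family p -> 0 < l -> (forall k, 0 <= g k) -> 0 <= m ->
  (forall a : 'I_N -> R[i], sqmod (\sum_k a k * psi k) <= m * \sum_k sqmod (a k) * g k) ->
  (forall k, psi k = p k j + \sum_i p k i * e i) ->
  \sum_k sqmod (p k j) / (g k + l) <= m + (\sum_i sqmod (e i)) / l.
Proof.
move=> [prow pcol] l0 g0 m0 H psiE; set b := \sum_k _.
have gl k : 0 < g k + l by rewrite ltr_wpDl.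
pose a k : R[i] := (p k j)^* * ((g k + l)^-1)%:C.
pose w i : R[i] := \sum_k a k * p k i.
pose A := \sum_k sqmod (a k) * g k; pose B := \sum_k sqmod (a k).
have sqa k : sqmod (a k) = sqmod (p k j) / (g k + l) ^+ 2.
  by rewrite /a sqmodM sqmod_conj sqmod_real exprVn.
have AB : A + l * B = b.
  rewrite /A /B mulr_sumr -big_split/=; apply: eq_bigr => k _.
  by rewrite sqa; field; rewrite gt_eqF.
have wB : \sum_i sqmod (w i) = B.
  have conjw i : (w i)^* = \sum_k (a k)^* * (p k i)^*.
    by etransitivity; [exact: conjc_sum|apply: eq_bigr => k _; exact: rmorphM].
  apply: complexI; rewrite !realc_sum.
  transitivity (\sum_i \sum_k \sum_k' a k * p k i * ((a k')^* * (p k' i)^*)).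
    apply: eq_bigr => i _; etransitivity; first exact: sqmodE.
    etransitivity; first exact: (f_equal (fun z => w i * z) (conjw i)).
    rewrite /w mulr_suml; apply: eq_bigr => k _.
    by rewrite mulr_sumr.
  rewrite exchange_big /=; apply: eq_bigr => k _.
  rewrite exchange_big /= (bigD1 k)//= [X in _ + X]big1 ?addr0.
    transitivity (a k * (a k)^* * \sum_i p k i * (p k i)^*).
      rewrite mulr_sumr; apply: eq_bigr => i _.
      by rewrite mulrACA.
    by rewrite prow eqxx mulr1 sqmodE.
  move=> k' kk'; transitivity (a k * (a k')^* * \sum_i p k i * (p k' i)^*).
    rewrite mulr_sumr; apply: eq_bigr => i _.
    by rewrite mulrACA.
  by rewrite prow eq_sym (negPf kk') mulr0.
have bE : \sum_k a k * psi k = b%:C + \sum_i w i * e i.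
  under eq_bigr => k _ do rewrite psiE mulrDr.
  rewrite big_split/=; congr (_ + _).
    rewrite realc_sum; apply: eq_bigr => k _; rewrite /a rmorphM/= sqmodE.
    by rewrite mulrAC [p k j * _]mulrC.
  under eq_bigr => k _ do rewrite mulr_sumr.
  rewrite exchange_big/=; apply: eq_bigr => i _; rewrite /w mulr_suml.
  by apply: eq_bigr => k _; rewrite mulrA.
set Z := \sum_k a k * psi k in bE.
have ReZ : complex.Re Z <= (A + m) / 2.
  have := H a; rewrite -/Z -/A => HZ.
  have A0 : 0 <= A by apply: sumr_ge0 => k _; rewrite mulr_ge0// sqmod_ge0.
  have : complex.Re Z ^+ 2 <= m * A by apply: le_trans HZ; rewrite lerDl sqr_ge0.
  rewrite leNgt => RZ; rewrite leNgt; apply: contra_notN (negP RZ) => lt.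
  have h0 : 0 <= (A + m) / 2 by rewrite divr_ge0// addr_ge0.
  apply: (@le_lt_trans _ _ (((A + m) / 2) ^+ 2)).
    have -> : ((A + m) / 2) ^+ 2 = m * A + ((A - m) / 2) ^+ 2 by field.
    by rewrite lerDl sqr_ge0.
  by rewrite ltr_pXn2r// nnegrE// ltW// (le_lt_trans h0).
have ReW : - complex.Re (\sum_i w i * e i) <= (l * B + (\sum_i sqmod (e i)) / l) / 2.
  rewrite Re_sum -sumrN -wB mulr_sumr mulr_suml -big_split mulr_suml/=.
  apply: ler_sum => i _.
  by apply: le_trans (Re_amgm _ _ l0); rewrite -normrN ler_norm.
have : complex.Re Z = b + complex.Re (\sum_i w i * e i) by rewrite bE raddfD.
by lra.
Qed.

(** * Complex-valued integrable functions *)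

Definition re R (F : R -> R[i]) (t : R) : R := complex.Re (F t).
Definition im R (F : R -> R[i]) (t : R) : R := complex.Im (F t).

Definition CL1 R (F : R -> R[i]) : Prop := L1 (re F) /\ L1 (im F).

Lemma Cintegral_comb R (N : nat) (c : 'I_N -> R[i]) (F : 'I_N -> R -> R[i]) :
  (forall j, CL1 (F j)) ->
  Cintegral (fun t => \sum_j c j * F j t) = \sum_j c j * Cintegral (F j).
Proof.
move=> iF; apply/eqP; rewrite eq_complex Re_sum Im_sum; apply/andP; split; apply/eqP.
  transitivity (\int[mu]_t \sum_j (complex.Re (c j) * re (F j) t - complex.Im (c j) * im (F j) t)).
    apply: eq_Rint => t; rewrite Re_sum; apply: eq_bigr => j _.
    by rewrite /re /im; case: (c j) (F j t) => ? ? [].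
  rewrite Rint_sum; last by move=> j; apply: L1B; apply: L1Z; apply iF.
  apply: eq_bigr => j _; rewrite RintB; [|by apply: L1Z; apply iF|by apply: L1Z; apply iF].
  by rewrite !RintZ; [|apply iF|apply iF]; case: (c j).
transitivity (\int[mu]_t \sum_j (complex.Re (c j) * im (F j) t + complex.Im (c j) * re (F j) t)).
  apply: eq_Rint => t; rewrite Im_sum; apply: eq_bigr => j _.
  by rewrite /re /im; case: (c j) (F j t) => ? ? [].
rewrite Rint_sum; last by move=> j; apply: L1D; apply: L1Z; apply iF.
apply: eq_bigr => j _; rewrite RintD; [|by apply: L1Z; apply iF|by apply: L1Z; apply iF].
by rewrite !RintZ; [|apply iF|apply iF]; case: (c j).
Qed.

Lemma L1_cos R (F : R -> R) (x : R) : L1 F -> L1 (fun t => F t * cos (t * x)).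
Proof.
move=> iF; apply: eq_L1 (L1_mul_comp x (@continuous_cos R) (@cos_max R) iF) => t.
by rewrite [t * x]mulrC.
Qed.

Lemma L1_sin R (F : R -> R) (x : R) : L1 F -> L1 (fun t => F t * sin (t * x)).
Proof.
move=> iF; apply: eq_L1 (L1_mul_comp x (@continuous_sin R) (@sin_max R) iF) => t.
by rewrite [t * x]mulrC.
Qed.

Lemma CL1_expi R (F : R -> R[i]) (x : R) :
  CL1 F -> CL1 (fun t => expi (t * x) * F t).
Proof.
move=> [i1 i2]; split.
  apply: eq_L1 (L1B (L1_cos x i1) (L1_sin x i2)) => t.
  by rewrite /re /im /expi; case: (F t) => ? ? /=; rewrite mulrC [_ * sin _]mulrC.
apply: eq_L1 (L1D (L1_sin x i1) (L1_cos x i2)) => t.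
by rewrite /re /im /expi; case: (F t) => a b /=; ring.
Qed.

Lemma fourierE R (F : R -> R[i]) (x : R) : CL1 F ->
  fourier F x = (cosT (re F) x - sinT (im F) x) +i* (sinT (re F) x + cosT (im F) x).
Proof.
move=> [i1 i2]; rewrite /fourier /Cintegral; apply: (f_equal2 (@Complex R)).
  apply: (Rint_subE (L1_cos x i1) (L1_sin x i2)) => t.
  by rewrite /re /im /expi; case: (F t) => a b /=; ring.
apply: (Rint_addE (L1_sin x i1) (L1_cos x i2)) => t.
by rewrite /re /im /expi; case: (F t) => a b /=; ring.
Qed.

Lemma fourier_comb R (N : nat) (c : 'I_N -> R[i]) (F : 'I_N -> R -> R[i]) (x : R) :
  (forall j, CL1 (F j)) ->
  fourier (fun t => \sum_j c j * F j t) x = \sum_j c j * fourier (F j) x.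
Proof.
move=> iF; rewrite /fourier -Cintegral_comb; last by move=> j; exact: CL1_expi.
apply: (f_equal (fun g => Cintegral g)); apply/funext => t.
by rewrite mulr_sumr; apply: eq_bigr => j _; rewrite mulrCA.
Qed.

Lemma Cintegral_conj R (F : R -> R[i]) : CL1 F ->
  Cintegral (fun t => (F t)^*) = (Cintegral F)^*.
Proof.
move=> [i1 i2]; rewrite /Cintegral /=; apply: (f_equal2 (@Complex R)).
  by apply: eq_Rint => t; case: (F t).
rewrite -RintN//; apply: eq_Rint => t; rewrite /im; by case: (F t).
Qed.

(** * Convolution with a triangle *)

Definition conv R (a : R) (F : R -> R) (t : R) : R :=
  \int[mu]_u (F u * hat a (t - u)).

Lemma L1_hat_mul R (a t : R) (F : R -> R) : 0 < a -> L1 F ->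
  L1 (fun u => F u * hat a (t - u)).
Proof.
move=> a0 iF; apply: (@eq_L1 _ (fun u => hat a (t - u) * F u)); first by move=> u; rewrite mulrC.
apply: (@L1_mul_bounded _ _ _ a^-1) => //.
  apply: (measurableT_comp (continuous_measurable_fun (@continuous_hat R a))).
  exact: measurable_funB.
by move=> u; rewrite ger0_norm ?hat_ge0// hat_le.
Qed.

Lemma conv_support R (a t : R) (F : R -> R) : 0 < a ->
  conv a F t != 0 -> exists u, F u != 0 /\ `|t - u| <= a.
Proof.
move=> a0; apply: contra_neqP => /forallNP H.
rewrite /conv -[RHS](Rint0 R); apply: eq_Rint => u.
have [->|Fu] := eqVneq (F u) 0; first by rewrite mul0r.
have [ta|ta] := leP `|t - u| a; first by case: (H u).
by rewrite hat_out ?mulr0// ltW.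
Qed.

Definition lip R (T : R) (a : R -> R) : Prop :=
  exists2 L, 0 <= L & lipschitz_supp T L a.

(** The triangle is Lipschitz, hence so is the convolution: this makes spectra
    regular enough for [plancherel_ge]. *)
Lemma conv_lip R (a T : R) (F : R -> R) : 0 < a -> L1 F ->
  (forall u, T < `|u| -> F u = 0) -> lip (T + a) (conv a F).
Proof.
move=> a0 iF FT; exists (a ^- 2 * \int[mu]_u `|F u|).
  by rewrite mulr_ge0 ?invr_ge0 ?sqr_ge0// Rint_ge0.
split.
  move=> s t; rewrite /conv -RintB; [|exact: L1_hat_mul|exact: L1_hat_mul].
  apply: le_trans (norm_Rint _) _; first by apply: L1B; exact: L1_hat_mul.
  apply: (@le_trans _ _ (\int[mu]_u (a ^- 2 * `|s - t| * `|F u|))).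
    apply: le_Rint.
    - by apply: L1_norm; apply: L1B; exact: L1_hat_mul.
    - by apply: L1Z; exact: L1_norm.
    - move=> u; rewrite -mulrBr normrM mulrC ler_wpM2r//.
      apply: le_trans (hat_lip _ _ a0) _.
      by have -> : s - u - (t - u) = s - t by ring.
  by rewrite RintZ; [rewrite mulrAC|exact: L1_norm].
move=> t tT; apply/eqP/negPn/negP => /(conv_support a0)[u [Fu tu]].
move: Fu; rewrite FT ?eqxx//.
have := ler_normD (t - u) u; rewrite subrK => h.
by have := lt_le_trans tT h; lra.
Qed.

Lemma lip_L1 R (T : R) (a : R -> R) : lip T a -> L1 a.
Proof. by move=> [L _]; exact: lipschitz_supp_L1. Qed.

(** A convolution is paired with [f] by moving the triangle onto [f]; it will be
    applied to cosines and sines, which are eigenfunctions of the triangle. *)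
Lemma conv_pairing R (a T c : R) (F f : R -> R) : 0 < a -> L1 F ->
  (forall u, T < `|u| -> F u = 0) -> continuous f -> L1 (fun u => F u * f u) ->
  (forall u, \int[mu]_t (hat a (t - u) * f t) = c * f u) ->
  \int[mu]_t (conv a F t * f t) = c * \int[mu]_u (F u * f u).
Proof.
move=> a0 iF FT cf iFf Hf; have lF := conv_lip a0 iF FT.
pose D : set R := [set` `[- (T + a), T + a]].
have iG : L1 (f \_ D) by exact: L1_restrict_itv.
have mw : measurable_fun setT (fun p : R * R => hat a (p.1 - p.2)).
  apply: (measurableT_comp (continuous_measurable_fun (@continuous_hat R a))).
  exact: measurable_funB.
have wK (p : R * R) : `|hat a (p.1 - p.2)| <= a^-1.
  by rewrite ger0_norm ?hat_ge0// hat_le.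
have inner u : F u != 0 -> \int[mu]_t ((f \_ D) t * hat a (t - u)) = c * f u.
  move=> Fu; rewrite -Hf; clear Hf iFf; apply: eq_Rint => t.
  rewrite patchE mulrC; case: ifPn => // tD.
  rewrite hat_out ?mul0r// leNgt; apply: contra tD => tu.
  have uT : `|u| <= T by rewrite leNgt; apply: contra_neqN Fu => /FT.
  rewrite /D inE/= in_itv/= -ler_norml.
  by have := ler_normD (t - u) u; rewrite subrK; lra.
transitivity (\int[mu]_t ((f \_ D) t * \int[mu]_u (F u * hat a (t - u)))).
  apply: eq_Rint => t; rewrite patchE; case: ifPn => [_|tD]; first by rewrite mulrC.
  rewrite mul0r; have [L _ [_ ->]] := lF; first by rewrite mul0r.
  rewrite ltNge; apply: contra tD => tD.
  by rewrite /D inE/= in_itv/= -ler_norml.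
have [_ E] := @Rint_swap _ F (f \_ D) _ _ iF iG mw wK.
etransitivity; first exact: E.
clear E Hf mw wK; etransitivity; last exact: (RintZ c iFf).
apply: eq_Rint => u; have [->|Fu] := eqVneq (F u) 0; first by rewrite !mul0r mulr0.
etransitivity; first exact: (f_equal (fun z => F u * z) (inner u Fu)).
by rewrite mulrCA.
Qed.

Lemma conv_trig R (a T x : R) (F : R -> R) : 0 < a -> L1 F ->
  (forall u, T < `|u| -> F u = 0) ->
  cosT (conv a F) x = hat_ft a x * cosT F x /\ sinT (conv a F) x = hat_ft a x * sinT F x.
Proof.
move=> a0 iF FT.
have cx : continuous (fun t : R => t * x).
  by move=> t; apply: cvgM; [exact: cvg_id|exact: cvg_cst].
have cc : continuous (fun t : R => cos (t * x)).
  by move=> t; apply: continuous_comp; [exact: cx|exact: continuous_cos].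
have cs : continuous (fun t : R => sin (t * x)).
  by move=> t; apply: continuous_comp; [exact: cx|exact: continuous_sin].
split.
- apply: (conv_pairing a0 iF FT cc); first exact: L1_cos.
  by move=> u; have := hat_cos u x 0 a0; rewrite addr0 => <-; apply: eq_Rint => t; rewrite addr0.
- apply: (conv_pairing a0 iF FT cs); first exact: L1_sin.
  by move=> u; rewrite hat_sin.
Qed.

Lemma convn_spec R (a T : R) (M : nat) (F : R -> R) : 0 < a -> L1 F ->
  (forall u, T < `|u| -> F u = 0) ->
  let G := iter M (conv a) F in
  [/\ L1 G, forall u, T + M%:R * a < `|u| -> G u = 0,
      forall x, cosT G x = hat_ft a x ^+ M * cosT F x /\ sinT G x = hat_ft a x ^+ M * sinT F x &
      forall t, G t != 0 -> exists u, F u != 0 /\ `|t - u| <= M%:R * a].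
Proof.
move=> a0 iF FT; elim: M => [|M [iG GT Gx Gs]] /=.
  split=> //.
  - by move=> u; rewrite mul0r addr0; exact: FT.
  - by move=> x; rewrite !expr0 !mul1r.
  - by move=> t Ft; exists t; rewrite subrr normr0 mul0r.
have lG := conv_lip a0 iG GT.
have -> : M.+1%:R * a = M%:R * a + a by rewrite -natr1 mulrDl mul1r.
split.
- exact: lip_L1 lG.
- by have [L _ [_ H]] := lG; rewrite addrA.
- move=> x; have [-> ->] := conv_trig x a0 iG GT; have [-> ->] := Gx x.
  by rewrite !exprS !mulrA.
- move=> t /(conv_support a0)[u [/Gs [v [Fv uv]] tu]]; exists v; split=> //.
  by rewrite [leRHS]addrC (le_trans (ler_distD u _ _))// lerD.
Qed.

(** * Modulation and mollification *)

Lemma cos_lip R (x y : R) : `|cos x - cos y| <= `|x - y|.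
Proof.
wlog xy : x y / y <= x.
  by move=> H; have [/H//|/ltW/H] := leP y x; rewrite distrC [`|y - x|]distrC.
have cs : continuous (fun t : R => - sin t).
  by move=> t; apply: cvgN; exact: continuous_sin.
have <- : \int[mu]_(t in `[y, x]) (- sin t) = cos x - cos y.
  by apply: Rint_FTC.
apply: le_trans (le_normr_Rintegral _ _) _ => //; first exact: continuous_integrable_itv.
rewrite (ger0_norm (x := x - y)) ?subr_ge0//.
apply: (@le_trans _ _ (\int[mu]_(t in `[y, x]) 1)); last by rewrite Rint_cst_itv// mul1r.
apply: le_Rintegral => //.
- apply: continuous_integrable_itv => t.
  by apply: cvg_norm; exact: cs.
- by apply: continuous_integrable_itv; exact: cst_continuous.
- by move=> t _; rewrite normrN sin_max.
Qed.

Lemma sin_lip R (x y : R) : `|sin x - sin y| <= `|x - y|.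
Proof.
rewrite -!cosBpihalf; apply: le_trans (cos_lip _ _) _.
by have -> : x - pi / 2 - (y - pi / 2) = x - y by ring.
Qed.

Lemma lipD R (T : R) (a b : R -> R) : lip T a -> lip T b ->
  lip T (fun t => a t + b t).
Proof.
move=> [L L0 [la a0]] [K K0 [lb b0]]; exists (L + K); first exact: addr_ge0.
split=> [s t|t tT]; last by rewrite a0 ?b0// addr0.
have -> : a s + b s - (a t + b t) = (a s - a t) + (b s - b t) by ring.
by rewrite mulrDl; apply: le_trans (ler_normD _ _) (lerD _ _).
Qed.

Lemma lipZ R (T c : R) (a : R -> R) : lip T a -> lip T (fun t => c * a t).
Proof.
move=> [L L0 [la a0]]; exists (`|c| * L); first exact: mulr_ge0.
split=> [s t|t tT]; last by rewrite a0 ?mulr0.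
by rewrite -mulrBr normrM -mulrA ler_wpM2l.
Qed.

Lemma lip_sum R (T : R) (I : Type) (s : seq I) (a : I -> R -> R) :
  (forall i, lip T (a i)) -> lip T (fun t => \sum_(i <- s) a i t).
Proof.
move=> la; elim: s => [|i s IH].
  exists 0 => //; split=> [x y|t _]; last by rewrite big_nil.
  by rewrite !big_nil subrr normr0 mul0r.
have [L L0 [h1 h2]] := lipD (la i) IH; exists L => //; split=> [x y|t tT].
  by rewrite !big_cons; exact: h1.
by rewrite big_cons; exact: h2.
Qed.

Lemma lip_mul R (T K : R) (f a : R -> R) : 0 < T -> lip T a ->
  (forall x, `|f x| <= 1) -> (forall x y, `|f x - f y| <= K * `|x - y|) ->
  lip T (fun t => f t * a t).
Proof.
move=> T0 [L L0 la] f1 fK; pose B := L * (3 * T).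
have aB t : `|a t| <= B by exact: lipschitz_supp_bounded.
have B0 : 0 <= B by exact: le_trans (aB 0).
exists (L + `|K| * B); first by rewrite addr_ge0// mulr_ge0.
split=> [s t|t tT]; last by rewrite la.2 ?mulr0.
have -> : f s * a s - f t * a t = f s * (a s - a t) + (f s - f t) * a t by ring.
apply: le_trans (ler_normD _ _) _; rewrite !normrM mulrDl lerD//.
  by rewrite -[leRHS]mul1r; apply: ler_pM => //; exact: la.1.
rewrite mulrAC; apply: ler_pM => //; apply: le_trans (fK _ _) _.
by rewrite ler_wpM2r// ler_norm.
Qed.

Lemma lip_expi R (T x : R) (F : R -> R[i]) : 0 < T ->
  lip T (re F) -> lip T (im F) ->
  lip T (re (fun t => expi (t * x) * F t)) /\ lip T (im (fun t => expi (t * x) * F t)).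
Proof.
move=> T0 l1 l2.
have lf (f : R -> R) : (forall s t, `|f s - f t| <= `|s - t|) ->
    forall s t, `|f (s * x) - f (t * x)| <= `|x| * `|s - t|.
  by move=> H s t; apply: le_trans (H _ _) _; rewrite -mulrBl normrM mulrC.
have m1 a : lip T a -> lip T (fun t => cos (t * x) * a t).
  by move=> la; apply: (lip_mul T0 la) (fun x => cos_max _) (lf _ (@cos_lip R)).
have m2 a : lip T a -> lip T (fun t => sin (t * x) * a t).
  by move=> la; apply: (lip_mul T0 la) (fun x => sin_max _) (lf _ (@sin_lip R)).
split.
  have -> : re (fun t => expi (t * x) * F t) =
      fun t => cos (t * x) * re F t + (-1) * (sin (t * x) * im F t).
    by apply/funext => t; rewrite /re /im /expi; case: (F t) => ? ? /=; rewrite mulN1r.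
  by apply: lipD; [exact: m1|apply: lipZ; exact: m2].
have -> : im (fun t => expi (t * x) * F t) =
    fun t => cos (t * x) * im F t + sin (t * x) * re F t.
  by apply/funext => t; rewrite /re /im /expi; case: (F t).
by apply: lipD; [exact: m1|exact: m2].
Qed.

Lemma expiD R (x y : R) : expi (x + y) = expi x * expi y.
Proof.
rewrite /expi cosD sinD; apply/eqP; rewrite eq_complex/=.
by apply/andP; split; apply/eqP; ring.
Qed.

Lemma expi0 R : expi (0 : R) = 1.
Proof. by rewrite /expi cos0 sin0. Qed.

Lemma sqmod_expi R (x : R) : sqmod (expi x) = 1.
Proof. exact: cos2Dsin2. Qed.

Lemma fourier_modulate R (F : R -> R[i]) (xi x : R) :
  fourier F x = fourier (fun t => expi (t * xi) * F t) (x - xi).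
Proof.
rewrite /fourier; apply: (f_equal (fun g => Cintegral g)); apply/funext => t.
by rewrite mulrA -expiD mulrBr subrK.
Qed.

(** Multiplying a transform by a power of a Fejer factor centred at [xi] amounts
    to convolving the modulated spectrum with triangles: the spectrum becomes
    Lipschitz and spreads by at most [M.+1 * a], while the value at [xi] is
    kept. *)
Lemma mollify R (F : R -> R[i]) (T xi a : R) (M : nat) : 0 < T -> 0 < a ->
  CL1 F -> (forall u, T < `|u| -> F u = 0) ->
  exists G : R -> R[i], [/\ lip (T + M.+1%:R * a) (re G), lip (T + M.+1%:R * a) (im G),
    forall t, G t != 0 -> exists u, F u != 0 /\ `|t - u| <= M.+1%:R * a &
    forall x, fourier G x = (hat_ft a (x - xi) ^+ M.+1)%:C * fourier F x].
Proof.
move=> T0 a0 iF FT; pose F1 t := expi (t * xi) * F t.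
have [iP iQ] : CL1 F1 by exact: CL1_expi.
have FP u : F u = 0 -> re F1 u = 0 /\ im F1 u = 0 by move=> Fu; rewrite /re /im /F1 Fu mulr0.
have PT u : T < `|u| -> re F1 u = 0 by move=> /FT/FP[].
have QT u : T < `|u| -> im F1 u = 0 by move=> /FT/FP[].
pose P := iter M.+1 (conv a) (re F1); pose Q := iter M.+1 (conv a) (im F1).
have [iPM PMT _ _] := convn_spec M a0 iP PT.
have [iQM QMT _ _] := convn_spec M a0 iQ QT.
have [iP' _ PE Ps] := convn_spec M.+1 a0 iP PT.
have [iQ' _ QE Qs] := convn_spec M.+1 a0 iQ QT.
have lP := conv_lip a0 iPM PMT; have lQ := conv_lip a0 iQM QMT.
have eT : T + M%:R * a + a = T + M.+1%:R * a by rewrite -natr1 mulrDl mul1r addrA.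
rewrite eT in lP lQ.
pose G1 t := P t +i* Q t; pose G t := expi (t * - xi) * G1 t.
have T1 : 0 < T + M.+1%:R * a by rewrite addr_gt0// mulr_gt0.
have [lG1 lG2] := @lip_expi _ _ (- xi) G1 T1 lP lQ.
exists G; split=> //.
- move=> t Gt; have : P t != 0 \/ Q t != 0.
    apply/orP; rewrite -negb_and; apply: contra Gt => /andP[/eqP p /eqP q].
    by rewrite /G /G1 p q mulr0.
  case=> [/Ps|/Qs] [u [h tu]]; exists u; split=> //; apply: contraNneq h => /FP[h1 h2].
    by rewrite h1.
  by rewrite h2.
- move=> x; rewrite (fourier_modulate G xi) (fourier_modulate F xi).
  have -> : (fun t => expi (t * xi) * G t) = G1.
    by apply/funext => t; rewrite /G mulrA -expiD mulrN subrr expi0 mul1r.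
  rewrite !fourierE// -/F1 /=; have [p1 p2] := PE (x - xi); have [q1 q2] := QE (x - xi).
  have -> : re G1 = iter M.+1 (conv a) (re F1) by [].
  have -> : im G1 = iter M.+1 (conv a) (im F1) by [].
  rewrite p1 p2 q1 q2; apply/eqP; rewrite eq_complex /=.
  by apply/andP; split; apply/eqP; ring.
Qed.

(** * Square-integrable functions *)

Lemma normc_sq R (z : R[i]) : Normc.normc z ^+ 2 = sqmod z.
Proof. by case: z => x y; rewrite /Normc.normc/= sqr_sqrtr// addr_ge0 ?sqr_ge0. Qed.

Lemma normc_nneg R (z : R[i]) : 0 <= Normc.normc z.
Proof. by case: z => x y; exact: sqrtr_ge0. Qed.

Lemma L2norm_sq R (f : R -> R[i]) :
  (L2norm f `^ 2 = \int[mu]_x (sqmod (f x))%:E)%E.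
Proof.
rewrite /L2norm poweR_Lnorm//; apply: eq_integral => x _.
rewrite abse_EFin poweR_EFin ger0_norm ?normc_nneg// powR_mulrn ?normc_nneg//.
by rewrite normc_sq.
Qed.

Lemma measurable_sqmod R (f : R -> R[i]) :
  measurable_fun setT (re f) -> measurable_fun setT (im f) ->
  measurable_fun setT (fun x => sqmod (f x)).
Proof. by move=> m1 m2; apply: measurable_funD; exact: measurable_funX. Qed.

Lemma inL2_sqmod R (f : R -> R[i]) : inL2 f -> L1 (fun x => sqmod (f x)).
Proof.
move=> [m1 m2 f2]; apply: L1_ge0; first exact: measurable_sqmod.
  by move=> x; exact: sqmod_ge0.
by rewrite -L2norm_sq; apply: poweR_lty.
Qed.

Lemma L2norm_le R (f : R -> R[i]) (K : R) : inL2 f -> 0 <= K ->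
  (L2norm f <= K%:E)%E -> \int[mu]_x sqmod (f x) <= K ^+ 2.
Proof.
move=> fL K0 fK; rewrite -lee_fin -L1_ge0_fin; last exact: inL2_sqmod.
rewrite -L2norm_sq -powR_mulrn// -poweR_EFin.
apply: gt0_ler_poweR => //; rewrite in_itv/= leey ?andbT ?lee_fin//.
exact: Lnorm_ge0.
Qed.

(** On a bounded support, [|z| <= 1 + |z|^2] turns square-integrability into
    integrability. *)
Lemma inL2_CL1 R (F : R -> R[i]) (T : R) : inL2 F ->
  (forall u, T < `|u| -> F u = 0) -> CL1 F.
Proof.
move=> FL FT; have i2 := inL2_sqmod FL; have [m1 m2 _] := FL.
have iD : L1 ((cst 1 : R -> R) \_ [set` `[- T, T]]).
  by apply: L1_restrict_itv; exact: cst_continuous.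
have bnd (x y : R) u : `|x| <= 1 + sqmod (x +i* y) /\ `|y| <= 1 + sqmod (x +i* y).
  have h (z : R) : `|z| <= 1 + z ^+ 2.
    have : 0 <= (`|z| - 1) ^+ 2 by rewrite sqr_ge0.
    by rewrite sqrrB1 real_normK ?num_real//; have := normr_ge0 z; lra.
  rewrite /sqmod/=; have := h x; have := h y; have := sqr_ge0 x; have := sqr_ge0 y.
  by move=> *; split; lra.
have D u : `|re F u| <= ((cst 1 : R -> R) \_ [set` `[- T, T]]) u + sqmod (F u) /\
           `|im F u| <= ((cst 1 : R -> R) \_ [set` `[- T, T]]) u + sqmod (F u).
  rewrite patchE; case: ifPn => uT.
    by rewrite /re /im; case: (F u) => x y; exact: bnd.
  rewrite /re /im FT /=; first by rewrite normr0 add0r sqmod_ge0.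
  rewrite ltNge; apply: contra uT => uT.
  by rewrite inE/= in_itv/= -ler_norml.
by split; [apply: L1_dominated m1 (fun u => (D u).1) _|apply: L1_dominated m2 (fun u => (D u).2) _];
  exact: L1D.
Qed.

(** * Gram matrices of Lipschitz spectra *)

Lemma lip_bounded_mul R (T : R) (a b : R -> R) : 0 < T -> lip T a -> lip T b ->
  L1 (fun t => a t * b t).
Proof.
move=> T0 [L L0 la] lb; have ia := lipschitz_supp_L1 la.
exact: (L1_mul_bounded (L1_measurable ia) (fun t => lipschitz_supp_bounded t T0 L0 la) (lip_L1 lb)).
Qed.

Definition lipC R (T : R) (F : R -> R[i]) : Prop := lip T (re F) /\ lip T (im F).

Lemma lipC_CL1 R (T : R) (F : R -> R[i]) : lipC T F -> CL1 F.
Proof. by move=> [l1 l2]; split; [exact: lip_L1 l1|exact: lip_L1 l2]. Qed.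

Lemma lipC_comb R (T : R) (N : nat) (c : 'I_N -> R[i]) (F : 'I_N -> R -> R[i]) :
  (forall j, lipC T (F j)) -> lipC T (fun t => \sum_j c j * F j t).
Proof.
move=> lF; split.
  have -> : re (fun t => \sum_j c j * F j t) =
     fun t => \sum_j (complex.Re (c j) * re (F j) t + (- complex.Im (c j)) * im (F j) t).
    apply/funext => t; rewrite /re Re_sum; apply: eq_bigr => j _; rewrite /im mulNr.
    by case: (c j) (F j t) => ? ? [].
  by apply: lip_sum => j; apply: lipD; apply: lipZ; apply lF.
have -> : im (fun t => \sum_j c j * F j t) =
   fun t => \sum_j (complex.Re (c j) * im (F j) t + complex.Im (c j) * re (F j) t).
  apply/funext => t; rewrite /im Im_sum; apply: eq_bigr => j _; rewrite /re.
  by case: (c j) (F j t) => ? ? [].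
by apply: lip_sum => j; apply: lipD; apply: lipZ; apply lF.
Qed.

Lemma CL1_mul_conj R (T : R) (F G : R -> R[i]) : 0 < T -> lipC T F -> lipC T G ->
  CL1 (fun t => F t * (G t)^*).
Proof.
move=> T0 [f1 f2] [g1 g2]; split.
  apply: eq_L1 (L1D (lip_bounded_mul T0 f1 g1) (lip_bounded_mul T0 f2 g2)) => t.
  by rewrite /re /im; case: (F t) (G t) => ? ? [? ?] /=; rewrite mulrN opprK.
apply: eq_L1 (L1B (lip_bounded_mul T0 f2 g1) (lip_bounded_mul T0 f1 g2)) => t.
by rewrite /re /im; case: (F t) (G t) => ? ? [? ?] /=; ring.
Qed.

Definition gram R (F G : R -> R[i]) : R[i] := Cintegral (fun t => F t * (G t)^*).

Lemma gram_sym R (T : R) (F G : R -> R[i]) : 0 < T -> lipC T F -> lipC T G ->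
  gram F G = (gram G F)^*.
Proof.
move=> T0 lF lG; rewrite /gram -Cintegral_conj; last exact: CL1_mul_conj lG lF.
apply: (f_equal (fun g => Cintegral g)); apply/funext => t.
by case: (F t) (G t) => ? ? [? ?]; apply/eqP; rewrite eq_complex/=; apply/andP; split; apply/eqP; ring.
Qed.

Lemma gram_combl R (T : R) (N : nat) (c : 'I_N -> R[i]) (F : 'I_N -> R -> R[i])
    (G : R -> R[i]) : 0 < T -> (forall j, lipC T (F j)) -> lipC T G ->
  gram (fun t => \sum_j c j * F j t) G = \sum_j c j * gram (F j) G.
Proof.
move=> T0 lF lG; rewrite /gram -Cintegral_comb; last by move=> j; exact: CL1_mul_conj (lF j) lG.
apply: (f_equal (fun g => Cintegral g)); apply/funext => t.
by rewrite mulr_suml; apply: eq_bigr => j _; rewrite mulrA.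
Qed.

Lemma gram_comb R (T : R) (N : nat) (a b : 'I_N -> R[i]) (F : 'I_N -> R -> R[i]) :
  0 < T -> (forall j, lipC T (F j)) ->
  gram (fun t => \sum_j a j * F j t) (fun t => \sum_j b j * F j t) =
  \sum_i \sum_j a i * gram (F i) (F j) * (b j)^*.
Proof.
move=> T0 lF; rewrite (gram_combl a T0 lF); last exact: lipC_comb.
apply: eq_bigr => i _; have lb := lipC_comb b lF.
have -> : gram (F i) (fun t => \sum_j b j * F j t) = \sum_j gram (F i) (F j) * (b j)^*.
  rewrite (gram_sym T0 (lF i) lb) (gram_combl b T0 lF (lF i)).
  etransitivity; first exact: conjc_sum.
  apply: eq_bigr => j _; rewrite (gram_sym T0 (lF i) (lF j)) mulrC.
  exact: rmorphM.
by rewrite mulr_sumr; apply: eq_bigr => j _; rewrite mulrA.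
Qed.

Lemma gram_sqmod R (F : R -> R[i]) :
  complex.Re (gram F F) = \int[mu]_t sqmod (F t).
Proof.
apply: eq_Rint => t; rewrite /sqmod; case: (F t) => x y /=; ring.
Qed.

Lemma lipC_sqmod R (T : R) (F : R -> R[i]) : 0 < T -> lipC T F ->
  L1 (fun t => sqmod (F t)).
Proof.
move=> T0 [l1 l2]; apply: eq_L1 (L1D (lip_bounded_mul T0 l1 l1) (lip_bounded_mul T0 l2 l2)) => t.
by rewrite /sqmod !expr2.
Qed.

(** The Cauchy-Schwarz inequality on [U], written with the inequality of means. *)
Lemma fourier_bound R (T m : R) (U : set R) (H : R -> R[i]) (x : R) :
  0 < T -> lipC T H -> measurable U -> 0 < m -> (mu U <= m%:E)%E ->
  (forall t, ~ U t -> H t = 0) ->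
  sqmod (fourier H x) <= m * \int[mu]_t sqmod (H t).
Proof.
move=> T0 lH mU m0 Um HU; pose g t := expi (t * x) * H t.
have [i1 i2] : CL1 g by apply: CL1_expi; exact: lipC_CL1 lH.
have iE := lipC_sqmod T0 lH.
set z := fourier H x; set E := \int[mu]_t _.
have zE : sqmod z = \int[mu]_t (complex.Re z * re g t + complex.Im z * im g t).
  by rewrite RintD ?RintZ//; exact: L1Z.
have Ufin : (mu U < +oo)%E by exact: le_lt_trans Um (ltry _).
have iU : L1 (\1_U : R -> R).
  by apply: L1_ge0 => //; rewrite integral_indic// setIT.
have IU : \int[mu]_t (\1_U t) <= m.
  rewrite -lee_fin -L1_ge0_fin//; apply: le_trans Um.
  by rewrite integral_indic// setIT.
have : sqmod z <= \int[mu]_t (m^-1 * sqmod z / 2 * \1_U t + m / 2 * sqmod (H t)).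
  rewrite {1}zE; apply: le_Rint.
  - by apply: L1D; exact: L1Z.
  - by apply: L1D; exact: L1Z.
  - move=> t; rewrite /= indicE; case: (pselect (U t)) => Ut; last first.
      by rewrite memNset// /g /re /im HU// mulr0 /= !mulr0 !add0r mulr_ge0 ?sqmod_ge0// divr_ge0// ltW.
    rewrite mem_set// mulr1.
    have := @Re_amgm R m^-1 z^* (g t); rewrite invr_gt0 => /(_ m0).
    rewrite ler_norml => /andP[_]; rewrite sqmod_conj invrK {2}/g sqmodM sqmod_expi mul1r.
    have -> : complex.Re (z^* * g t) = complex.Re z * re g t + complex.Im z * im g t.
      by rewrite /re /im; case: (z) (g t) => ? ? [? ?] /=; rewrite mulNr opprK.
    rewrite mulrDl; set A := sqmod z; set B := sqmod (H t).
    by rewrite [B * m]mulrC [m * B / 2]mulrAC.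
rewrite RintD; [|exact: L1Z|exact: L1Z]; rewrite !RintZ//.
have Um1 : (\int[mu]_t \1_U t) / m <= 1 by rewrite ler_pdivrMr// mul1r.
have : sqmod z * ((\int[mu]_t \1_U t) / m) <= sqmod z by rewrite ler_piMr// sqmod_ge0.
by rewrite -/E; lra.
Qed.

Lemma plancherel_lipC R (T : R) (H : R -> R[i]) : 0 < T -> lipC T H ->
  L1 (fun x => sqmod (fourier H x)) ->
  2 * pi * \int[mu]_t sqmod (H t) <= \int[mu]_x sqmod (fourier H x).
Proof.
move=> T0 lH; have iH := lipC_CL1 lH; have [[L L0 [la a0]] [K K0 [lb b0]]] := lH.
have -> : (fun x => sqmod (fourier H x)) = sqft (re H) (im H).
  by apply/funext => x; rewrite fourierE.
have LK : 0 <= L + K by exact: addr_ge0.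
move=> iS; apply: (plancherel_ge T0 LK) => //; split=> // s t.
  by apply: le_trans (la _ _) _; rewrite ler_wpM2r// lerDl.
by apply: le_trans (lb _ _) _; rewrite ler_wpM2r// lerDr.
Qed.

(** The bounded support makes the transform Lipschitz; measurability of
    transforms follows. *)
Lemma trigT_lip R (T : R) (a f : R -> R) : lip T a -> continuous f ->
  (forall x, `|f x| <= 1) -> (forall x y, `|f x - f y| <= `|x - y|) ->
  continuous (fun x => \int[mu]_t (a t * f (t * x))).
Proof.
move=> la cf f1 fl; have ia := lip_L1 la.
have [L L0 [_ aT]] := la.
have if_ x : L1 (fun t => a t * f (t * x)).
  by apply: eq_L1 (L1_mul_comp x cf f1 ia) => t; rewrite [t * x]mulrC.
pose K := `|T| * \int[mu]_t `|a t|.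
have K0 : 0 <= K by rewrite mulr_ge0// Rint_ge0.
have lK x y : `|\int[mu]_t (a t * f (t * x)) - \int[mu]_t (a t * f (t * y))| <= K * `|x - y|.
  rewrite -RintB//; apply: le_trans (norm_Rint _) _; first exact: L1B.
  rewrite /K mulrAC -RintZ; last exact: L1_norm.
  apply: le_Rint; [by apply: L1_norm; exact: L1B|by apply: L1Z; exact: L1_norm|move=> t].
  rewrite -mulrBr normrM mulrC; have [tT|tT] := leP `|t| T; last first.
    by rewrite aT// normr0 !mulr0.
  rewrite ler_wpM2r//; apply: le_trans (fl _ _) _.
  rewrite -mulrBr normrM ler_wpM2r//; apply: le_trans tT (ler_norm _).
move=> x; apply/cvgrPdist_le => /= e e0.
have d0 : 0 < e / (K + 1) by rewrite divr_gt0// ltr_wpDl.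
near=> y.
have xy : `|x - y| <= e / (K + 1).
  by near: y; apply: cvgr_dist_le => //; exact: cvg_id.
apply: (le_trans (lK x y)); apply: (@le_trans _ _ ((K + 1) * (e / (K + 1)))).
  by apply: ler_pM => //; rewrite lerDl.
by rewrite mulrCA divff ?mulr1// gt_eqF// ltr_wpDl.
Unshelve. all: by end_near. Qed.

Lemma lipC_fourier_measurable R (T : R) (F : R -> R[i]) : lipC T F ->
  measurable_fun setT (re (fourier F)) /\ measurable_fun setT (im (fourier F)).
Proof.
move=> [l1 l2]; have iF : CL1 F by split; [exact: lip_L1 l1|exact: lip_L1 l2].
have mc a : lip T a -> measurable_fun setT (cosT a).
  by move=> la; apply: continuous_measurable_fun; exact: (trigT_lip la (@continuous_cos R) (@cos_max R) (@cos_lip R)).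
have ms a : lip T a -> measurable_fun setT (sinT a).
  by move=> la; apply: continuous_measurable_fun; exact: (trigT_lip la (@continuous_sin R) (@sin_max R) (@sin_lip R)).
split.
  have -> : re (fourier F) = fun x => cosT (re F) x - sinT (im F) x.
    by apply/funext => x; rewrite {1}/re fourierE.
  by apply: measurable_funB; [exact: mc|exact: ms].
have -> : im (fourier F) = fun x => sinT (re F) x + cosT (im F) x.
  by apply/funext => x; rewrite {1}/im fourierE.
by apply: measurable_funD; [exact: ms|exact: mc].
Qed.

(** * Counting nodes with the resolvent of a Gram matrix *)

Lemma sqmod_unit_comb R (N : nat) (p f : 'I_N -> R[i]) :
  \sum_j sqmod (p j) = 1 -> sqmod (\sum_j p j * f j) <= \sum_j sqmod (f j).
Proof.
move=> p1; set z := \sum_j p j * f j; set B := \sum_j sqmod (f j).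
have : sqmod z <= (sqmod z + B) / 2.
  have e1 : sqmod z = \sum_j complex.Re (z^* * (p j * f j)).
    rewrite -Re_sum -mulr_sumr -/z.
    by rewrite /sqmod; case: (z) => x y /=; ring.
  have e2 : sqmod z = \sum_j sqmod (z^* * p j).
    under [RHS]eq_bigr => j _ do rewrite sqmodM sqmod_conj.
    by rewrite -mulr_sumr p1 mulr1.
  rewrite {1}e1 e2.
  rewrite /B -big_split mulr_suml/=; apply: ler_sum => j _.
  have := @Re_amgm R 1 (z^* * p j) (f j) ltr01; rewrite mul1r divr1 ler_norml => /andP[_].
  by rewrite mulrA.
by lra.
Qed.

(** The counting argument.  Diagonalise the Gram matrix of the spectra; the
    resulting orthogonal family has energies [g k] and transforms [psi _ k].

    At every point [x], [bessel_regularized] bounds the sum of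
    [|psi x k|^2 / (g k + l)] by [m].  By Plancherel's inequality and the tail
    hypothesis, [psi _ k] has a mass of at least [2 pi g k - N eta] on the
    interval of radius [r].  Integrating the first bound over that interval and
    inserting the second one shows that the sum of
    [(2 pi g k - N eta) / (g k + l)] is at most [2 r m].  This sum differs from
    [2 pi N] by a multiple of the trace of the resolvent, and the trace is
    controlled by [resolvent_coordinate], because each [G i] almost
    interpolates a Kronecker symbol at the nodes. *)
Lemma concentration_count R (N : nat) (T m l r eta d2 : R) (U : set R)
    (G : 'I_N -> R -> R[i]) (xi : 'I_N -> R) :
  0 < T -> measurable U -> 0 < m -> (mu U <= m%:E)%E -> 0 < l -> 0 <= r ->
  (forall j, lipC T (G j)) -> (forall j t, ~ U t -> G j t = 0) ->
  (forall j, L1 (fun x => sqmod (fourier (G j) x))) ->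
  (forall j, \int[mu]_x (if r < `|x| then sqmod (fourier (G j) x) else 0) <= eta) ->
  (forall i, \sum_j sqmod (fourier (G i) (xi j) - (i == j)%:R) <= d2) ->
  2 * pi * N%:R - (2 * pi * l + N%:R * eta) * (N%:R * (m + d2 / l)) <= 2 * r * m.
Proof.
move=> T0 mU m0 Um l0 r0 lG GU iG tail interp.
have Gsym i j : gram (G i) (G j) = (gram (G j) (G i))^* by exact: gram_sym (lG i) (lG j).
have [p [g [[prow pcol] pg]]] := spectral_family Gsym.
pose v k t := \sum_j p k j * G j t.
have lv k : lipC T (v k) by exact: lipC_comb.
have vgram k k' : gram (v k) (v k') = (g k)%:C *+ (k == k').
  by rewrite /v (gram_comb _ _ T0 lG).
have comb_norm (a : 'I_N -> R[i]) :
    \int[mu]_t sqmod (\sum_k a k * v k t) = \sum_k sqmod (a k) * g k.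
  rewrite -gram_sqmod (gram_comb a a T0 lv) Re_sum; apply: eq_bigr => k _.
  rewrite (bigD1 k)//= big1 ?addr0; last first.
    by move=> k' kk'; rewrite vgram eq_sym (negPf kk') mulr0n mulr0 mul0r.
  rewrite vgram eqxx mulr1n mulrAC -sqmodE /=; by rewrite mul0r subr0.
have g0 k : 0 <= g k.
  have := comb_norm (fun k' => (k' == k)%:R).
  have -> : \sum_k0 sqmod ((k0 == k)%:R : R[i]) * g k0 = g k.
    rewrite (bigD1 k)//= big1 ?addr0.
      by rewrite eqxx /sqmod/= expr0n addr0 expr1n mul1r.
    by move=> k' /negPf ->; rewrite /sqmod/= expr0n addr0 mul0r.
  by move=> <-; apply: Rint_ge0 => t; exact: sqmod_ge0.
pose psi x k := fourier (v k) x.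
have psiE x k : psi x k = \sum_j p k j * fourier (G j) x.
  by rewrite /psi /v fourier_comb// => j; exact: lipC_CL1 (lG j).
have key x (a : 'I_N -> R[i]) :
    sqmod (\sum_k a k * psi x k) <= m * \sum_k sqmod (a k) * g k.
  rewrite -comb_norm /psi -fourier_comb; last by move=> j; exact: lipC_CL1 (lv j).
  apply: (fourier_bound x T0 (lipC_comb a lv) mU m0 Um) => t Ut.
  by rewrite big1// => k _; rewrite /v big1 ?mulr0// => j _; rewrite GU ?mulr0.
have gl k : 0 < g k + l by rewrite ltr_wpDl.
have Bes x := bessel_regularized l0 g0 (key x) (ltW m0).
(* By unitarity the trace is the sum of the diagonal entries of the resolvent
   in the original family, one for each node. *)
have tr : \sum_k (g k + l)^-1 <= N%:R * (m + d2 / l).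
  have -> : \sum_k (g k + l)^-1 = \sum_j \sum_k sqmod (p k j) / (g k + l).
    rewrite exchange_big /=; apply: eq_bigr => k _; rewrite -mulr_suml.
    suff -> : \sum_j sqmod (p k j) = 1 by rewrite mul1r.
    apply: complexI; rewrite realc_sum.
    by under eq_bigr => j _ do rewrite sqmodE; rewrite prow eqxx.
  pose e j i := fourier (G i) (xi j) - (i == j)%:R.
  apply: (@le_trans _ _ (\sum_j (m + (\sum_i sqmod (e j i)) / l))).
    apply: ler_sum => j _.
    apply: (resolvent_coordinate (conj prow pcol) l0 g0 (ltW m0) (key (xi j))) => k.
    rewrite psiE; under [X in _ + X]eq_bigr => i _ do rewrite /e mulrBr.
    rewrite sumrB (bigD1 (F := fun i => p k i * (i == j)%:R) j)//= eqxx mulr1.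
    rewrite [\sum_(i < N | i != j) _]big1 ?addr0; first by rewrite addrC subrK.
    by move=> i /negPf ->; rewrite mulr0.
  rewrite big_split/= sumr_const card_ord -mulr_suml exchange_big/=.
  rewrite mulrDr mulr_natl lerD2l mulrA ler_wpM2r ?invr_ge0 ?(ltW l0)//.
  apply: (@le_trans _ _ (\sum_(i < N) d2)); first by apply: ler_sum => i _; exact: interp.
  by rewrite sumr_const card_ord mulr_natl.
(* By unitarity, integrability and tails of [psi] are inherited from the
   transforms of the [G j]. *)
have sqp k x : sqmod (psi x k) <= \sum_j sqmod (fourier (G j) x).
  rewrite psiE; apply: sqmod_unit_comb; apply: complexI; rewrite realc_sum.
  by under eq_bigr => j _ do rewrite sqmodE; rewrite prow eqxx.
have iS : L1 (fun x => \sum_j sqmod (fourier (G j) x)) by exact: L1_sum.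
have ipsi k : L1 (fun x => sqmod (psi x k)).
  have [m1 m2] := lipC_fourier_measurable (lv k).
  apply: L1_dominated iS; first exact: measurable_sqmod m1 m2.
  by move=> x; rewrite ger0_norm ?sqmod_ge0.
pose D : set R := [set` `[- r, r]].
have mD : measurable D by exact: measurable_itv.
have muD : (mu D <= (2 * r)%:E)%E.
  rewrite /D lebesgue_measure_itv/=; case: ifP => _; last by rewrite lee_fin mulr_ge0.
  by rewrite -EFinB lee_fin; lra.
have iD : L1 (\1_D : R -> R).
  apply: L1_ge0 => //; rewrite integral_indic// setIT.
  exact: le_lt_trans muD (ltry _).
have D01 x : 0 <= (\1_D x : R) <= 1 by rewrite indicE; case: (x \in D); rewrite ?lexx ler01.
have iDpsi k : L1 (fun x => \1_D x * sqmod (psi x k)).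
  apply: (@L1_mul_bounded _ _ _ 1) => //.
  by move=> x; have /andP[? ?] := D01 x; rewrite ger0_norm.
have itail j : L1 (fun x => if r < `|x| then sqmod (fourier (G j) x) else 0).
  apply: (@eq_L1 _ (fun x => sqmod (fourier (G j) x) - \1_D x * sqmod (fourier (G j) x))).
    move=> x; rewrite indicE; have -> : (x \in D) = (`|x| <= r).
      by apply/idP/idP; rewrite /D inE/= in_itv/= -ler_norml.
    by case: ltP => _; rewrite ?mul1r ?subrr// mul0r subr0.
  apply: L1B => //; apply: (@L1_mul_bounded _ _ _ 1) => //.
  by move=> x; have /andP[? ?] := D01 x; rewrite ger0_norm.
have conc k : 2 * pi * g k - N%:R * eta <= \int[mu]_x (\1_D x * sqmod (psi x k)).
  have gk : g k = \int[mu]_t sqmod (v k t).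
    by rewrite -gram_sqmod vgram eqxx mulr1n.
  rewrite gk; apply: (@le_trans _ _ (\int[mu]_x sqmod (psi x k) - N%:R * eta)).
    by rewrite lerD2r; apply: (plancherel_lipC T0 (lv k)); exact: ipsi.
  rewrite lerBlDr.
  apply: (@le_trans _ _ (\int[mu]_x (\1_D x * sqmod (psi x k)) +
     \int[mu]_x \sum_j (if r < `|x| then sqmod (fourier (G j) x) else 0))).
    rewrite -RintD//; last exact: L1_sum.
    apply: le_Rint => //; first by apply: L1D => //; exact: L1_sum.
    move=> x; rewrite indicE; have -> : (x \in D) = (`|x| <= r).
      by apply/idP/idP; rewrite /D inE/= in_itv/= -ler_norml.
    by case: ltP => _; rewrite ?mul0r ?add0r// mul1r lerDl sumr_ge0.
  rewrite lerD2l Rint_sum// mulr_natl -[in leRHS](card_ord N) -sumr_const.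
  by apply: ler_sum => j _.
have total : \sum_k (2 * pi * g k - N%:R * eta) / (g k + l) <= 2 * r * m.
  apply: (@le_trans _ _ (\int[mu]_x \sum_k ((g k + l)^-1 * (\1_D x * sqmod (psi x k))))).
    rewrite Rint_sum; last by move=> k; exact: L1Z.
    apply: ler_sum => k _; rewrite RintZ// mulrC ler_wpM2l// invr_ge0; exact: ltW.
  apply: (@le_trans _ _ (\int[mu]_x (m * \1_D x))).
    apply: le_Rint; [by apply: L1_sum => k; exact: L1Z|exact: L1Z|move=> x].
    under eq_bigr => k _ do rewrite mulrCA [_^-1 * _]mulrC.
    rewrite -mulr_sumr mulrC; have /andP[D0 _] := D01 x.
    by rewrite ler_wpM2r.
  rewrite RintZ// mulrC ler_wpM2r ?(ltW m0)//.
  by rewrite -lee_fin -L1_ge0_fin// integral_indic// setIT; exact: muD.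
apply: le_trans total.
have -> : \sum_k (2 * pi * g k - N%:R * eta) / (g k + l) =
   2 * pi * N%:R - (2 * pi * l + N%:R * eta) * \sum_k (g k + l)^-1.
  have -> : 2 * pi * N%:R = \sum_(k < N) (2 * pi) :> R by rewrite sumr_const card_ord mulr_natr.
  rewrite mulr_sumr -sumrB.
  by apply: eq_bigr => k _; field; rewrite gt_eqF.
rewrite lerD2l lerN2; have [N0|N0] := posnP N.
  have -> : \sum_k (g k + l)^-1 = 0.
    by apply: big1 => k _; have := ltn_ord k; rewrite [X in (_ < X)%N]N0.
  have -> : (N%:R : R) = 0 by rewrite N0.
  by rewrite !mul0r.
apply: ler_wpM2l => //; rewrite addr_ge0//.
  by rewrite mulr_ge0 ?(ltW l0)// mulr_ge0// pi_ge0.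
rewrite mulr_ge0//; apply: le_trans (tail (Ordinal N0)).
by apply: Rint_ge0 => x; case: ifP => // _; exact: sqmod_ge0.
Qed.

(** * Compact spectra and separated nodes *)

Lemma compact_thickening R (S U : set R) : compact S -> open U -> S `<=` U ->
  exists2 e, 0 < e & forall t u, S u -> `|t - u| <= e -> U t.
Proof.
move=> /compact_near_coveringP cS oU SU.
have := cS R (0^'+)%R (fun e x => forall t, `|t - x| <= e -> U t) _.
case.
- move=> x Sx; have := oU; rewrite openE => /(_ x (SU x Sx)) /nbhs_ballP[r /= r0 rU].
  exists ([set y | `|x - y| < r / 2], [set e | e < r / 2]) => /=.
    split; first by apply/nbhs_ballP; exists (r / 2) => //=; rewrite divr_gt0.
    by apply: nbhs_right_lt; rewrite divr_gt0.
  move=> [y e] /= [xy er] t ty; apply: rU; rewrite /ball/=.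
  apply: le_lt_trans (ler_distD y _ _) _; rewrite [`|y - t|]distrC.
  by move: xy er ty; lra.
- move=> r /= r0 H; exists (r / 2); first by rewrite divr_gt0.
  move=> t u Su tu; apply: (H (r / 2) _ _ u Su t tu).
    by rewrite /= sub0r normrN gtr0_norm ?divr_gt0//; move: r0; rewrite /=; lra.
  by rewrite divr_gt0.
Qed.

Lemma uniformly_discreteP R (A : set R) : uniformly_discrete A ->
  exists2 s, 0 < s & forall x y, A x -> A y -> x <> y -> s <= `|x - y|.
Proof.
rewrite /uniformly_discrete; set I := ereal_inf _ => I0.
have HI x y : A x -> A y -> x <> y -> (I <= `|x - y|%:E)%E.
  by move=> Ax Ay xy; apply: ereal_inf_lbound; exists x, y.
move: I0 HI; case: I => [s| |] //.
  by rewrite lte_fin => s0 HI; exists s.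
by move=> _ HI; exists 1 => // x y Ax Ay xy; have := HI x y Ax Ay xy; rewrite leye_eq.
Qed.

(** Rounding [x / s] to an integer is injective on an [s]-separated set. *)
Lemma separated_size R (s r : R) (l : seq R) : 0 < s -> 1 <= r -> uniq l ->
  (forall x y, x \in l -> y \in l -> x != y -> s <= `|x - y|) ->
  (forall x, x \in l -> `|x| < r) -> (size l)%:R <= (2 / s + 4) * (2 * r).
Proof.
move=> s0 r1 ul sep lr.
pose B := (Num.truncn (r / s)).+1.
have rB : r / s < B%:R by exact: truncnS_gt.
have Br : B%:R <= r / s + 1.
  rewrite /B -natr1 lerD2r truncn_le// divr_ge0// ?(ltW s0)//; lra.
pose h x := Num.truncn (x / s + B%:R).
have h0 x : x \in l -> 0 <= x / s + B%:R /\ x / s + B%:R < (2 * B)%:R.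
  move=> /lr; rewrite ltr_norml => /andP[x1 x2].
  have a1 : x / s <= r / s by rewrite ler_pM2r ?invr_gt0// ltW.
  have a2 : - (r / s) <= x / s by rewrite -mulNr ler_pM2r ?invr_gt0// ltW.
  by rewrite natrM; split; lra.
have hinj : {in l &, injective h}.
  move=> x y xl yl hxy; apply/eqP; apply/negPn/negP => xy.
  have := sep x y xl yl xy.
  have /andP[x1 x2] := truncn_itv (h0 x xl).1.
  have /andP[y1 y2] := truncn_itv (h0 y yl).1.
  rewrite -/(h x) in x1 x2; rewrite -/(h y) -hxy in y1 y2.
  have : `|x / s - y / s| < 1.
    rewrite -[X in _ < X](_ : (h x).+1%:R - (h x)%:R = 1 :> R); last by rewrite -natr1; ring.
    by rewrite ltr_norml; apply/andP; split; lra.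
  rewrite -mulrBl normrM normfV (gtr0_norm s0) ltr_pdivrMr// mul1r.
  by move=> /lt_le_trans h1 /h1; rewrite ltxx.
have : (size l <= 2 * B)%N.
  rewrite -(size_map h) -(size_iota 0 (2 * B)); apply: uniq_leq_size.
    by rewrite map_inj_in_uniq.
  move=> k /mapP[x xl ->]; rewrite mem_iota /= add0n.
  rewrite truncn_lt_nat; have [? ?] := h0 x xl; [by []|lra].
rewrite -(ler_nat R) natrM => /le_trans -> //.
have : r / s * 1 <= r / s * 4 by apply: ler_wpM2l; [rewrite divr_ge0 ?(ltW s0)//; lra|lra].
have -> : (2 / s + 4) * (2 * r) = 4 * (r / s) + 8 * r by ring.
by lra.
Qed.

Lemma l2norm_fin R (A : set R) (u : R -> R[i]) (d : R) (l : seq R) : 0 <= d ->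
  (l2norm A u <= d%:E)%E -> uniq l -> (forall x, x \in l -> A x) ->
  \sum_(x <- l) sqmod (u x) <= d ^+ 2.
Proof.
move=> d0; rewrite /l2norm; set E := (\esum_(_ in _) _)%E => Ed ul lA.
have E0 : (0 <= E)%E by apply: esum_ge0 => x _; rewrite lee_fin sqr_ge0.
have : (E <= (d ^+ 2)%:E)%E.
  have : ((E `^ 2^-1) `^ 2 <= (d%:E) `^ 2)%E.
    by apply: gt0_ler_poweR => //; rewrite in_itv/= ?poweR_ge0 ?lee_fin ?leey ?d0.
  by rewrite -poweRrM mulVf// poweRe1// poweR_EFin powR_mulrn.
apply: contraTT; rewrite -!ltNge => h; apply: (@lt_le_trans _ _ (\sum_(x <- l) sqmod (u x))%:E).
  by rewrite lte_fin.
apply: esum_ge; exists [set` l]; first by split; [exact: finite_seq|move=> x /= /lA].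
rewrite -fsbig_seq//= -sumEFin le_eqVlt; apply/orP; left; apply/eqP.
by apply: eq_bigr => x _; rewrite normc_sq.
Qed.

(** * The density bound *)

(** Multiply [f xi] by the power [M.+1] of the Fejer factor of width
    [delta / M.+1] centred at [xi].  The spectrum moves by at most [delta], and
    so stays in [U]; the interpolation error does not increase; and since
    [M.+1] is at most a small multiple of [r], the energy outside the interval
    of radius [(1 + nu) r] is divided by [4 ^ (2 M.+1)].  Then
    [concentration_count] applies to the products. *)
Lemma nodes_count R (d T m delta nu l r B : R) (U S : set R)
    (f : R -> R -> R[i]) (Lambda : set R) (M : nat) (s : seq R) :
  0 < d -> 0 < T -> measurable U -> 0 < m -> (mu U <= m%:E)%E -> 0 < delta ->
  (forall t, S t -> `|t| <= T) ->
  (forall t u, S u -> `|t - u| <= delta -> U t) ->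
  0 < nu -> 0 < l -> 0 < r -> 0 <= B ->
  4 * M.+1%:R <= delta * nu * r ->
  uniq s -> (forall x, x \in s -> Lambda x /\ `|x| < r) ->
  (forall xi, Lambda xi -> `|xi| < r -> [/\ PW S (f xi),
     (l2norm Lambda (fun l => f xi l - kronecker xi l)%R <= d%:E)%E &
     (L2norm (f xi) <= B%:E)%E]) ->
  2 * pi * (size s)%:R - (2 * pi * l + (size s)%:R * ((4^-1) ^+ (2 * M.+1) * B ^+ 2)) *
    ((size s)%:R * (m + d ^+ 2 / l)) <= 2 * ((1 + nu) * r) * m.
Proof.
move=> d0 T0 mU m0 Um del0 ST SU nu0 l0 r0 B0 Mr us sL Hf.
pose a := delta / M.+1%:R.
have a0 : 0 < a by rewrite divr_gt0.
have Ma : M.+1%:R * a = delta by rewrite /a mulrCA divff ?mulr1// pnatr_eq0.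
pose xi (i : 'I_(size s)) := nth 0 s i.
have xis i : xi i \in s by exact: mem_nth.
have xiL i : Lambda (xi i) by have [] := sL _ (xis i).
have xir i : `|xi i| < r by have [] := sL _ (xis i).
have T1 : 0 < T + delta by exact: addr_gt0.
have hft0 y : 0 <= hat_ft a y by exact: hat_ft_ge0.
have hft1 y : hat_ft a y <= 1 by exact: hat_ft_le1.
have ex i : exists G : R -> R[i], [/\ lipC (T + delta) G, forall t, ~ U t -> G t = 0 &
    forall x, fourier G x = (hat_ft a (x - xi i) ^+ M.+1)%:C * f (xi i) x].
  have [[_ [F [FL FS fF]]] _ _] := Hf _ (xiL i) (xir i).
  have FT u : T < `|u| -> F u = 0.
    move=> Tu; apply: FS => Su; have := ST u Su; by rewrite leNgt Tu.
  have iF := inL2_CL1 FL FT.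
  have [G [l1 l2 Gs GE]] := mollify (xi i) M T0 a0 iF FT.
  exists G; split.
  - by rewrite -Ma; split.
  - move=> t Ut; apply/eqP/negPn/negP => /Gs [u [Fu]]; rewrite Ma => tu; apply: Ut.
    apply: (SU t u) => //; apply: contrapT => Su.
    by move: Fu; rewrite FS ?eqxx.
  - by move=> x; rewrite GE fF.
have [G HG] := choice ex.
have lG i : lipC (T + delta) (G i) by have [] := HG i.
have GU i t : ~ U t -> G i t = 0 by have [_ + _] := HG i; apply.
have GE i x : fourier (G i) x = (hat_ft a (x - xi i) ^+ M.+1)%:C * f (xi i) x.
  by have [_ _] := HG i; apply.
have fL i : inL2 (f (xi i)) by have [[? _] _ _] := Hf _ (xiL i) (xir i).
have sqG i x : sqmod (fourier (G i) x) = hat_ft a (x - xi i) ^+ (2 * M.+1) * sqmod (f (xi i) x).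
  by rewrite GE sqmodM sqmod_real -exprM mulnC.
have iG i : L1 (fun x => sqmod (fourier (G i) x)).
  have [m1 m2] := lipC_fourier_measurable (lG i).
  apply: L1_dominated (inL2_sqmod (fL i)); first exact: measurable_sqmod m1 m2.
  move=> x; rewrite ger0_norm ?sqmod_ge0// sqG ler_piMl ?sqmod_ge0//.
  by rewrite exprn_ile1.
apply: (@concentration_count R (size s) (T + delta) m l ((1 + nu) * r) _ (d ^+ 2) U G xi) => //.
- by rewrite mulr_ge0 ?(ltW r0)//; lra.
- move=> i; have [_ _ fB] := Hf _ (xiL i) (xir i).
  have fB2 := L2norm_le (fL i) B0 fB.
  apply: (@le_trans _ _ (\int[mu]_x ((4^-1) ^+ (2 * M.+1) * sqmod (f (xi i) x)))); last first.
    rewrite RintZ; last exact: inL2_sqmod.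
    by rewrite ler_wpM2l// exprn_ge0// invr_ge0.
  (* the factor is at most 4 / (a y) ^ 2, and |a y| >= 4 out there *)
  have le4 x : (1 + nu) * r < `|x| -> hat_ft a (x - xi i) <= 4^-1.
    move=> xr; have xxi : nu * r <= `|x - xi i|.
      have := lerB_dist x (xi i); have := xir i; lra.
    have p0 : 0 < nu * r by exact: mulr_gt0.
    have xn0 : x - xi i != 0 by rewrite -normr_gt0 (lt_le_trans p0).
    apply: le_trans (hat_ft_decay a0 xn0) _.
    have a4 : 4 <= a * (nu * r).
      by rewrite /a mulrAC ler_pdivlMr// mulrA.
    have a4' : 4 <= `|a * (x - xi i)|.
      rewrite normrM (gtr0_norm a0); apply: le_trans a4 _.
      by rewrite ler_wpM2l// ltW.
    rewrite ler_pdivrMr; last by rewrite exprn_even_gt0//= mulf_neq0// gt_eqF.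
    rewrite -[(a * _) ^+ 2]real_normK ?num_real//.
    have : 4 * 4 <= `|a * (x - xi i)| ^+ 2 by rewrite expr2; apply: ler_pM.
    lra.
  have i2 : L1 (fun x => (4^-1) ^+ (2 * M.+1) * sqmod (f (xi i) x)).
    by apply: L1Z; exact: inL2_sqmod.
  apply: le_Rint => //.
    apply: L1_dominated (iG i).
      apply: measurable_fun_if => //.
      - exact: measurable_fun_ltr.
      - by apply: measurable_funTS; exact: L1_measurable.
    by move=> x; case: ifP => _; rewrite ?normr0 ?sqmod_ge0// ger0_norm ?sqmod_ge0.
  move=> x; case: ifPn => [/le4 x4|_].
    by rewrite sqG; apply: ler_wpM2r; [exact: sqmod_ge0|apply: lerXn2r; rewrite ?nnegrE ?invr_ge0].
  by rewrite mulr_ge0 ?sqmod_ge0// exprn_ge0// invr_ge0.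
- move=> i; have [_ fd _] := Hf _ (xiL i) (xir i).
  apply: le_trans (l2norm_fin (ltW d0) fd us (fun x xs => (sL x xs).1)).
  rewrite (big_nth 0) big_mkord; apply: ler_sum => j _; rewrite -/(xi j).
  rewrite GE /kronecker (_ : (xi j == xi i) = (i == j)); last first.
    by rewrite /xi nth_uniq// eq_sym.
  case: eqVneq => [<-|_].
    by rewrite subrr hat_ft0 expr1n mul1r.
  rewrite !subr0 sqmodM sqmod_real ler_piMl ?sqmod_ge0//.
  by rewrite -exprM exprn_ile1.
Qed.

(** Sub-exponential growth [exp (r `^ gamma)] loses against [exp (- k r)]: the
    power [r `^ gamma] is eventually below [k r / 4]. *)
Lemma tail_vanishes R (gamma k e : R) : 0 < gamma < 1 -> 0 < k -> 0 < e ->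
  exists2 r0, 0 < r0 & forall r, r0 <= r -> r * expR (2 * r `^ gamma - k * r) <= e.
Proof.
move=> /andP[g0 g1] k0 e0; have g1' : 0 < 1 - gamma by rewrite subr_gt0.
pose q := (4 / k) `^ (1 - gamma)^-1.
have c0 : 0 < 16 / (k ^+ 2 * e) by rewrite divr_gt0// mulr_gt0// exprn_gt0.
exists (1 + q + 16 / (k ^+ 2 * e)).
  by rewrite addr_gt0// ltr_wpDr// powR_ge0.
move=> r rr; have q0 : 0 <= q by exact: powR_ge0.
have r0 : 0 < r by apply: lt_le_trans rr; rewrite addr_gt0// ltr_wpDr.
have rq : 4 / k <= r `^ (1 - gamma).
  have -> : 4 / k = q `^ (1 - gamma).
    by rewrite /q -powRrM mulVf ?gt_eqF// powRr1// divr_ge0// ltW.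
  by apply: ge0_ler_powR; [exact: ltW|rewrite nnegrE|rewrite nnegrE ltW|lra].
have rg : 2 * r `^ gamma <= k * r / 2.
  have {2}-> : r = r `^ gamma * r `^ (1 - gamma).
    by rewrite -powRD ?(gt_eqF r0) ?implybT// addrC subrK powRr1// ltW.
  rewrite ler_pdivlMr//; have -> : 2 * r `^ gamma * 2 = r `^ gamma * 4 by ring.
  rewrite mulrCA; apply: ler_wpM2l; first exact: powR_ge0.
  by rewrite mulrC -ler_pdivrMr.
have : expR (2 * r `^ gamma - k * r) <= expR (- (k * r / 2)).
  by rewrite ler_expR; lra.
move=> /(ler_wpM2l (ltW r0)) /le_trans; apply.
rewrite expRN ler_pdivrMr ?expR_gt0//.
have y0 : 0 <= k * r / 2 by rewrite divr_ge0// mulr_ge0// ltW.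
have ey : (k * r / 2) ^+ 2 / 4 <= expR (k * r / 2).
  have h := expR_ge1Dx (k * r / 4).
  have -> : k * r / 2 = k * r / 4 + k * r / 4 by field.
  rewrite expRD -expr2; have z0 : 0 <= k * r / 4 by lra.
  have : (1 + k * r / 4) ^+ 2 <= expR (k * r / 4) ^+ 2.
    by rewrite lerXn2r// nnegrE ?expR_ge0//; lra.
  by apply: le_trans; set z := k * r / 4 in z0 *; nra.
apply: (@le_trans _ _ (e * ((k * r / 2) ^+ 2 / 4))); last by rewrite ler_pM2l.
have -> : e * ((k * r / 2) ^+ 2 / 4) = r * (r / (16 / (k ^+ 2 * e))).
  by field; rewrite !gt_eqF.
rewrite ler_peMr ?(ltW r0)// ler_pdivlMr// mul1r; lra.
Qed.

Lemma seq_of_fset R (A : set R) : finite_set A ->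
  exists s : seq R, [/\ uniq s, forall x, x \in s <-> A x & counting A = (size s)%:R%:E :> \bar R].
Proof.
move=> fA; exists (finmap.enum_fset (fset_set A)); split.
- exact: finmap.fset_uniq.
- by move=> x; rewrite in_fset_set// inE.
- by rewrite /counting asboolT.
Qed.

(** From [exp (- 1/2) >= 1/2]. *)
Lemma expR1_le4 R : expR 1 <= 4 :> R.
Proof.
have := expR_ge1Dx (- (2^-1) : R); rewrite expRN => h.
have h2 : expR 2^-1 <= 2 :> R by rewrite -lef_pV2 ?posrE ?expR_gt0//; lra.
have -> : 1 = 2%:R * 2^-1 :> R by field.
rewrite expRM_natl; apply: (@le_trans _ _ (2 ^+ 2)); last by lra.
by rewrite lerXn2r ?nnegrE ?expR_ge0.
Qed.

(** With [M] proportional to the radius [r], the factor [4 ^ (- 2 M)] of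
    [nodes_count] beats the growth [exp (2 r `^ gamma)] because [gamma < 1].
    Hence, for every [e], the count of nodes in the interval of radius [r] is
    eventually at most [2 r (m(S) + e) / (2 pi (1 - d^2))].  The crude count
    [K (2 r)] coming from separation controls the error terms. *)
Theorem density_bound R (d : R) (S Lambda : set R) (f : R -> R -> R[i]) (C gamma : R) :
  0 < d < 1 -> compact S -> uniformly_discrete Lambda -> 0 < C -> 0 < gamma < 1 ->
  (forall xi, Lambda xi ->
     [/\ PW S (f xi),
         (l2norm Lambda (fun l => f xi l - kronecker xi l)%R <= d%:E)%E &
         (L2norm (f xi) <= (C * expR (`|xi| `^ gamma))%:E)%E]) ->
  ((2 * pi * (1 - d ^+ 2))%:E * upper_density Lambda <= lebesgue_measure S)%E.
Proof.
move=> /andP[d0 d1] cS /uniformly_discreteP[s s0 sep] C0 hg Hf.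
have mS : measurable S by exact: compact_measurable.
have Sfin := compact_finite_measure cS.
have [T T0 ST] : exists2 T, 0 < T & forall t, S t -> `|t| <= T.
  have [B [_ HB]] := compact_bounded cS.
  exists (`|B| + 1); first by rewrite ltr_wpDl.
  by move=> t St; apply: (HB (`|B| + 1)) => //; rewrite (le_lt_trans (ler_norm _))// ltrDl.
pose m0 := fine (mu S).
have m0E : mu S = m0%:E by rewrite /m0 fineK// ge0_fin_numE.
have m00 : 0 <= m0 by rewrite fine_ge0.
have pi0 : 0 < pi :> R by exact: pi_gt0.
have d2 : 0 < 1 - d ^+ 2 by rewrite subr_gt0 expr_lte1// ltW.
pose c := 2 * pi * (1 - d ^+ 2); have c0 : 0 < c by rewrite !mulr_gt0.
pose K := 2 / s + 4; have K0 : 0 < K by rewrite addr_gt0// divr_gt0.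
have finL r : 1 <= r -> finite_set (Lambda `&` [set x : R | (- r < x < r)%R]).
  move=> r1; apply: contrapT => /infinite_set_fsetP inf.
  have [n nK] : exists n : nat, K * (2 * r) < n%:R.
    by exists (Num.truncn (K * (2 * r))).+1; exact: truncnS_gt.
  have [B BL Bn] := inf n.
  have BLx x : x \in finmap.enum_fset B -> Lambda x /\ `|x| < r.
    by move=> xB; have [? /=] := BL x xB; rewrite ltr_norml.
  have := @separated_size R s r (finmap.enum_fset B) s0 r1 (finmap.fset_uniq B) _ (fun x xB => (BLx x xB).2).
  move=> /(_ _) h; have : (size (finmap.enum_fset B))%:R <= K * (2 * r).
    by apply: h => x y /BLx[? _] /BLx[? _] /eqP; exact: sep.
  apply/negP; rewrite -ltNge (lt_le_trans nK)// ler_nat; exact: Bn.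
have key e : 0 < e -> exists r0 : R, forall r, r0 < r ->
   (counting (Lambda `&` [set x : R | (- r < x < r)%R]) * ((2 * r)^-1)%:E <= ((m0 + e) / c)%:E)%E.
  (* four errors of [e / 4]: the measure of [U], the widening [nu], the
     regularisation [l] and the tails [eta] *)
  move=> e0; pose m := m0 + e / 4.
  have mp : 0 < m by rewrite ltr_wpDl// divr_gt0.
  have [U [oU SU USe]] := lebesgue_regularity_outer mS Sfin (divr_gt0 e0 (ltr0n R 4)).
  have mU : measurable U by exact: open_measurable.
  have Um : (mu U <= m%:E)%E.
    have -> : U = S `|` (U `\` S) by rewrite setDUK.
    apply: (@le_trans _ _ (mu S + mu (U `\` S))%E); first by apply: measureU2 => //; exact: measurableD.
    rewrite [X in (X + _ <= _)%E]m0E /m EFinD leeD2l// ltW//.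
  have [delta del0 SUd] := compact_thickening cS oU SU.
  pose nu := e / (4 * m); have nu0 : 0 < nu by rewrite divr_gt0// mulr_gt0.
  pose l := e / (4 * (K * (2 * pi * m))).
  have l0 : 0 < l by rewrite divr_gt0// !mulr_gt0.
  pose k := delta * nu / 4; have k0 : 0 < k by rewrite divr_gt0// mulr_gt0.
  pose A := K * (K * 2) * (m + d ^+ 2 / l) * (C ^+ 2 * expR 1).
  have A0 : 0 < A.
    rewrite !mulr_gt0 ?exprn_gt0 ?expR_gt0// addr_gt0// divr_gt0// exprn_gt0//.
  have [r0 r00 Hr0] := tail_vanishes hg k0 (divr_gt0 e0 (mulr_gt0 (ltr0n R 4) A0)).
  exists (1 + r0 + 1 / k) => r rr.
  have rp : 0 < r by apply: lt_trans rr; rewrite !addr_gt0// divr_gt0.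
  have k1 : 0 < 1 / k by rewrite divr_gt0.
  have r1 : 1 <= r by lra.
  have [sq [us sqL ->]] := seq_of_fset (finL r r1).
  have sL x : x \in sq -> Lambda x /\ `|x| < r.
    by move=> /sqL [? /=]; rewrite ltr_norml.
  rewrite -EFinM lee_fin.
  pose M := (Num.truncn (k * r)).-1.
  have kr1 : 1 <= k * r by rewrite mulrC -ler_pdivrMr//; lra.
  have tr1 : (0 < Num.truncn (k * r))%N by rewrite truncn_gt0.
  have ME : M.+1 = Num.truncn (k * r) by rewrite /M prednK.
  have /andP[M1 M2] := @truncn_itv R (k * r) (le_trans ler01 kr1).
  rewrite -ME in M1 M2.
  pose B := C * expR (r `^ gamma).
  have B0 : 0 <= B by rewrite mulr_ge0 ?expR_ge0// ltW.
  have Mr : 4 * M.+1%:R <= delta * nu * r.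
    by move: M1; rewrite /k; lra.
  have Hf' xi : Lambda xi -> `|xi| < r -> [/\ PW S (f xi),
     (l2norm Lambda (fun l => f xi l - kronecker xi l)%R <= d%:E)%E &
     (L2norm (f xi) <= B%:E)%E].
    move=> Lxi xir; have [h1 h2 h3] := Hf xi Lxi; split; [exact: h1|exact: h2|apply: (le_trans h3)].
    rewrite lee_fin ler_wpM2l ?(ltW C0)// ler_expR.
    have /andP[g0 _] := hg.
    by apply: ge0_ler_powR; rewrite ?nnegrE ?(ltW xir)// ltW.
  have main := @nodes_count R d T m delta nu l r B U S f Lambda M sq d0 T0 mU mp Um del0 ST SUd
     nu0 l0 rp B0 Mr us sL Hf'.
  have NK : (size sq)%:R <= K * (2 * r).
    apply: (separated_size s0 r1 us) => [x y /sL[? _] /sL[? _] /eqP|x /sL[]//].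
    exact: sep.
  move: main NK; set N := (size sq)%:R; set eta := _ ^+ _ * B ^+ 2.
  have N0 : 0 <= N by exact: ler0n.
  have eta0 : 0 <= eta by rewrite mulr_ge0 ?exprn_ge0// invr_ge0.
  have etaB : eta <= C ^+ 2 * expR 1 * expR (2 * r `^ gamma - k * r).
    have -> : C ^+ 2 * expR 1 * expR (2 * r `^ gamma - k * r) = expR (1 - k * r) * B ^+ 2.
      rewrite /B exprMn -expRM_natl expRD (expRD 1) mulr_natl; ring.
    rewrite ler_wpM2r ?sqr_ge0//; apply: (@le_trans _ _ (expR (- M.+1%:R))).
      rewrite expRN -[M.+1%:R]mulr1 expRM_natl -exprVn exprM.
      rewrite lerXn2r// ?nnegrE ?sqr_ge0 ?invr_ge0 ?expR_ge0//.
      rewrite exprVn lef_pV2 ?posrE ?expR_gt0 ?exprn_gt0//.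
      by apply: (le_trans (expR1_le4 R)); rewrite -natrX ler_nat.
    rewrite ler_expR; move: M2; rewrite -natr1; lra.
  move=> main NK; rewrite ler_pdivrMr ?mulr_gt0// mulrAC ler_pdivlMr//.
  have Neta : N * eta * (m + d ^+ 2 / l) * N <= 2 * r * (e / 4).
    have md : 0 <= m + d ^+ 2 / l by rewrite addr_ge0 ?(ltW mp)// divr_ge0 ?sqr_ge0// ltW.
    have K2r : 0 <= K * (2 * r) by rewrite !mulr_ge0// ltW.
    apply: (@le_trans _ _ (K * (2 * r) * (C ^+ 2 * expR 1 * expR (2 * r `^ gamma - k * r)) *
       (m + d ^+ 2 / l) * (K * (2 * r)))).
      apply: ler_pM; [exact: (mulr_ge0 (mulr_ge0 N0 eta0) md)|exact: N0| |exact: NK].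
      by apply: ler_wpM2r; [exact: md|exact: (ler_pM N0 eta0 NK etaB)].
    have h := Hr0 r _; have : r * expR (2 * r `^ gamma - k * r) <= e / (4 * A).
      by apply: h; lra.
    rewrite ler_pdivlMr; last exact: (mulr_gt0 (ltr0n R 4) A0).
    move=> hh.
    have -> : K * (2 * r) * (C ^+ 2 * expR 1 * expR (2 * r `^ gamma - k * r)) *
       (m + d ^+ 2 / l) * (K * (2 * r)) = 2 * r * (r * expR (2 * r `^ gamma - k * r) * A).
      by rewrite /A; ring.
    rewrite ler_wpM2l//; first by rewrite mulr_ge0// ltW.
    lra.
  have lm : 2 * pi * l * m * N <= 2 * r * (e / 4).
    apply: (@le_trans _ _ (2 * pi * l * m * (K * (2 * r)))).
      apply: ler_wpM2l NK.
      by rewrite (mulr_ge0 (mulr_ge0 (mulr_ge0 (ler0n _ 2) (ltW pi0)) (ltW l0)) (ltW mp)).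
    apply: le_of_eq; rewrite /l.
    have : 0 < (pi : R) := pi0; generalize (pi : R) => p p0; field.
    by rewrite (gt_eqF mp) (gt_eqF K0) (gt_eqF p0).
  have dl : 2 * pi * l * (d ^+ 2 / l) = 2 * pi * d ^+ 2 by field; rewrite (gt_eqF l0).
  have nm : 2 * (nu * r) * m = 2 * r * (e / 4).
    by rewrite /nu; field; rewrite (gt_eqF mp).
  have : c * N = 2 * pi * N - (2 * pi * l + N * eta) * (N * (m + d ^+ 2 / l))
     + 2 * pi * l * m * N + N * eta * (m + d ^+ 2 / l) * N.
    rewrite /c; have -> : 2 * pi * (1 - d ^+ 2) * N = 2 * pi * N - N * (2 * pi * d ^+ 2) by ring.
    by rewrite -dl; ring.
  rewrite [N * c]mulrC => ->.
  have : 2 * ((1 + nu) * r) * m = 2 * r * m + 2 * (nu * r) * m by ring.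
  rewrite nm => h1; move: main; rewrite h1 => main.
  apply: (@le_trans _ _ (2 * r * m + 2 * r * (e / 4) + 2 * r * (e / 4) + 2 * r * (e / 4))).
    by apply: lerD Neta; apply: lerD main lm.
  by rewrite /m; apply: le_of_eq; field.
have ud e : 0 < e -> (upper_density Lambda <= ((m0 + e) / c)%:E)%E.
  move=> e0; have [r0 Hr0] := key e e0.
  apply: (@le_trans _ _ (ereal_sup ((fun a : R =>
      (counting (Lambda `&` [set x : R | (- a < x < a)%R]) * ((2 * a)^-1)%:E)%E) @` [set a | r0 < a]))).
    apply: ereal_inf_lbound; exists [set a | r0 < a] => //.
    by exists r0; split => //; exact: num_real.
  by apply: ge_ereal_sup => _ [a ra <-]; exact: Hr0.
rewrite m0E; apply/lee_addgt0Pr => e e0.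
have := lee_wpmul2l _ (ud e e0).
move=> /(_ c%:E); rewrite lee_fin => /(_ (ltW c0)) /le_trans; apply.
by rewrite -EFinM -EFinD lee_fin mulrCA divff ?mulr1// gt_eqF.
Qed.

(** * Sinc windows and trigonometric polynomials *)

Lemma L2norm_le_sqrt R (f : R -> R[i]) (K : R) : 0 <= K ->
  (\int[mu]_x (sqmod (f x))%:E <= (K ^+ 2)%:E)%E -> (L2norm f <= K%:E)%E.
Proof.
rewrite -L2norm_sq /L2norm => K0; set E := Lnorm _ _ _.
have : (0 <= E)%E by exact: Lnorm_ge0.
case: E => [r| |]; last by [].
  rewrite poweR_EFin !lee_fin => r0; rewrite powR_mulrn// => h.
  by move: h; rewrite ler_sqr ?nnegrE.
by rewrite poweRyr ?leye_eq// pnatr_eq0.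
Qed.

(** Bounds and supports add up, so linear combinations stay in this class; for
    [inL2] the same would call for Minkowski's inequality. *)
Definition boxed R (F : R -> R[i]) : Prop :=
  [/\ measurable_fun setT (re F), measurable_fun setT (im F),
      exists K, forall t, `|re F t| <= K /\ `|im F t| <= K &
      exists T, forall t, T < `|t| -> F t = 0].

Lemma boxed0 R : boxed (fun=> 0 : R[i]).
Proof.
split; [exact: measurable_cst|exact: measurable_cst|exists 0|by exists 0].
by move=> t; rewrite /re /im /= normr0.
Qed.

Lemma boxed_axpy R (c : R[i]) (F G : R -> R[i]) : boxed F -> boxed G ->
  boxed (fun t => c * F t + G t).
Proof.
case: c => a b [mF1 mF2 [K FK] [T FT]] [mG1 mG2 [L GL] [U GU]].
have reE : re (fun t => (a +i* b) * F t + G t) = fun t => (a * re F t - b * im F t) + re G t.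
  by apply/funext => t; rewrite /re /im; case: (F t) => x y; case: (G t).
have imE : im (fun t => (a +i* b) * F t + G t) = fun t => (a * im F t + b * re F t) + im G t.
  by apply/funext => t; rewrite /re /im; case: (F t) => x y; case: (G t).
split.
- rewrite reE; apply: measurable_funD => //; apply: measurable_funB; exact: measurable_funM.
- rewrite imE; apply: measurable_funD => //; apply: measurable_funD; exact: measurable_funM.
- exists (`|a| * K + `|b| * K + L) => t; have [f1 f2] := FK t; have [g1 g2] := GL t.
  rewrite reE imE; split.
    apply: (le_trans (ler_normD _ _)); apply: lerD => //; apply: (le_trans (ler_normB _ _)).
    by rewrite !normrM; apply: lerD; exact: ler_wpM2l.
  apply: (le_trans (ler_normD _ _)); apply: lerD => //; apply: (le_trans (ler_normD _ _)).
  by rewrite !normrM; apply: lerD; exact: ler_wpM2l.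
- exists (Num.max T U) => t; rewrite gt_max => /andP[tT tU].
  by rewrite FT// GU// mulr0 addr0.
Qed.

Lemma boxed_inL2 R (F : R -> R[i]) : boxed F -> inL2 F.
Proof.
move=> [m1 m2 [K FK] [T FT]]; split => //.
have K0 : 0 <= K by have [h _] := FK 0; exact: le_trans (normr_ge0 _) h.
pose g : R -> R := (fun=> K ^+ 2 + K ^+ 2) \_ `[- T, T].
have ig : L1 g by apply: L1_restrict_itv; exact: cst_continuous.
have i2 : L1 (fun t => sqmod (F t)).
  apply: L1_dominated ig; first exact: measurable_sqmod.
  move=> t; rewrite ger0_norm ?sqmod_ge0// /g patchE; case: ifPn => tT.
    have [h1 h2] := FK t; rewrite /sqmod -/(re F t) -/(im F t).
    rewrite -(real_normK (num_real (re F t))) -(real_normK (num_real (im F t))).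
    by apply: lerD; rewrite lerXn2r ?nnegrE.
  rewrite FT; first by rewrite sqmod_real expr0n.
  rewrite ltNge; apply: contra tT => tT.
  by rewrite inE/= in_itv/= -ler_norml.
apply: (@lty_poweRy _ _ 2); first by rewrite pnatr_eq0.
by rewrite L2norm_sq L1_ge0_fin// ltry.
Qed.

Definition sinc R (y : R) : R := if y == 0 then 1 else sin y / y.

Lemma sinc0 R : sinc (0 : R) = 1.
Proof. by rewrite /sinc eqxx. Qed.

Lemma sinc_le R (y : R) : y != 0 -> `|sinc y| <= `|y|^-1.
Proof.
move=> y0; rewrite /sinc (negPf y0) normrM normfV ler_piMl ?invr_ge0//.
exact: sin_max.
Qed.

Lemma sinc_le1 R (y : R) : `|sinc y| <= 1.
Proof.
rewrite /sinc; case: eqVneq => [_|y0]; first by rewrite normr1.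
rewrite normrM normfV ler_pdivrMr ?normr_gt0// mul1r.
by have := sin_lip y 0; rewrite sin0 !subr0.
Qed.

Lemma sinc_sq_le R (y : R) : sinc y ^+ 2 * (1 + y ^+ 2) <= 2.
Proof.
have h1 : sinc y ^+ 2 <= 1.
  by rewrite -(real_normK (num_real _)) expr_le1// sinc_le1.
rewrite mulrDr mulr1 (_ : 2 = 1 + 1)//; apply: lerD => //.
rewrite -exprMn /sinc; case: eqVneq => [->|y0]; first by rewrite mul1r expr0n.
by rewrite divfK// -(real_normK (num_real _)) expr_le1// sin_max.
Qed.

Lemma measurable_sinc R : measurable_fun setT (@sinc R).
Proof.
apply: measurable_fun_if => //.
  by apply: measurable_fun_eqr; [exact: measurable_id|exact: measurable_cst].
have -> : [set: R] `&` [pred y : R | y == 0] @^-1` [set false] = [set y : R | y != 0].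
  by apply/seteqP; split => y /=; [case=> _ /= ->|move=> /negPf ->].
apply: open_continuous_measurable_fun; first exact: open_neq.
move=> y; rewrite inE /= => y0; apply: cvgM; first exact: continuous_sin.
by apply: cvgV => //; exact: cvg_id.
Qed.

(** The normalised indicator of the interval of radius [e] around [c], modulated
    so that its transform is a sinc centred at [xi]. *)
Definition box R (e xi c : R) (t : R) : R[i] :=
  if c - e <= t <= c + e then ((2 * e)^-1)%:C * expi ((c - t) * xi) else 0.

Lemma box_boxed R (e xi c : R) : 0 < e -> boxed (box e xi c).
Proof.
move=> e0; have mc : measurable_fun setT (fun t : R => c - e <= t <= c + e).
  by apply: measurable_and; apply: measurable_fun_ler; try exact: measurable_cst; exact: measurable_id.
have ml : measurable_fun setT (fun t : R => (c - t) * xi).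
  by apply: measurable_funM; [apply: measurable_funB; [exact: measurable_cst|exact: measurable_id]|exact: measurable_cst].
have reE : re (box e xi c) = fun t => if c - e <= t <= c + e then (2 * e)^-1 * cos ((c - t) * xi) else 0.
  by apply/funext => t; rewrite /re /box; case: ifP => //= _; rewrite mul0r subr0.
have imE : im (box e xi c) = fun t => if c - e <= t <= c + e then (2 * e)^-1 * sin ((c - t) * xi) else 0.
  by apply/funext => t; rewrite /im /box; case: ifP => //= _; rewrite mul0r addr0.
split.
- rewrite reE; apply: measurable_fun_ifT => //; apply: measurable_funM => //.
  exact: (measurableT_comp (continuous_measurable_fun (@continuous_cos R))).
- rewrite imE; apply: measurable_fun_ifT => //; apply: measurable_funM => //.
  exact: (measurableT_comp (continuous_measurable_fun (@continuous_sin R))).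
- have e1 : 0 <= (2 * e)^-1 by rewrite invr_ge0 mulr_ge0// ltW.
  exists ((2 * e)^-1) => t; rewrite reE imE; case: ifP => _; last by rewrite normr0.
  by rewrite !normrM (ger0_norm e1); split; rewrite ler_piMr// ?cos_max ?sin_max.
- exists (`|c| + e) => t; rewrite /box; case: ifP => // /andP[t1 t2].
  rewrite ltNge => /negP[]; rewrite ler_norml.
  have := ler_norm c; have := ler_norm (- c); rewrite normrN => *; apply/andP; split; lra.
Qed.

Lemma box_support R (e xi c t : R) : box e xi c t != 0 -> `|t - c| <= e.
Proof.
rewrite /box; case: ifP => [/andP[h1 h2] _|_]; last by rewrite eqxx.
by rewrite ler_norml; apply/andP; split; lra.
Qed.

Lemma Rint_window R (a b : R) (f g : R -> R) :
  (forall t, f t = if a <= t <= b then g t else 0) ->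
  \int[mu]_t f t = \int[mu]_(t in `[a, b]) g t.
Proof.
move=> fg; rewrite [RHS]Rintegral_mkcond; apply: eq_Rintegral => t _.
rewrite fg patchE; have -> : (t \in `[a, b]%classic) = (a <= t <= b).
  by apply/idP/idP => h; [move: h; rewrite inE/= in_itv|rewrite inE/= in_itv].
by [].
Qed.

Lemma Rint_cos_window R (e c u q : R) : 0 < e ->
  \int[mu]_(t in `[c - e, c + e]) ((2 * e)^-1 * cos (t * u + q)) =
  sinc (e * u) * cos (c * u + q).
Proof.
move=> e0; have en0 : e != 0 by rewrite gt_eqF.
have ce : c - e <= c + e by lra.
have cc : continuous (fun t : R => (2 * e)^-1 * cos (t * u + q)).
  have cl : continuous (fun t : R => t * u + q).
    by move=> x; apply: cvgD; [apply: cvgM; [exact: cvg_id|exact: cvg_cst]|exact: cvg_cst].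
  move=> x; apply: cvgM; first exact: cvg_cst.
  by apply: continuous_comp; [exact: cl|exact: continuous_cos].
have [u0|u0] := eqVneq u 0.
  rewrite u0 in cc *.
  have -> : \int[mu]_(t in `[c - e, c + e]) ((2 * e)^-1 * cos (t * 0 + q)) =
      \int[mu]_(t in `[c - e, c + e]) ((2 * e)^-1 * cos q).
    by apply: eq_Rintegral => t _; rewrite mulr0 add0r.
  by rewrite Rint_cst_itv// !mulr0 sinc0 add0r; field.
pose F t := (2 * e)^-1 * (sin (t * u + q) / u).
have -> : \int[mu]_(t in `[c - e, c + e]) ((2 * e)^-1 * cos (t * u + q)) = F (c + e) - F (c - e).
  apply: Rint_FTC => //.
  by move=> x; apply: is_derive_eq; rewrite /GRing.scale/=; field; rewrite en0 u0.
rewrite /F /sinc mulf_eq0 (negPf en0) (negPf u0) /=.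
have -> : (c - e) * u + q = (c * u + q) - e * u by ring.
have -> : (c + e) * u + q = (c * u + q) + e * u by ring.
by move: (c * u + q) => s; rewrite sinB sinD; field; rewrite en0 u0.
Qed.

Lemma fourier_box R (e xi c x : R) : 0 < e ->
  fourier (box e xi c) x = expi (c * x) * (sinc (e * (x - xi)))%:C.
Proof.
move=> e0; rewrite /fourier /Cintegral; set u := x - xi.
have prodE t : expi (t * x) * box e xi c t =
    if c - e <= t <= c + e then ((2 * e)^-1)%:C * expi (t * u + c * xi) else 0.
  rewrite /box; case: ifP => _; last by rewrite mulr0.
  rewrite mulrCA -expiD; congr (_ * expi _); rewrite /u; ring.
rewrite (@Rint_window _ (c - e) (c + e) _ (fun t => (2 * e)^-1 * cos (t * u + c * xi))); last first.
  by move=> t; rewrite prodE; case: ifP => //= _; rewrite mul0r subr0.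
rewrite (@Rint_window _ (c - e) (c + e) _ (fun t => (2 * e)^-1 * sin (t * u + c * xi))); last first.
  by move=> t; rewrite prodE; case: ifP => //= _; rewrite mul0r addr0.
rewrite Rint_cos_window//.
have -> : \int[mu]_(t in `[c - e, c + e]) ((2 * e)^-1 * sin (t * u + c * xi)) =
    \int[mu]_(t in `[c - e, c + e]) ((2 * e)^-1 * cos (t * u + (c * xi - pi / 2))).
  by apply: eq_Rintegral => t _; rewrite addrA cosBpihalf.
rewrite Rint_cos_window// addrA cosBpihalf.
have -> : c * u + c * xi = c * x by rewrite /u; ring.
by apply/eqP; rewrite /expi eq_complex/= !mulr0 subr0 add0r [_ * cos _]mulrC [_ * sin _]mulrC !eqxx.
Qed.

(** Coefficients and frequencies are listed with repetitions, so that products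
    never require collecting terms. *)
Definition trigpoly R (Z : R -> Prop) (g : R -> R) : Prop :=
  exists2 s : seq (R[i] * R), (forall p, p \in s -> Z p.2) &
    forall x, (g x)%:C = \sum_(p <- s) p.1 * expi (p.2 * x).

Lemma trigpoly_cst R (Z : R -> Prop) (k : R) : Z 0 -> trigpoly Z (fun=> k).
Proof.
move=> Z0; exists [:: (k%:C, 0)] => [p|x]; first by rewrite inE => /eqP ->.
by rewrite big_seq1 mul0r expi0 mulr1.
Qed.

Lemma expi_sin R (x : R) : (sin x)%:C = (0 +i* - (2^-1)) * expi x + (0 +i* 2^-1) * expi (- x) :> R[i].
Proof.
apply/eqP; rewrite /expi cosN sinN eq_complex/=; apply/andP; split; apply/eqP; by field.
Qed.

(** By Euler's formula a sine factor shifts every frequency by [a] both ways. *)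
Lemma trigpoly_sin R (Z Z' : R -> Prop) (g : R -> R) (a b : R) :
  (forall c, Z c -> Z' (c + a) /\ Z' (c - a)) ->
  trigpoly Z g -> trigpoly Z' (fun x => sin (a * (x - b)) * g x).
Proof.
move=> ZZ [s sZ gE].
pose h u p : R[i] * R := (p.1 * ((0 +i* u) * expi (u * 2 * (a * b))), p.2 - u * 2 * a).
exists ([seq h (- 2^-1) p | p <- s] ++ [seq h 2^-1 p | p <- s]) => [p|x].
  by rewrite mem_cat => /orP[] /mapP[r /sZ/ZZ[h1 h2] ->] /=; [have -> : r.2 - - 2^-1 * 2 * a = r.2 + a by field|
    have -> : r.2 - 2^-1 * 2 * a = r.2 - a by field].
rewrite rmorphM/= gE expi_sin mulrDl !mulr_sumr big_cat !big_map/=.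
by congr (_ + _); apply: eq_bigr => p _; rewrite mulrCA -!mulrA; congr (_ * (_ * _));
  rewrite -!expiD; congr (expi _); field.
Qed.

Lemma boxed_sum R (e xi : R) (s : seq (R[i] * R)) : 0 < e ->
  boxed (fun t => \sum_(p <- s) p.1 * box e xi p.2 t).
Proof.
move=> e0; elim: s => [|p s IH].
  rewrite (_ : (fun t => _) = fun=> 0); first exact: boxed0.
  by apply/funext => t; rewrite big_nil.
rewrite (_ : (fun t => _) = fun t => p.1 * box e xi p.2 t + \sum_(p <- s) p.1 * box e xi p.2 t).
  by apply: boxed_axpy => //; exact: box_boxed.
by apply/funext => t; rewrite big_cons.
Qed.

Lemma fourier_box_sum R (e xi x : R) (s : seq (R[i] * R)) : 0 < e ->
  fourier (fun t => \sum_(p <- s) p.1 * box e xi p.2 t) x =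
  (\sum_(p <- s) p.1 * expi (p.2 * x)) * (sinc (e * (x - xi)))%:C.
Proof.
move=> e0; pose F (i : 'I_(size s)) := box e xi (tnth (in_tuple s) i).2.
pose c (i : 'I_(size s)) := (tnth (in_tuple s) i).1.
have FE t : \sum_(p <- s) p.1 * box e xi p.2 t = \sum_i c i * F i t by rewrite big_tnth.
rewrite (_ : (fun t => _) = fun t => \sum_i c i * F i t); last by apply/funext => t; exact: FE.
rewrite fourier_comb.
  rewrite big_distrl/= [in RHS]big_tnth; apply: eq_bigr => i _.
  by rewrite /F fourier_box// mulrA.
move=> j; have bj := box_boxed xi (tnth (in_tuple s) j).2 e0.
by have [_ _ _ [T FT]] := bj; exact: inL2_CL1 (boxed_inL2 bj) FT.
Qed.

Lemma L1_oneDsqrV R : L1 (fun x : R => (1 + x ^+ 2)^-1).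
Proof.
apply: L1_ge0; first exact: (continuous_measurable_fun (@continuous_oneDsqrV R)).
  by move=> x; rewrite invr_ge0 addr_ge0// sqr_ge0.
rewrite ge0_symfun_integralT; last first.
- by move=> x /=; rewrite sqrrN.
- exact: continuous_oneDsqrV.
- by move=> x; rewrite invr_ge0 addr_ge0// sqr_ge0.
have -> : [set x : R | 0 <= x] = `[0, +oo[%classic.
  by apply/seteqP; split => x /=; rewrite in_itv/= andbT.
by rewrite (integral0y_oneDsqr R) -EFinM ltry.
Qed.

(** The square root of the integral of the bound of [sinc_window_le], without
    its factor in [xi]. *)
Definition sinc_const R (e : R) : R :=
  Num.sqrt (18 / e ^+ 2 * \int[mu]_x (1 + x ^+ 2)^-1).

(** Peetre's inequality trades the translation by [xi] for a factor polynomial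
    in [xi], so that one integrable weight dominates all the windows. *)
Lemma sinc_window_le R (e xi x : R) : 0 < e <= 1 ->
  sinc (e * (x - xi)) ^+ 2 <= 18 / e ^+ 2 * expR (2 / 3 * `|xi|) * (1 + x ^+ 2)^-1.
Proof.
move=> /andP[e0 e1]; set u := x - xi.
have e2 : 0 < e ^+ 2 by rewrite exprn_gt0.
have e21 : e ^+ 2 <= 1 by rewrite expr_le1// ltW.
have x0 : 0 < 1 + x ^+ 2 by rewrite ltr_pwDl ?sqr_ge0.
have u0 : 0 < 1 + u ^+ 2 by rewrite ltr_pwDl ?sqr_ge0.
have h1 : sinc (e * u) ^+ 2 * (e ^+ 2 * (1 + u ^+ 2)) <= 2.
  apply: le_trans (sinc_sq_le (e * u)); apply: ler_wpM2l; first exact: sqr_ge0.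
  by rewrite exprMn mulrDr mulr1 lerD2r.
have h2 : 1 + x ^+ 2 <= 2 * (1 + xi ^+ 2) * (1 + u ^+ 2).
  have -> : x = xi + u by rewrite /u; ring.
  rewrite -subr_ge0 (_ : _ - _ = 1 + (xi - u) ^+ 2 + 2 * (xi * u) ^+ 2); last by ring.
  by apply: addr_ge0; [apply: addr_ge0 => //; exact: sqr_ge0|apply: mulr_ge0 => //; exact: sqr_ge0].
have h3 : 1 + xi ^+ 2 <= 9 / 2 * expR (2 / 3 * `|xi|).
  have y0 : 0 <= 2 / 3 * `|xi| by rewrite mulr_ge0.
  have := @expR_ge1Dxn _ _ 1%N y0; rewrite exprMn real_normK ?num_real// => h.
  have : 2`!%:R = 2 :> R by [].
  by move=> E; rewrite E in h; have := sqr_ge0 xi; lra.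
have E0 : 0 <= expR (2 / 3 * `|xi|) by exact: expR_ge0.
have h4 : 1 + x ^+ 2 <= 9 * expR (2 / 3 * `|xi|) * (1 + u ^+ 2).
  apply: le_trans h2 _; apply: ler_wpM2r; [exact: ltW|lra].
rewrite ler_pdivlMr// -mulrA [_^-1 * _]mulrC mulrA ler_pdivlMr//.
apply: (@le_trans _ _ (9 * expR (2 / 3 * `|xi|) * (sinc (e * u) ^+ 2 * (e ^+ 2 * (1 + u ^+ 2))))).
  rewrite [leRHS](_ : _ = sinc (e * u) ^+ 2 * e ^+ 2 * (9 * expR (2 / 3 * `|xi|) * (1 + u ^+ 2))); last by ring.
  by rewrite mulrAC; apply: ler_wpM2l h4; rewrite mulr_ge0 ?sqr_ge0.
apply: (@le_trans _ _ (9 * expR (2 / 3 * `|xi|) * 2)); last by lra.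
by apply: ler_wpM2l h1; rewrite mulr_ge0.
Qed.

(** Such a product is the transform of a combination of boxes centred at the
    frequencies of [g]. *)
Lemma trigpoly_PW R (Z : R -> Prop) (S : set R) (g : R -> R) (e xi K : R) :
  0 < e <= 1 -> trigpoly Z g -> continuous g -> (forall x, `|g x| <= K) ->
  (forall c t, Z c -> `|t - c| <= e -> S t) ->
  let f x : R[i] := (g x * sinc (e * (x - xi)))%:C in
  PW S f /\ (L2norm f <= (K * sinc_const e * expR (`|xi| / 3))%:E)%E.
Proof.
move=> he [s sZ gE] cg gK ZS f; have /andP[e0 e1] := he.
have K0 : 0 <= K by exact: le_trans (normr_ge0 _) (gK 0).
have mg := continuous_measurable_fun cg.
have ms : measurable_fun setT (fun x : R => sinc (e * (x - xi))).
  apply: (measurableT_comp (@measurable_sinc R)); apply: measurable_funM; first exact: measurable_cst.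
  by apply: measurable_funB; [exact: measurable_id|exact: measurable_cst].
have mf := measurable_funM mg ms.
have m2 : measurable_fun setT (fun x => sqmod (f x)) by apply: measurable_sqmod => //; exact: measurable_cst.
pose c := K ^+ 2 * (18 / e ^+ 2 * expR (2 / 3 * `|xi|)).
have c0 : 0 <= c by rewrite mulr_ge0 ?sqr_ge0// mulr_ge0 ?expR_ge0// divr_ge0// sqr_ge0.
have fle x : sqmod (f x) <= c * (1 + x ^+ 2)^-1.
  rewrite /f sqmod_real exprMn /c -mulrA; apply: ler_pM; rewrite ?sqr_ge0//; last exact: sinc_window_le.
  by rewrite -(real_normK (num_real _)) lerXn2r ?nnegrE.
have iw : L1 (fun x : R => c * (1 + x ^+ 2)^-1) by apply: L1Z; exact: L1_oneDsqrV.
have i2 : L1 (fun x => sqmod (f x)).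
  by apply: L1_dominated iw => // x; rewrite ger0_norm ?sqmod_ge0.
have fK : (L2norm f <= (K * sinc_const e * expR (`|xi| / 3))%:E)%E.
  have W0 : 0 <= \int[mu]_x (1 + x ^+ 2)^-1 :> R.
    by apply: Rint_ge0 => x; rewrite invr_ge0 addr_ge0// sqr_ge0.
  apply: L2norm_le_sqrt; first by rewrite !mulr_ge0 ?expR_ge0 ?sqrtr_ge0.
  rewrite L1_ge0_fin// lee_fin; apply: le_trans (le_Rint i2 iw fle) _.
  rewrite RintZ; last exact: L1_oneDsqrV.
  rewrite !exprMn /sinc_const sqr_sqrtr; last by rewrite mulr_ge0// divr_ge0// sqr_ge0.
  rewrite -expRM_natl (_ : 2%:R * (`|xi| / 3) = 2 / 3 * `|xi|); last by field.
  by rewrite /c; apply: le_of_eq; ring.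
split=> //; split.
  split; [exact: mf|exact: measurable_cst|exact: le_lt_trans fK (ltry _)].
exists (fun t => \sum_(p <- s) p.1 * box e xi p.2 t); split.
- by apply: boxed_inL2; exact: boxed_sum.
- move=> t St; rewrite big_seq big1// => p ps.
  have [->|/box_support h] := eqVneq (box e xi p.2 t) 0; first by rewrite mulr0.
  by exfalso; apply: St; exact: ZS (sZ _ ps) h.
- by move=> x; rewrite fourier_box_sum// -gE /f rmorphM.
Qed.

(** * Products of sines with spectrum in short bands *)

(** With [j <= 2 J], the centres are the multiples [pi k] for [|k| <= J]. *)
Definition band R (J : nat) (h : R) (j : nat) : set R :=
  [set` `[pi * (j%:R - J%:R) - h, pi * (j%:R - J%:R) + h]].

Definition bands R (J : nat) (h : R) : set R :=
  \big[setU/set0]_(j < J.*2.+1) band J h j.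

Lemma bands_compact R (J : nat) (h : R) : compact (bands J h).
Proof. by apply: bigsetU_compact => j _; exact: segment_compact. Qed.

Lemma bands_measure R (J : nat) (h : R) : 0 <= h ->
  (mu (bands J h) <= (J.*2.+1%:R * (2 * h))%:E)%E.
Proof.
move=> h0; rewrite /bands; elim: (J.*2.+1) => [|n IH].
  by rewrite big_ord0 measure0 mul0r.
have mb j : measurable (band J h j) by exact: measurable_itv.
have mB : measurable (\big[setU/set0]_(j < n) band J h j).
  by apply: bigsetU_measurable => j _; exact: mb.
have sub A B : measurable A -> measurable B ->
    (mu (A `|` B : set R) <= mu A + mu B)%E by move=> *; exact: measureU2.
rewrite big_ord_recr /=; apply: le_trans (sub _ _ mB (mb n)) _.
rewrite -[n.+1%:R]natr1 mulrDl mul1r EFinD; apply: leeD => //.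
rewrite [X in (X <= _)%E]lebesgue_measure_itv /= lte_fin; case: ifP => _; last by rewrite lee_fin mulr_ge0.
by rewrite -EFinD lee_fin; apply: le_of_eq; ring.
Qed.

Lemma bandsP R (J : nat) (h t : R) (k : int) :
  (absz k <= J)%N -> `|t - pi * k%:~R| <= h -> bands J h t.
Proof.
move=> kJ; rewrite ler_norml => /andP[t1 t2].
have [j jE jJ] : exists2 j : nat, (Posz j = k + J%:Z)%R & (j < J.*2.+1)%N.
  by exists (absz (k + J%:Z)); lia.
have kE : k%:~R = j%:R - J%:R :> R.
  have -> : k = j%:Z - J%:Z by rewrite jE addrK.
  by rewrite rmorphB /=.
rewrite /bands -(bigcup_mkord _ (band J h)); exists j => //=.
by rewrite /band /= in_itv /=; rewrite kE in t1 t2; apply/andP; split; lra.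
Qed.

Definition near_pi R (m : nat) (h c : R) : Prop :=
  exists2 k : int, (absz k <= m)%N & `|c - pi * k%:~R| <= h.

Definition sprod R (a : R) (P : seq R) (x : R) : R :=
  \prod_(b <- P) sin (a * (x - b)).

Lemma sprod_cons R (a b x : R) (P : seq R) :
  sprod a (b :: P) x = sin (a * (x - b)) * sprod a P x.
Proof. exact: big_cons. Qed.

Lemma sprod_nil R (a x : R) : sprod a [::] x = 1.
Proof. exact: big_nil. Qed.

Lemma sprod_cat R (a x : R) (P Q : seq R) :
  sprod a (P ++ Q) x = sprod a P x * sprod a Q x.
Proof. exact: big_cat. Qed.

Lemma sprod_le1 R (a x : R) (P : seq R) : `|sprod a P x| <= 1.
Proof.
elim: P => [|b P IH]; first by rewrite sprod_nil normr1.
by rewrite sprod_cons normrM mulr_ile1// sin_max.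
Qed.

Lemma sprod_eq0 R (a x b : R) (P : seq R) : b \in P ->
  sin (a * (x - b)) = 0 -> sprod a P x = 0.
Proof.
move=> bP s0; elim: P bP => [//|c P IH]; rewrite inE sprod_cons => /orP[/eqP <-|/IH ->].
  by rewrite s0 mul0r.
by rewrite mulr0.
Qed.

Lemma continuous_sprod R (a : R) (P : seq R) : continuous (sprod a P).
Proof.
elim: P => [|b P IH].
  rewrite (_ : sprod a _ = fun=> 1); first exact: cst_continuous.
  by apply/funext => x; rewrite sprod_nil.
rewrite (_ : sprod a _ = fun x => sin (a * (x - b)) * sprod a P x); last first.
  by apply/funext => x; rewrite sprod_cons.
have cl : continuous (fun x : R => a * (x - b)).
  by move=> x; apply: cvgM; [exact: cvg_cst|apply: cvgB; [exact: cvg_id|exact: cvg_cst]].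
by move=> x; apply: cvgM; [apply: continuous_comp; [exact: cl|exact: continuous_sin]|exact: IH].
Qed.

(** A sine of frequency [pi] moves a frequency from one multiple of [pi] to the
    next; the slow sines together move it by at most [size Q * tau]. *)
Lemma trigpoly_sprods R (tau k : R) (P Q : seq R) : 0 <= tau ->
  trigpoly (near_pi (size P) ((size Q)%:R * tau)) (fun x => sprod pi P x * (sprod tau Q x * k)).
Proof.
move=> t0; elim: P => [|b P IH].
  rewrite (_ : (fun x => _) = fun x => sprod tau Q x * k); last first.
    by apply/funext => x; rewrite sprod_nil mul1r.
  elim: Q => [|b Q IH].
    rewrite (_ : (fun x => _) = fun x => k); last by apply/funext => x; rewrite sprod_nil mul1r.
    by apply: trigpoly_cst; exists 0%R => //; rewrite mulr0 subr0 normr0 mul0r.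
  rewrite (_ : (fun x => _) = fun x => sin (tau * (x - b)) * (sprod tau Q x * k)); last first.
    by apply/funext => x; rewrite sprod_cons mulrA.
  apply: trigpoly_sin IH => c [j j0 cj].
  have e u : `|u| = tau -> near_pi (size ([::] : seq R)) ((size (b :: Q))%:R * tau) (c + u).
    move=> ut; exists j => //; rewrite addrAC.
    have -> : (size (b :: Q))%:R * tau = (size Q)%:R * tau + tau by rewrite /= -natr1; ring.
    by apply: le_trans (ler_normD _ _) _; rewrite ut lerD2r.
  by split; apply: e; rewrite ?normrN ger0_norm.
rewrite (_ : (fun x => _) = fun x => sin (pi * (x - b)) * (sprod pi P x * (sprod tau Q x * k))); last first.
  by apply/funext => x; rewrite sprod_cons -!mulrA.
apply: trigpoly_sin IH => c [j j0 cj]; split.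
  exists (j + 1)%R; first by move: j0 => /=; lia.
  by have -> : c + pi - pi * (j + 1)%:~R = c - pi * j%:~R by rewrite rmorphD/=; ring.
exists (j - 1)%R; first by move: j0 => /=; lia.
by have -> : c - pi - pi * (j - 1)%:~R = c - pi * j%:~R by rewrite rmorphB/=; ring.
Qed.

Lemma sprods_PW R (e tau k xi : R) (P Q : seq R) (J : nat) :
  0 < e <= 1 -> 0 <= tau -> (size P <= J)%N -> (size Q)%:R * tau <= e ->
  let f x : R[i] := (sprod pi P x * (sprod tau Q x * k) * sinc (e * (x - xi)))%:C in
  PW (bands J (2 * e)) f /\ (L2norm f <= (`|k| * sinc_const e * expR (`|xi| / 3))%:E)%E.
Proof.
move=> he t0 PJ Qe; apply: (trigpoly_PW _ he (trigpoly_sprods k P Q t0)).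
- move=> x; apply: cvgM; first exact: continuous_sprod.
  by apply: cvgM; [exact: continuous_sprod|exact: cvg_cst].
- move=> x; rewrite !normrM mulrA ler_piMl// mulr_ile1// ?sprod_le1//.
- move=> c t [j jP cj] tc; apply: (@bandsP _ _ _ _ j); first exact: leq_trans jP PJ.
  have -> : t - pi * j%:~R = (t - c) + (c - pi * j%:~R) by ring.
  by apply: le_trans (ler_normD _ _) _; have := le_trans cj Qe; lra.
Qed.

(** * Lower and upper bounds for products of sines *)

(** The sine is the integral of the cosine, which is at least [1 / 2] there. *)
Lemma sin_ge_half R (x : R) : `|x| <= 1 -> `|x| / 2 <= `|sin x|.
Proof.
wlog x0 : x / 0 <= x.
  move=> H h; have [/H H0|/ltW x0] := leP 0 x; first exact: H0.
  by rewrite -normrN -[`|sin x|]normrN -sinN; apply: H; rewrite ?oppr_ge0// normrN.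
rewrite ger0_norm// => x1; apply: le_trans (ler_norm _).
have cg : continuous (fun t : R => cos t) by exact: continuous_cos.
have <- : \int[mu]_(t in `[0, x]) cos t = sin x.
  by rewrite -[RHS]subr0 -{2}(sin0 R); apply: Rint_FTC.
rewrite mulrC -[X in _ * X <= _]subr0 -Rint_cst_itv//; apply: le_Rintegral => //.
- by apply: continuous_integrable_itv; exact: cst_continuous.
- exact: continuous_integrable_itv.
- move=> t /=; rewrite in_itv/= => /andP[t0 tx].
  have t1 : t <= 1 by exact: le_trans tx x1.
  have : 1 - cos t <= t ^+ 2 / 2.
    rewrite -[t in cos t](_ : t / 2 *+ 2 = t); last by rewrite mulr2n; field.
    (* the half-angle formula: 1 - cos t = 2 sin (t / 2) ^ 2 *)
    rewrite cos_mulr2n (_ : t ^+ 2 / 2 = 2 * (t / 2) ^+ 2); last by field.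
    have := cos2Dsin2 (t / 2); have := sin_lip (t / 2) 0.
    rewrite sin0 !subr0 => h.
    have : sin (t / 2) ^+ 2 <= (t / 2) ^+ 2.
      by rewrite -(real_normK (num_real (sin _))) -(real_normK (num_real (t / 2))) lerXn2r ?nnegrE.
    by move=> *; rewrite mulr2n; lra.
  have : t ^+ 2 <= 1 by rewrite expr_le1.
  by move=> *; lra.
Qed.

Lemma norm_sin_pi_shift R (y : R) (n : int) :
  `|sin (pi * (y + n%:~R))| = `|sin (pi * y)|.
Proof.
have nat_shift (m : nat) z : `|sin (pi * (z + m%:R))| = `|sin (pi * z) : R|.
  elim: m => [|m IH]; first by rewrite addr0.
  rewrite -IH -natr1 addrA mulrDr mulr1 sinDpi normrN//.
case: n => m; first exact: nat_shift.
have -> : (Negz m)%:~R = - m.+1%:R :> R by rewrite NegzE mulrNz.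
by rewrite -(nat_shift m.+1 (y - m.+1%:R)) subrK.
Qed.

Lemma sin_pi_int R (n : int) : sin (pi * n%:~R) = 0 :> R.
Proof.
by apply: normr0_eq0; rewrite -[n%:~R]add0r norm_sin_pi_shift mulr0 sin0 normr0.
Qed.

Lemma pi_le4 R : pi <= 4 :> R.
Proof. by have [/andP[_ h] _] := pihalf_02_cos_pihalf R; lra. Qed.

Lemma sin_pi_le R (y : R) : `|sin (pi * y)| <= 4 * `|y|.
Proof.
have := sin_lip (pi * y) 0; rewrite sin0 !subr0 => /le_trans; apply.
by rewrite normrM ger0_norm ?pi_ge0// ler_wpM2r// pi_le4.
Qed.

Lemma sin_pi_ge R (y : R) : `|y| <= 4^-1 -> `|y| <= `|sin (pi * y)|.
Proof.
move=> y4; have p0 := @pi_ge0 R.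
have h1 : `|pi * y| <= 1.
  rewrite normrM ger0_norm//; apply: (@le_trans _ _ (4 * 4^-1)); last by rewrite divff.
  by apply: ler_pM => //; exact: pi_le4.
apply: le_trans _ (sin_ge_half h1); rewrite normrM ger0_norm// ler_pdivlMr// mulrC.
by apply: ler_wpM2r => //; exact: pi_ge2.
Qed.

Lemma sprod_ratio R (a r x y : R) (P : seq R) : 0 <= r ->
  (forall b, b \in P -> `|sin (a * (x - b))| <= r * `|sin (a * (y - b))|) ->
  `|sprod a P x| <= r ^+ size P * `|sprod a P y|.
Proof.
move=> r0; elim: P => [|b P IH] h; first by rewrite !sprod_nil mul1r.
rewrite !sprod_cons !normrM exprS /= mulrACA; apply: ler_pM => //.
  by apply: h; exact: mem_head.
by apply: IH => c cP; apply: h; rewrite inE cP orbT.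
Qed.

Lemma sprod_ge R (a m x : R) (P : seq R) : 0 <= m ->
  (forall b, b \in P -> m <= `|sin (a * (x - b))|) -> m ^+ size P <= `|sprod a P x|.
Proof.
move=> m0; elim: P => [|b P IH] h; first by rewrite sprod_nil normr1.
rewrite sprod_cons normrM exprS /=; apply: ler_pM => //; first by rewrite exprn_ge0.
  by apply: h; exact: mem_head.
by apply: IH => c cP; apply: h; rewrite inE cP orbT.
Qed.

(** Zeros in arithmetic progression: the product is at least [N! / y ^ N], and
    [y ^ N / N! <= exp y] whatever [N]. *)
Lemma sprod_ge_fact R (a y x : R) (b : nat -> R) (N : nat) : 0 < y ->
  (forall k, (k < N)%N -> k.+1%:R / y <= `|sin (a * (x - b k))|) ->
  expR (- y) <= `|sprod a [seq b k | k <- iota 0 N] x|.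
Proof.
move=> y0 h; apply: (@le_trans _ _ (N`!%:R / y ^+ N)).
  case: N {h} => [|N]; first by rewrite expr0 divr1 -expR0 ler_expR oppr_le0 ltW.
  rewrite expRN -[leRHS]invrK invf_div lef_pV2 ?posrE ?expR_gt0//; last first.
    by rewrite divr_gt0 ?exprn_gt0// ltr0n fact_gt0.
  by apply: le_trans (expR_ge1Dxn N (ltW y0)); rewrite lerDr.
elim: N h => [|N IH] h; first by rewrite sprod_nil normr1 divr1.
rewrite -addn1 iotaD map_cat sprod_cat normrM /= sprod_cons sprod_nil mulr1.
rewrite addn1 factS natrM exprS invfM mulrACA mulrC; apply: ler_pM; rewrite ?divr_ge0 ?exprn_ge0// ?(ltW y0)//.
- by apply: IH => k kN; apply: h; exact: ltnW.
- by apply: h.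
Qed.

(** * Shells and perturbed integers *)

(** The unit of length of the [i]-th shell, the set of the integers [n] such that
    [q * radius W q i < |n| <= q ^ 2 * radius W q i]; the shell [0] extends
    down to [n = 0]. *)
Definition radius (W q i : nat) : nat := (W * q ^ i)%N.

(** The search can stop at [|n|], because [n < q ^ n]. *)
Definition shell (W q : nat) (n : int) : nat :=
  find (fun i => absz n <= q ^ 2 * radius W q i)%N (iota 0 (absz n).+1).

Lemma shellP (W q : nat) (n : int) : (1 < q)%N -> (0 < W)%N ->
  (absz n <= q ^ 2 * radius W q (shell W q n))%N.
Proof.
move=> q1 W0; rewrite /shell; set a := (X in find X).
have h : has a (iota 0 (absz n).+1).
  apply/hasP; exists (absz n); first by rewrite mem_iota add0n ltnS leqnn.
  rewrite /a /radius; apply: leq_trans (ltnW (ltn_expl (absz n) q1)) _.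
  by rewrite mulnA leq_pmull// muln_gt0 expn_gt0 W0 (ltnW q1).
have := nth_find 0%N h; rewrite nth_iota ?add0n//.
by rewrite -[X in (_ < X)%N](size_iota 0) -has_find.
Qed.

Lemma shell_gt (W q : nat) (n : int) (i : nat) : (i < shell W q n)%N ->
  (q ^ 2 * radius W q i < absz n)%N.
Proof.
move=> h; have := before_find 0%N h.
rewrite nth_iota ?add0n; last first.
  by apply: leq_trans h _; rewrite -[X in (_ <= X)%N](size_iota 0 (absz n).+1) find_size.
by move=> /negbT; rewrite -ltnNge.
Qed.

Lemma radius_mono (W q i j : nat) : (0 < q)%N -> (i <= j)%N -> (radius W q i <= radius W q j)%N.
Proof. by move=> q0 ij; rewrite /radius leq_mul2l leq_pexp2l// orbT. Qed.

Lemma radiusS (W q i : nat) : radius W q i.+1 = (q * radius W q i)%N.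
Proof. by rewrite /radius expnS mulnCA. Qed.

Definition residue (q : nat) (n : int) : nat := absz (n %% (q ^ 2)%:Z)%Z.

Lemma residue_lt (q : nat) (n : int) : (0 < q)%N -> (residue q n < q ^ 2)%N.
Proof.
move=> q0; have Q0 : ((q ^ 2)%:Z != 0)%R by rewrite eqz_nat expn_eq0 andbT -lt0n.
rewrite /residue -ltz_nat gez0_abs ?modz_ge0//.
by rewrite -[X in (_ < X)%R]gez0_abs// ltz_mod.
Qed.

Lemma residue_eq (q : nat) (m n : int) : (0 < q)%N -> residue q m = residue q n ->
  exists k : int, m = n + (q ^ 2)%:Z * k.
Proof.
move=> q0 h; have Q0 : ((q ^ 2)%:Z != 0)%R by rewrite eqz_nat expn_eq0 andbT -lt0n.
have : (m %% (q ^ 2)%:Z)%Z = (n %% (q ^ 2)%:Z)%Z.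
  by rewrite -[LHS]gez0_abs ?modz_ge0// -[RHS]gez0_abs ?modz_ge0//; congr Posz.
move/eqP; rewrite eqz_mod_dvd => /dvdzP[k kE]; exists k.
by rewrite mulrC -kE; ring.
Qed.

(** The size of the perturbations decays doubly exponentially with the shell, at
    a rate such that [rho i ^ (q ^ 2) = exp (- radius i / 6)]. *)
Definition rho R (W q i : nat) : R :=
  expR (- ((radius W q i)%:R / (6 * (q ^ 2)%:R))).

(** The perturbation of [n] encodes its shell and its residue modulo [q ^ 2]: a
    single sine of frequency [pi] then kills a whole residue class of a shell. *)
Definition eta R (W q : nat) (n : int) : R :=
  rho R W q (shell W q n).+1 * (residue q n).+1%:R.

Definition node R (W q : nat) (n : int) : R := n%:~R + eta R W q n.

Section Nodes.
Context (R : realType) (W q : nat) (q3 : (2 < q)%N) (W0 : (0 < W)%N).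
Context (small0 : (q ^ 2)%:R * rho R W q 0 <= 8^-1).
Local Notation D := (q ^ 2)%N.
Local Notation X := (radius W q).
Local Notation rh := (rho R W q).
Local Notation et := (eta R W q).
Local Notation nd := (node R W q).

Let q0 : (0 < q)%N. Proof. exact: ltn_trans q3. Qed.
Let D0 : 0 < D%:R :> R. Proof. by rewrite ltr0n expn_gt0 q0. Qed.
Let D1 : 1 <= D%:R :> R. Proof. by rewrite ler1n expn_gt0 q0. Qed.

Lemma rho_gt0 i : 0 < rh i. Proof. exact: expR_gt0. Qed.

Lemma rho_pow i : rh i ^+ D = expR (- ((X i)%:R / 6)).
Proof.
rewrite /rho -expRM_natl; congr expR; field.
by rewrite pnatr_eq0 -lt0n.
Qed.

Lemma rhoS_half i : D%:R * rh i.+1 <= rh i / 2.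
Proof.
suff h : rh i.+1 <= rh i * rh 0.
  apply: (@le_trans _ _ (D%:R * (rh i * rh 0))); first by rewrite ler_wpM2l.
  rewrite mulrCA; apply: ler_wpM2l; first exact/ltW/rho_gt0.
  by apply: le_trans small0 _; lra.
rewrite /rho -expRD ler_expR -opprD lerN2 -mulrDl ler_wpM2r//.
rewrite -natrD ler_nat radiusS.
have h : (X 0 <= X i)%N by exact: radius_mono.
apply: (@leq_trans (X i + X i)); first by rewrite leq_add2l.
by rewrite addnn -mul2n leq_mul2r (ltnW q3) orbT.
Qed.

Lemma rho_antimono i j : (i <= j)%N -> rh j <= rh i.
Proof.
move=> ij; rewrite /rho ler_expR lerN2 ler_wpM2r ?invr_ge0 ?mulr_ge0 ?(ltW D0)//.
by rewrite ler_nat radius_mono.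
Qed.

Lemma rho_le i : D%:R * rh i <= 8^-1.
Proof. by apply: le_trans small0; rewrite ler_wpM2l ?(ltW D0)// rho_antimono. Qed.

Lemma eta_bounds n : rh (shell W q n).+1 <= et n <= D%:R * rh (shell W q n).+1.
Proof.
have r0 := rho_gt0 (shell W q n).+1; rewrite /eta; apply/andP; split.
  by rewrite ler_peMr ?(ltW r0)// ler1n.
by rewrite mulrC ler_wpM2r ?(ltW r0)// ler_nat residue_lt.
Qed.

Lemma eta_small n : 0 < et n <= 8^-1.
Proof.
have /andP[h1 h2] := eta_bounds n; apply/andP; split.
  by apply: lt_le_trans h1; exact: rho_gt0.
exact: le_trans h2 (rho_le _).
Qed.

Lemma node_dist m n : m != n -> `|(m - n)%:~R : R| / 2 <= `|nd m - nd n|.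
Proof.
move=> mn; have /andP[e1 e2] := eta_small m; have /andP[f1 f2] := eta_small n.
have h1 : 1 <= `|(m - n)%:~R : R|.
  rewrite -intr_norm -[1]/(1%:~R) ler_int; move: mn; rewrite -subr_eq0 => /eqP; lia.
have -> : nd m - nd n = (m - n)%:~R + (et m - et n) by rewrite /node rmorphB/=; ring.
have h2 : `|et m - et n| <= 4^-1 by rewrite ler_norml; apply/andP; split; lra.
have := ler_normB ((m - n)%:~R + (et m - et n)) (et m - et n).
by rewrite addrK; lra.
Qed.

Lemma node_inj : injective nd.
Proof.
move=> m n h; apply/eqP/negPn/negP => mn.
have := node_dist mn; rewrite h subrr normr0 leNgt => /negP; apply.
by rewrite divr_gt0// normr_gt0 intr_eq0 subr_eq0.
Qed.

Lemma node_abs n : `|nd n - n%:~R| <= 8^-1.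
Proof. by rewrite /node addrC addKr; have /andP[h1 h2] := eta_small n; rewrite gtr0_norm. Qed.

End Nodes.

(** * Square sums over the nodes *)

(** By comparison with the telescoping sum of [1 / k - 1 / (k + 1)]. *)
Lemma sum_inv_sq_nat R (s : seq nat) : uniq s ->
  \sum_(k <- s) (k.+1%:R^-1 : R) ^+ 2 <= 2.
Proof.
move=> us; have [M sM] : exists M, forall k, k \in s -> (k < M.+1)%N.
  exists (\max_(k <- s) k) => k ks; by rewrite ltnS leq_bigmax_seq.
have F0 k : 0 <= (k.+1%:R^-1 : R) ^+ 2 by exact: sqr_ge0.
have part : \sum_(0 <= k < M.+1) (k.+1%:R^-1 : R) ^+ 2 <= 2 - M.+1%:R^-1.
  elim: M {sM} => [|M IH]; first by rewrite big_nat1 invr1 expr1n; lra.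
  rewrite big_nat_recr//=; apply: le_trans (lerD IH (lexx _)) _.
  have a0 : 0 < M.+1%:R :> R by [].
  have b0 : 0 < M.+2%:R :> R by [].
  have -> : M.+1%:R = M.+2%:R - 1 :> R by rewrite -[M.+2%:R]natr1 addrK.
  have c0 : 0 < M.+2%:R - 1 :> R by rewrite -[M.+2%:R]natr1 addrK.
  move: (M.+2%:R : R) b0 c0 => x x0 x1.
  have h : (x - 1)^-1 - x^-1 = (x * (x - 1))^-1 by field; rewrite !gt_eqF.
  have : (x^-1) ^+ 2 <= (x * (x - 1))^-1.
    rewrite exprVn lef_pV2 ?posrE ?mulr_gt0 ?exprn_gt0// expr2; apply: ler_wpM2l; [exact: ltW|lra].
  by rewrite -h; lra.
apply: le_trans (le_trans part _); last by rewrite gerBl invr_ge0.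
have pm : perm_eq s [seq k <- iota 0 M.+1 | k \in s].
  apply: uniq_perm => //; first by rewrite filter_uniq// iota_uniq.
  move=> k; rewrite mem_filter mem_iota add0n leq0n /=.
  by apply/idP/idP => [ks|/andP[]//]; rewrite ks sM.
rewrite (perm_big _ pm) big_filter big_mkcond /= /index_iota subn0.
by apply: ler_sum => k _; case: ifP.
Qed.

Lemma sum_inv_sq_int R (s : seq int) : uniq s ->
  \sum_(k <- s | k != 0) (`|k%:~R|^-1 : R) ^+ 2 <= 4.
Proof.
move=> us; have half (P : pred int) :
    {in [pred k : int | P k] &, injective absz} -> (forall k, P k -> k != 0%R) ->
    \sum_(k <- s | P k) (`|k%:~R|^-1 : R) ^+ 2 <= 2.
  move=> inj nz; rewrite -big_filter.
  rewrite (eq_big_seq (fun k => (((absz k).-1.+1%:R)^-1 : R) ^+ 2)); last first.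
    move=> k; rewrite mem_filter => /andP[/nz k0 _].
    by rewrite prednK ?absz_gt0// pmulrn abszE intr_norm.
  rewrite -(big_map (fun k => (absz k).-1) predT (fun j => (j.+1%:R^-1 : R) ^+ 2)).
  apply: sum_inv_sq_nat; rewrite map_inj_in_uniq ?filter_uniq// => x y.
  rewrite !mem_filter => /andP[Px _] /andP[Py _] h; apply: inj => //.
  by rewrite -[LHS]prednK ?absz_gt0 ?nz// h prednK// absz_gt0 nz.
rewrite (bigID (fun k : int => 0 < k))/= (_ : 4 = 2 + 2 :> R); last by rewrite -natrD.
by apply: lerD; apply: half => [x y|x]; rewrite ?inE/=; lia.
Qed.

Lemma l2norm_le R (A : set R) (u : R -> R[i]) (d : R) : 0 <= d ->
  (forall s : seq R, uniq s -> (forall x, x \in s -> A x) ->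
     \sum_(x <- s) sqmod (u x) <= d ^+ 2) ->
  (l2norm A u <= d%:E)%E.
Proof.
move=> d0 H; rewrite /l2norm; set E := (\esum_(_ in _) _)%E.
have E0 : (0 <= E)%E by apply: esum_ge0 => x _; rewrite lee_fin sqr_ge0.
have Ed : (E <= (d ^+ 2)%:E)%E.
  apply: ge_ereal_sup => _ [B [/finite_seqP[s ->] sA] <-].
  have sE : [set` s] = [set` undup s] by apply/seteqP; split => x /=; rewrite mem_undup.
  rewrite sE -fsbig_seq ?undup_uniq//= sumEFin lee_fin.
  rewrite (eq_bigr (fun x => sqmod (u x))); last by move=> x _; rewrite normc_sq.
  by apply: H; [exact: undup_uniq|move=> x; rewrite mem_undup; exact: sA].
apply: (@le_trans _ _ ((d ^+ 2)%:E `^ 2^-1)%E).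
  by apply: gt0_ler_poweR => //; rewrite in_itv/= ?leey ?andbT ?lee_fin ?sqr_ge0.
by rewrite poweR_EFin -powR_mulrn// -powRrM mulfV// powRr1.
Qed.

Lemma seq_in_range (T : Type) (R : eqType) (g : T -> R) (s : seq R) :
  (forall x, x \in s -> range g x) -> exists r, s = map g r.
Proof.
elim: s => [|x s IH] h; first by exists [::].
have [r ->] : exists r, s = map g r by apply: IH => y ys; apply: h; rewrite inE ys orbT.
by have [t _ <-] := h x (mem_head _ _); exists (t :: r).
Qed.

(** * Almost interpolating functions *)

Section NodeFunction.
Context (R : realType) (W q : nat) (q3 : (2 < q)%N) (W0 : (0 < W)%N).
Context (small0 : (q ^ 2)%:R * rho R W q 0 <= 8^-1).
Context (eps : R) (eps0 : 0 < eps) (eps1 : eps <= 1).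
(* [K] times the radius is the logarithmic cost of the progression through a
   node; [K * q] bounds the inverse of a slow sine at an older zero. *)
Context (K : R) (KE : K = 7 * 8 * 32 / eps).
Context (qK : 12 * K <= q%:R) (qexp : K * q%:R <= expR (q%:R / 36)).
Local Notation D := (q ^ 2)%N.
Local Notation X := (radius W q).
Local Notation rh := (rho R W q).
Local Notation et := (eta R W q).
Local Notation nd := (node R W q).
Local Notation sh := (shell W q).

Let q0 : (0 < q)%N. Proof. exact: ltn_trans q3. Qed.
Let D0 : 0 < D%:R :> R. Proof. by rewrite ltr0n expn_gt0 q0. Qed.
Let D1 : 1 <= D%:R :> R. Proof. by rewrite ler1n expn_gt0 q0. Qed.
Let X0 i : 0 < (X i)%:R :> R.
Proof. by rewrite ltr0n muln_gt0 W0 expn_gt0 q0. Qed.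
Let qR0 : 0 < q%:R :> R. Proof. by rewrite ltr0n. Qed.

(** Zeros of the sines of frequency [pi], in three groups: the integers with
    multiplicity [q ^ 2], which make the function tiny on the outer shells, whose
    nodes are much closer to integers; in the shell of [n0], the residue classes
    other than its own; in the preceding shell, all the residue classes. *)
Definition pi_zeros (n0 : int) : seq R :=
  nseq D 0 ++
  ([seq rh (sh n0).+1 * c.+1%:R | c <- iota 0 D & c != residue q n0] ++
   [seq rh (sh n0) * c.+1%:R | c <- iota 0 D]).

(** Nodes killed one at a time: those of the progression of step [q ^ 2] through
    [n0] which may lie in the shell of [n0] or inside, and those of index at most
    [radius], which make up the shells before the preceding one; there are none
    of the latter for the shell [0]. *)
Definition slow_zeros (n0 : int) : seq R :=
  [seq nd (n0 + (D * k.+1)%:Z) | k <- iota 0 (2 * X (sh n0))] ++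
  ([seq nd (n0 - (D * k.+1)%:Z) | k <- iota 0 (2 * X (sh n0))] ++
   [seq nd (k%:Z - (X (sh n0))%:Z) |
     k <- iota 0 (if sh n0 is 0%N then 0 else (X (sh n0)).*2.+1)]).

Definition bandwidth : R := eps / (32 * D%:R).
(** Low enough for all the slow sines together to spend one [bandwidth]. *)
Definition slow (n0 : int) : R := bandwidth / (7 * (X (sh n0))%:R).

Lemma bandwidth_gt0 : 0 < bandwidth.
Proof. by rewrite divr_gt0// mulr_gt0. Qed.

Lemma size_pi_zeros n0 : (size (pi_zeros n0) <= 3 * D)%N.
Proof.
rewrite /pi_zeros !size_cat size_nseq !size_map size_iota size_filter.
have := count_size (fun c => c != residue q n0) (iota 0 D); rewrite size_iota.
by rewrite [(3 * D)%N](_ : _ = D + (D + D))%N ?mulSn ?mul0n ?addn0// leq_add2l leq_add2r.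
Qed.

Lemma size_slow_zeros n0 : (size (slow_zeros n0) <= 7 * X (sh n0))%N.
Proof.
have : (0 < X (sh n0))%N by rewrite -(ltr0n R).
rewrite /slow_zeros !size_cat !size_map !size_iota; move: (X _) => x x0.
by case: (sh n0) => [|_]; clear -x0; lia.
Qed.

Lemma slow_ge0 n0 : 0 < slow n0.
Proof. by rewrite divr_gt0 ?bandwidth_gt0// mulr_gt0. Qed.

Lemma slow_budget n0 : (size (slow_zeros n0))%:R * slow n0 <= bandwidth.
Proof.
rewrite /slow mulrCA ler_piMr ?(ltW bandwidth_gt0)// ler_pdivrMr ?mulr_gt0// mul1r -natrM ler_nat.
exact: size_slow_zeros.
Qed.

(** In the shell of [n0], another residue class is killed by the second group of
    [pi_zeros], and the class of [n0] by the progression; the preceding shell is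
    killed by the third group; an older node has index at most [radius]. *)
Lemma inner_zero n0 n : n != n0 -> (sh n <= sh n0)%N ->
  sprod pi (pi_zeros n0) (nd n) * sprod (slow n0) (slow_zeros n0) (nd n) = 0.
Proof.
move=> nn0 le; have hn := shellP n (ltnW q3) W0; have hn0 := shellP n0 (ltnW q3) W0.
have sl m : nd m \in slow_zeros n0 -> sprod (slow n0) (slow_zeros n0) (nd m) = 0.
  by move=> h; apply: (sprod_eq0 h); rewrite subrr mulr0 sin0.
have pz m : et m \in pi_zeros n0 -> sprod pi (pi_zeros n0) (nd m) = 0.
  by move=> h; apply: (sprod_eq0 h); rewrite /node addrK sin_pi_int.
have Dpos : (0 < D)%N by rewrite expn_gt0 q0.
have res_in m : residue q m \in iota 0 D by rewrite mem_iota add0n leq0n residue_lt.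
have [eqsh|nesh] := eqVneq (sh n) (sh n0).
  have [eqr|ner] := eqVneq (residue q n) (residue q n0); last first.
    rewrite pz ?mul0r// /pi_zeros !mem_cat; apply/orP; right; apply/orP; left.
    by apply/mapP; exists (residue q n); [rewrite mem_filter ner res_in|rewrite /eta eqsh].
  have [k kE] := residue_eq q0 eqr.
  have k0 : k != 0%R by apply: contra nn0 => /eqP k0; rewrite kE k0 mulr0 addr0.
  rewrite eqsh in hn.
  have kX : (absz k <= 2 * X (sh n0))%N.
    have : (D * absz k <= D * (2 * X (sh n0)))%N.
      rewrite mulnCA -[X in (X * absz k)%N](absz_nat D) -abszM; move: hn hn0; rewrite kE.
      by move: (D%:Z * k)%R (D * X (sh n0))%N => a b; move: (n0 : int); clear; lia.
    by rewrite leq_pmul2l.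
  rewrite sl ?mulr0// /slow_zeros !mem_cat.
  case: k k0 kE kX => [[//|k] _|k _] kE kX.
    by apply/orP; left; apply/mapP; exists k; [rewrite mem_iota|rewrite kE -PoszM].
  apply/orP; right; apply/orP; left; apply/mapP; exists k; first by rewrite mem_iota.
  by rewrite kE NegzE mulrN -PoszM.
have lt : (sh n < sh n0)%N by rewrite ltn_neqAle nesh.
have [eqS|neS] := eqVneq (sh n).+1 (sh n0).
  rewrite pz ?mul0r// /pi_zeros !mem_cat; apply/orP; right; apply/orP; right.
  by apply/mapP; exists (residue q n); [exact: res_in|rewrite /eta eqS].
have lt2 : ((sh n).+2 <= sh n0)%N by rewrite ltn_neqAle neS.
have nX : (absz n <= X (sh n0))%N.
  apply: leq_trans hn _; apply: leq_trans (radius_mono W q0 lt2).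
  by rewrite !radiusS mulnA mulnn.
rewrite sl ?mulr0// /slow_zeros !mem_cat; apply/orP; right; apply/orP; right.
case: (sh n0) lt nX => // i _; move: (X i.+1) => x nX; apply/mapP; exists (absz (n + x%:Z)).
  by rewrite mem_iota; clear -nX; lia.
by congr node; clear -nX; lia.
Qed.

(** The arguments of the slow sines stay in the range of [sin_ge_half]. *)
Lemma slow_sin_ge n0 n m : (absz n <= 3 * (D * X (sh n0)))%N ->
  m <= `|nd n0 - nd n| -> slow n0 * m / 2 <= `|sin (slow n0 * (nd n0 - nd n))|.
Proof.
move=> hn hm; have hn0 := shellP n0 (ltnW q3) W0; have s0 := slow_ge0 n0.
have d1 : `|nd n0 - nd n| <= 7 * (D%:R * (X (sh n0))%:R).
  have a1 := node_abs q3 small0 n0; have a2 := node_abs q3 small0 n.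
  have -> : nd n0 - nd n = (nd n0 - n0%:~R) - (nd n - n%:~R) + (n0 - n)%:~R by rewrite rmorphB/=; ring.
  apply: le_trans (ler_normD _ _) _; apply: le_trans (lerD (ler_normB _ _) (lexx _)) _.
  have : `|(n0 - n)%:~R : R| <= 4 * (D%:R * (X (sh n0))%:R).
    rewrite -intr_norm -natrM -(natrM _ 4) pmulrn ler_int; move: hn hn0.
    by move: (D * X (sh n0))%N => a; clear; lia.
  have : 1 <= D%:R * (X (sh n0))%:R :> R.
    by rewrite -natrM ler1n muln_gt0 expn_gt0 q0 -(ltr0n R) X0.
  by lra.
have z1 : `|slow n0 * (nd n0 - nd n)| <= 1.
  rewrite normrM (gtr0_norm s0); apply: le_trans (ler_wpM2l (ltW s0) d1) _.
  have -> : slow n0 * (7 * (D%:R * (X (sh n0))%:R)) = eps / 32.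
    rewrite /slow /bandwidth; field; rewrite !gt_eqF//.
  by rewrite ler_pdivrMr// mul1r (le_trans eps1)// ler1n.
apply: le_trans (sin_ge_half z1); rewrite normrM (gtr0_norm s0) ler_wpM2r//.
by rewrite ler_wpM2l// ltW.
Qed.

(** Write [X] for the radius.  Each half of the progression costs
    [exp (K X / 2)] by [sprod_ge_fact]; the at most [3 X] older zeros are at
    distance at least [q X / 4] and cost a factor [K q] each.  The node itself
    is of size at least [q X] outside the shell [0], so a large [q] makes the cost
    [exp (q X / 6)] affordable. *)
Lemma slow_product_ge n0 :
  expR (- (q%:R * (X (sh n0))%:R / 6)) <= `|sprod (slow n0) (slow_zeros n0) (nd n0)|.
Proof.
have hn0 := shellP n0 (ltnW q3) W0; have s0 := slow_ge0 n0.
have XR := X0 (sh n0); have K0 : 0 < K by rewrite KE divr_gt0// !mulr_gt0.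
pose y := K * (X (sh n0))%:R / 2.
have y0 : 0 < y by rewrite divr_gt0// mulr_gt0.
have s_eq : slow n0 * D%:R = 4 / y.
  by rewrite /slow /bandwidth /y KE; field; rewrite !gt_eqF.
(* each half of the progression, to the right and to the left of [n0] *)
have prog (b : nat -> int) : (forall k, absz (b k - n0) = D * k.+1)%N ->
    expR (- y) <= `|sprod (slow n0) [seq nd (b k) | k <- iota 0 (2 * X (sh n0))] (nd n0)|.
  move=> bE; rewrite [map _ _](_ : _ = [seq (nd \o b) k | k <- iota 0 (2 * X (sh n0))])//.
  apply: (sprod_ge_fact y0) => k kX /=.
  have nn : n0 != b k.
    apply/eqP => E; have := bE k; rewrite E subrr => /esym/eqP; rewrite muln_eq0 expn_eq0 /= andbT.
    by rewrite orbF => /eqP qz; move: q0; rewrite qz.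
  have hd := node_dist q3 W0 small0 nn.
  have hb : (absz (b k) <= 3 * (D * X (sh n0)))%N.
    have : (D * k.+1 <= D * (2 * X (sh n0)))%N by rewrite leq_mul2l kX orbT.
    rewrite mulnCA; have := bE k; move: hn0.
    by move: (D * k.+1)%N (D * X (sh n0))%N (b k) (n0 : int) => a1 a2 u v; clear; lia.
  apply: le_trans (slow_sin_ge hb hd).
  rewrite -intr_norm distrC -abszE bE -pmulrn natrM.
  rewrite (_ : slow n0 * _ / 2 = slow n0 * D%:R * k.+1%:R / 4); last by field.
  rewrite s_eq; move: (y) y0 => z z0.
  by apply: le_of_eq; field; rewrite gt_eqF.
have old : expR (- (q%:R * (X (sh n0))%:R / 12)) <=
  `|sprod (slow n0) [seq nd (k%:Z - (X (sh n0))%:Z) |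
     k <- iota 0 (if sh n0 is 0%N then 0 else (X (sh n0)).*2.+1)] (nd n0)|.
  have := @shell_gt W q n0; case E : (sh n0) => [|i] far.
    by rewrite sprod_nil normr1 -expR0 ler_expR oppr_le0 !mulr_ge0 ?invr_ge0.
  rewrite -E in far *; have {}far : (q * X (sh n0) < absz n0)%N.
    by apply: leq_ltn_trans (far i _); [rewrite E radiusS mulnA mulnn|rewrite E].
  apply: (@le_trans _ _ (expR (- (q%:R / 36)) ^+ (X (sh n0)).*2.+1)).
    rewrite -expRM_natl ler_expR mulrN lerN2.
    rewrite (_ : q%:R * (X (sh n0))%:R / 12 = (3 * (X (sh n0))%:R) * (q%:R / 36)); last by field.
    apply: ler_wpM2r; first by rewrite mulr_ge0 ?invr_ge0.
    have : (0 < X (sh n0))%N by rewrite -(ltr0n R).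
    by rewrite -natrM ler_nat; move: (X _) => x; clear; lia.
  rewrite -[X in _ ^+ X](size_iota 0) -(size_map (fun k => nd (k%:Z - (X (sh n0))%:Z))).
  apply: sprod_ge; first exact: expR_ge0.
  move=> _ /mapP[k kX ->]; set n := (k%:Z - _)%R.
  have nX : (absz n <= X (sh n0))%N.
    by move: kX; rewrite mem_iota /n; move: (X _) => x; clear; lia.
  have nn : n0 != n.
    apply/eqP => nn; suff : (absz n0 <= q * X (sh n0))%N by rewrite leqNgt far.
    by rewrite {1}nn; apply: leq_trans nX _; rewrite leq_pmull.
  have hd := node_dist q3 W0 small0 nn.
  have hb : (absz n <= 3 * (D * X (sh n0)))%N.
    by apply: leq_trans nX _; rewrite mulnA leq_pmull// muln_gt0 expn_gt0 q0.
  have hm : q%:R * (X (sh n0))%:R / 4 <= `|nd n0 - nd n|.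
    apply: le_trans _ hd; rewrite -intr_norm -abszE -pmulrn.
    have : (q * X (sh n0) <= 2 * absz (n0 - n))%N.
      have : (2 * X (sh n0) <= q * X (sh n0))%N by rewrite leq_mul2r (ltnW q3) orbT.
      move: far nX; move: (q * X (sh n0))%N (X (sh n0)) (n : int) (n0 : int) => a b u v.
      by clear; lia.
    by rewrite -(ler_nat R) !natrM; lra.
  apply: le_trans (slow_sin_ge hb hm).
  rewrite (_ : slow n0 * _ / 2 = (K * q%:R)^-1); last first.
    by rewrite /slow /bandwidth KE natrX; field; rewrite !gt_eqF.
  by rewrite expRN lef_pV2 ?posrE ?expR_gt0// mulr_gt0.
rewrite /slow_zeros !sprod_cat !normrM.
have -> : q%:R * (X (sh n0))%:R / 6 = q%:R * (X (sh n0))%:R / 24 + (q%:R * (X (sh n0))%:R / 24 +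
  q%:R * (X (sh n0))%:R / 12) :> R by field.
rewrite !opprD !expRD.
have yq : expR (- (q%:R * (X (sh n0))%:R / 24)) <= expR (- y).
  rewrite ler_expR lerN2 /y (_ : K * (X (sh n0))%:R / 2 = 12 * K * (X (sh n0))%:R / 24); last by field.
  by apply: ler_wpM2r; [rewrite invr_ge0|apply: ler_wpM2r; [exact: ltW|exact: qK]].
have ge0 x : 0 <= expR x :> R by exact: expR_ge0.
apply: ler_pM; rewrite ?mulr_ge0 ?ge0//.
  by apply: le_trans yq (prog _ _) => k; rewrite addrAC subrr add0r.
apply: ler_pM; rewrite ?ge0//.
by apply: le_trans yq (prog _ _) => k; rewrite addrAC subrr add0r abszN.
Qed.

Lemma sin_node n b : `|sin (pi * (nd n - b))| = `|sin (pi * (et n - b))|.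
Proof. by rewrite -[RHS](norm_sin_pi_shift _ n); congr (`|sin (pi * _)|); rewrite /node; ring. Qed.

(** Up to integers, the arguments are [pi] times differences of perturbations. *)
Lemma pi_sin_ge n0 :
  [/\ rh (sh n0).+1 <= `|sin (pi * (nd n0 - 0))|,
      forall c, (c < D)%N -> c != residue q n0 ->
        rh (sh n0).+1 <= `|sin (pi * (nd n0 - rh (sh n0).+1 * c.+1%:R))| &
      forall c, (c < D)%N ->
        rh (sh n0) / 2 <= `|sin (pi * (nd n0 - rh (sh n0) * c.+1%:R))|].
Proof.
have /andP[e1 e2] := eta_bounds R W q3 n0; have r0 := rho_gt0 R W q (sh n0).
have r1 := rho_gt0 R W q (sh n0).+1.
have l0 := rho_le q3 small0 (sh n0); have l1 := rho_le q3 small0 (sh n0).+1.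
have half := rhoS_half q3 small0 (sh n0).
have cD (c : nat) (r : R) : 0 < r -> (c < D)%N -> r <= r * c.+1%:R <= D%:R * r.
  move=> rp cD; rewrite ler_peMr ?(ltW rp) ?ler1n//= mulrC ler_wpM2r ?(ltW rp)//.
  by rewrite ler_nat.
have lower n b m : m <= `|et n - b| -> `|et n - b| <= 4^-1 -> m <= `|sin (pi * (nd n - b))|.
  by rewrite sin_node => h1 /sin_pi_ge; exact: le_trans.
split.
- apply: lower; rewrite subr0 gtr0_norm ?(lt_le_trans r1 e1)//.
  by apply: le_trans e2 _; apply: le_trans l1 _; lra.
- move=> c cc cn; have /andP[c1 c2] := cD c _ r1 cc; apply: lower; last first.
    by rewrite ler_norml; apply/andP; split; lra.
  rewrite /eta -mulrBr normrM (gtr0_norm r1) ler_peMr ?(ltW r1)//.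
  rewrite -[X in X%:R - _]addn1 -[X in _ - X%:R]addn1 !natrD opprD addrACA subrr addr0.
  case: (ltngtP c (residue q n0)) cn => // h _.
    by rewrite -natrB ?(ltnW h)// normr_nat ler1n subn_gt0.
  by rewrite distrC -natrB ?(ltnW h)// normr_nat ler1n subn_gt0.
- move=> c cc; have /andP[c1 c2] := cD c _ r0 cc; apply: lower; rewrite distrC ger0_norm; lra.
Qed.

Lemma pi_product_ge n0 :
  rh (sh n0).+1 ^+ D * (rh (sh n0).+1 ^+ D * (rh (sh n0) / 2) ^+ D) <=
  `|sprod pi (pi_zeros n0) (nd n0)|.
Proof.
have [h1 h2 h3] := pi_sin_ge n0.
have r0 := ltW (rho_gt0 R W q (sh n0)); have r1 := ltW (rho_gt0 R W q (sh n0).+1).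
have r1' : rh (sh n0).+1 <= 1.
  apply: le_trans (ler_peMl r1 D1) _; apply: le_trans (rho_le q3 small0 _) _.
  by rewrite invf_le1// ler1n.
rewrite /pi_zeros !sprod_cat !normrM; apply: ler_pM; rewrite ?mulr_ge0 ?exprn_ge0 ?divr_ge0//.
  rewrite -[X in _ ^+ X](size_nseq D (0 : R)); apply: sprod_ge => // b.
  by rewrite mem_nseq => /andP[_ /eqP ->].
apply: ler_pM; rewrite ?exprn_ge0 ?divr_ge0//.
  set s := [seq _ | c <- _ & _]; apply: (@le_trans _ _ (rh (sh n0).+1 ^+ size s)).
    apply: ler_wiXn2l => //; rewrite size_map size_filter -[X in (_ <= X)%N](size_iota 0 D).
    exact: count_size.
  apply: sprod_ge => // b /mapP[c]; rewrite mem_filter mem_iota add0n /= => /andP[cn cc] ->.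
  exact: h2.
rewrite -[X in _ ^+ X](size_iota 0 D) -(size_map (fun c => rh (sh n0) * c.+1%:R)).
apply: sprod_ge => [|b /mapP[c]]; first by rewrite divr_ge0.
by rewrite mem_iota add0n /= => cc ->; exact: h3.
Qed.

(** Factor by factor, the value at an outer node is at most [8 q^2] times the
    value at the node [n0]; for the zeros at the integers there is moreover the
    ratio of the perturbations of two consecutive shells. *)
Lemma pi_product_outer n0 n : (sh n0 < sh n)%N ->
  `|sprod pi (pi_zeros n0) (nd n)| <=
  (8 * D%:R) ^+ (3 * D) * (rh (sh n0).+2 / rh (sh n0).+1) ^+ D *
  `|sprod pi (pi_zeros n0) (nd n0)|.
Proof.
move=> lt; have [h1 h2 h3] := pi_sin_ge n0.
have r0 := rho_gt0 R W q (sh n0); have r1 := rho_gt0 R W q (sh n0).+1.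
have r2 := rho_gt0 R W q (sh n0).+2.
have /andP[e1 e2] := eta_bounds R W q3 n.
have e0 : 0 <= et n by apply: le_trans e1; exact/ltW/rho_gt0.
have rD i j : (j <= i)%N -> D%:R * rh i <= D%:R * rh j.
  by move=> ij; apply: ler_wpM2l; [exact: ltW|exact: rho_antimono].
have eD j : (j <= (sh n0).+2)%N -> et n <= D%:R * rh j.
  by move=> hj; apply: le_trans e2 _; apply: rD; exact: leq_trans hj _.
have num b j : 0 <= b <= D%:R * rh j -> (j <= (sh n0).+2)%N ->
    `|sin (pi * (nd n - b))| <= 4 * (D%:R * rh j).
  move=> /andP[b0 b1] hj; rewrite sin_node; apply: le_trans (sin_pi_le _) _.
  rewrite ler_wpM2l//; have := eD j hj; rewrite ler_norml => ?; apply/andP; split; lra.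
have cD (c : nat) (r : R) : 0 < r -> (c < D)%N -> 0 <= r * c.+1%:R <= D%:R * r.
  move=> rp cD; rewrite mulr_ge0 ?(ltW rp)//= mulrC ler_wpM2r ?(ltW rp)//.
  by rewrite ler_nat.
have D8 : 1 <= 8 * D%:R :> R by apply: mulr_ege1 => //; rewrite ler1n.
have D80 : 0 <= 8 * D%:R :> R by exact: le_trans D8.
pose t := rh (sh n0).+2 / rh (sh n0).+1; have t0 : 0 <= t by rewrite divr_ge0 ?ltW.
rewrite -/t /pi_zeros !sprod_cat !normrM.
have part1 : `|sprod pi (nseq D 0) (nd n)| <= (8 * D%:R) ^+ D * t ^+ D * `|sprod pi (nseq D 0) (nd n0)|.
  rewrite -exprMn -[X in _ ^+ X](size_nseq D (0 : R)); apply: sprod_ratio; first exact: mulr_ge0.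
  move=> b; rewrite mem_nseq => /andP[_ /eqP ->].
  apply: (@le_trans _ _ (8 * D%:R * t * rh (sh n0).+1)); last first.
    by apply: ler_wpM2l h1; exact: mulr_ge0.
  rewrite /t mulrA divfK ?gt_eqF//; apply: le_trans (num 0 (sh n0).+2 _ _) _ => //.
    by rewrite lexx mulr_ge0 ?(ltW D0) ?ltW.
  by rewrite mulrA ler_wpM2r ?(ltW r2)// ler_wpM2r ?(ltW D0)// ler_nat.
set s2 := [seq _ | c <- _ & _].
have part2 : `|sprod pi s2 (nd n)| <= (8 * D%:R) ^+ D * `|sprod pi s2 (nd n0)|.
  apply: (@le_trans _ _ ((8 * D%:R) ^+ size s2 * `|sprod pi s2 (nd n0)|)).
    apply: sprod_ratio => // b /mapP[c]; rewrite mem_filter mem_iota add0n /= => /andP[cn cc] ->.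
    apply: (@le_trans _ _ (8 * D%:R * rh (sh n0).+1)).
      apply: le_trans (num _ (sh n0).+1 (cD _ _ r1 cc) _) _ => //.
      by rewrite mulrA ler_wpM2r ?(ltW r1)// ler_wpM2r ?(ltW D0)// ler_nat.
    by rewrite ler_wpM2l// h2.
  apply: ler_wpM2r => //; apply: ler_weXn2l => //.
  rewrite size_map size_filter -[X in (_ <= X)%N](size_iota 0 D); exact: count_size.
set s3 := [seq _ | c <- _].
have part3 : `|sprod pi s3 (nd n)| <= (8 * D%:R) ^+ D * `|sprod pi s3 (nd n0)|.
  rewrite [X in (8 * _) ^+ X](_ : D = size s3); last by rewrite size_map size_iota.
  apply: sprod_ratio => // b /mapP[c]; rewrite mem_iota add0n /= => cc ->.
  apply: le_trans (num _ (sh n0) (cD _ _ r0 cc) _) _; first by rewrite leqW.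
  by apply: le_trans (ler_wpM2l D80 (h3 c cc)); apply: le_of_eq; field.
apply: le_trans (ler_pM _ _ part1 (ler_pM _ _ part2 part3)) _ => //.
rewrite mulSn mulSn mul1n !exprD; apply: le_of_eq; ring.
Qed.

Definition amplitude (n0 : int) : R :=
  (sprod pi (pi_zeros n0) (nd n0) * sprod (slow n0) (slow_zeros n0) (nd n0))^-1.

Definition node_fun (n0 : int) (x : R) : R :=
  sprod pi (pi_zeros n0) x * (sprod (slow n0) (slow_zeros n0) x * amplitude n0) *
  sinc (bandwidth * (x - nd n0)).

Let pi_gt0 n0 : 0 < `|sprod pi (pi_zeros n0) (nd n0)|.
Proof.
apply: lt_le_trans (pi_product_ge n0).
by rewrite !mulr_gt0 ?exprn_gt0 ?divr_gt0 ?rho_gt0.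
Qed.

Let slow_gt0 n0 : 0 < `|sprod (slow n0) (slow_zeros n0) (nd n0)|.
Proof. by apply: lt_le_trans (slow_product_ge n0); exact: expR_gt0. Qed.

Lemma node_fun_self n0 : node_fun n0 (nd n0) = 1.
Proof.
rewrite /node_fun subrr mulr0 sinc0 mulr1 mulrA /amplitude mulfV//.
by rewrite mulf_neq0// -normr_gt0.
Qed.

Lemma node_fun_inner n0 n : n != n0 -> (sh n <= sh n0)%N -> node_fun n0 (nd n) = 0.
Proof. by move=> h1 h2; rewrite /node_fun mulrA inner_zero// !mul0r. Qed.

(** With [X] the radius, the gain [exp (- (q^2 - q) X / 6)] of
    [pi_product_outer] beats the cost [exp (q X / 6)] of the slow zeros; the
    sinc supplies the square-summable decay. *)
Lemma node_fun_outer n0 n : (sh n0 < sh n)%N ->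
  `|node_fun n0 (nd n)| <=
  (8 * D%:R) ^+ (3 * D) * expR (- (W%:R / 2)) * (2 / (bandwidth * `|(n - n0)%:~R|)).
Proof.
move=> lt; have nn : n != n0 by apply: contraTneq lt => ->; rewrite ltnn.
have b0 := bandwidth_gt0; have hd := node_dist q3 W0 small0 nn.
have n1 : 0 < `|(n - n0)%:~R : R| by rewrite normr_gt0 intr_eq0 subr_eq0.
rewrite /node_fun normrM; apply: ler_pM => //; last first.
  have x0 : bandwidth * (nd n - nd n0) != 0.
    apply: mulf_neq0; first by rewrite gt_eqF.
    by rewrite -normr_gt0; apply: lt_le_trans hd; rewrite divr_gt0.
  apply: le_trans (sinc_le x0) _; rewrite normrM (gtr0_norm b0) -invf_div -[leRHS]/((_ * _ / 2)^-1).
  rewrite -[bandwidth * _ / 2]mulrA lef_pV2.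
  - by rewrite ler_pM2l.
  - by rewrite posrE mulr_gt0//; apply: lt_le_trans hd; rewrite divr_gt0.
  - by rewrite posrE mulr_gt0// divr_gt0.
rewrite normrM normrM mulrCA; apply: le_trans (ler_piMl _ (sprod_le1 _ _ _)) _; first exact: mulr_ge0.
rewrite /amplitude normrV ?unitfE; last first.
  by rewrite mulf_neq0// -normr_gt0.
rewrite normrM -ler_pdivlMr ?invr_gt0 ?mulr_gt0// invrK.
apply: le_trans (pi_product_outer lt) _.
have c0 : 0 <= (8 * D%:R) ^+ (3 * D) :> R by rewrite exprn_ge0 ?mulr_ge0.
rewrite -!mulrA; apply: ler_wpM2l => //.
rewrite [leRHS]mulrCA [leLHS]mulrC; apply: ler_wpM2l => //.
apply: le_trans (ler_wpM2l (expR_ge0 _) (slow_product_ge n0)).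
rewrite expr_div_n !rho_pow// -expRN -!expRD ler_expR !radiusS.
rewrite [(q * (q * _))%:R]natrM [(q * _)%:R]natrM.
have XW : W%:R <= (X (sh n0))%:R :> R by rewrite ler_nat /radius leq_pmulr// expn_gt0 q0.
have q3R : 3 <= q%:R :> R by rewrite ler_nat.
have : 0 <= (q%:R * (q%:R - 2) - 3) * (X (sh n0))%:R :> R.
  apply: mulr_ge0 => //; rewrite subr_ge0; apply: (@le_trans _ _ (3 * 1)); first by rewrite mulr1.
  by apply: ler_pM => //; lra.
rewrite (_ : (_ - 3) * _ = q%:R * (q%:R * (X (sh n0))%:R) - 2 * (q%:R * (X (sh n0))%:R) -
  3 * (X (sh n0))%:R); last by ring.
by move: XW; lra.
Qed.

(** This converts costs per shell into costs per node; the constant accounts for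
    the shell [0]. *)
Lemma radius_le_node n0 : q%:R * (X (sh n0))%:R <= `|nd n0| + (1 + q%:R * W%:R).
Proof.
have := @shell_gt W q n0; case E : (sh n0) => [|i] far.
  by rewrite /radius expn0 muln1 addrA lerDr addr_ge0.
have {}far : (q * X i.+1 <= absz n0)%N.
  by apply/ltnW/(leq_ltn_trans _ (far i _)) => //; rewrite radiusS mulnA mulnn.
have a := node_abs q3 small0 n0.
have : `|n0%:~R : R| <= `|nd n0| + `|nd n0 - n0%:~R|.
  by rewrite -{1}(subKr (nd n0) n0%:~R) ler_normB.
rewrite -intr_norm -abszE -pmulrn; move: far; rewrite -(ler_nat R) natrM.
have : 0 <= q%:R * W%:R :> R by rewrite mulr_ge0.
by move=> *; lra.
Qed.

Lemma amplitude_le n0 :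
  `|amplitude n0| <= 2 ^+ D * expR (2 / 3 * (1 + q%:R * W%:R)) * expR (2 / 3 * `|nd n0|).
Proof.
rewrite /amplitude normrV ?unitfE; last by rewrite mulf_neq0// -normr_gt0.
rewrite normrM; pose x := (X (sh n0))%:R : R.
apply: (@le_trans _ _ ((expR (- (q%:R * x / 6)) * (expR (- (q%:R * x / 6)) * (expR (- (x / 6)) / 2 ^+ D)) *
   expR (- (q%:R * x / 6)))^-1)).
  rewrite lef_pV2 ?posrE ?mulr_gt0 ?invr_gt0 ?exprn_gt0 ?expR_gt0//.
  apply: ler_pM; rewrite ?mulr_ge0 ?invr_ge0 ?exprn_ge0 ?expR_ge0//; last exact: slow_product_ge.
  by have := pi_product_ge n0; rewrite expr_div_n !rho_pow// radiusS natrM -/x.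
rewrite (_ : _ * _ = expR (- (q%:R * x / 2) - x / 6) / 2 ^+ D); last first.
  rewrite !mulrA -!expRD mulrAC -expRD; congr (expR _ / _); by field.
rewrite invf_div -expRN -[leRHS]mulrA ler_wpM2l ?exprn_ge0// -expRD ler_expR.
have := radius_le_node n0; rewrite -/x.
have : 0 <= q%:R * x by rewrite mulr_ge0 ?ler0n.
have : 3 * x <= q%:R * x by apply: ler_wpM2r; rewrite ?ler0n// ler_nat.
by move: (x) => z; lra.
Qed.

Definition cost_const : R :=
  2 ^+ D * expR (2 / 3 * (1 + q%:R * W%:R)) * sinc_const bandwidth.

Lemma node_fun_PW n0 :
  PW (bands (3 * D) (2 * bandwidth)) (fun x => (node_fun n0 x)%:C) /\
  (L2norm (fun x => (node_fun n0 x)%:C) <= (cost_const * expR `|nd n0|)%:E)%E.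
Proof.
have b0 := bandwidth_gt0.
have b1 : bandwidth <= 1.
  rewrite /bandwidth ler_pdivrMr ?mulr_gt0// mul1r (le_trans eps1)//.
  by apply: mulr_ege1 => //; rewrite ler1n.
have he : 0 < bandwidth <= 1 by rewrite b0.
have [h1 h2] := sprods_PW (amplitude n0) (nd n0) he (ltW (slow_ge0 n0))
  (size_pi_zeros n0) (slow_budget n0).
split; first exact: h1.
apply: le_trans h2 _; rewrite lee_fin.
have s0 : 0 <= sinc_const bandwidth by exact: sqrtr_ge0.
have E : expR `|nd n0| = expR (2 / 3 * `|nd n0|) * expR (`|nd n0| / 3).
  by rewrite -expRD; congr expR; field.
rewrite /cost_const E mulrA; apply: ler_wpM2r; first exact: expR_ge0.
by rewrite mulrAC; apply: ler_wpM2r => //; exact: amplitude_le.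
Qed.

Context (d : R) (d0 : 0 < d).
Context (small : (8 * D%:R) ^+ (3 * D) * expR (- (W%:R / 2)) <= d * bandwidth / 4).

(** Only the outer nodes contribute, with squared errors at most
    [(d ^ 2 / 4) / (n - n0) ^ 2], and the sum of [1 / k ^ 2] over the nonzero
    integers is at most [4]. *)
Lemma node_fun_error n0 :
  (l2norm (range nd) (fun l => (node_fun n0 l)%:C - kronecker (nd n0) l)%R <= d%:E)%E.
Proof.
apply: l2norm_le => [|s us sr]; first exact: ltW.
have [r rE] := seq_in_range sr; move: us; rewrite rE => {sr s rE} us.
have ur : uniq r by exact: map_uniq us.
rewrite big_map; have b0 := bandwidth_gt0.
apply: (@le_trans _ _ (\sum_(n <- r) d ^+ 2 / 4 * (if n - n0 != 0 then (`|(n - n0)%:~R|^-1 : R) ^+ 2 else 0))).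
  apply: ler_sum => n _; rewrite /kronecker subr_eq0; case: (eqVneq n n0) => [->|nn].
    by rewrite eqxx /= node_fun_self subrr mulr0 (_ : 0 = (0 : R)%:C)// sqmod_real expr0n.
  have -> : (nd n == nd n0) = false.
    by apply/negbTE; apply: contra nn => /eqP/(node_inj q3 W0 small0) ->.
  rewrite subr0 sqmod_real /=.
  have [le|lt] := leqP (sh n) (sh n0).
    by rewrite node_fun_inner// expr0n mulr_ge0 ?sqr_ge0// divr_ge0// sqr_ge0.
  have n1 : 0 < `|(n - n0)%:~R : R| by rewrite normr_gt0 intr_eq0 subr_eq0.
  have h : `|node_fun n0 (nd n)| <= d / 2 * `|(n - n0)%:~R|^-1.
    apply: le_trans (node_fun_outer lt) _.
    apply: le_trans (ler_wpM2r _ small) _; first by rewrite divr_ge0// mulr_ge0// ltW.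
    apply: le_of_eq; move: (bandwidth) b0 => b b0; field.
    by rewrite !gt_eqF.
  rewrite -(real_normK (num_real (node_fun _ _))).
  apply: (@le_trans _ _ ((d / 2 * `|(n - n0)%:~R|^-1) ^+ 2)).
    by rewrite lerXn2r ?nnegrE// mulr_ge0 ?invr_ge0// divr_ge0// ltW.
  by rewrite exprMn expr_div_n; apply: le_of_eq; congr (_ / _ * _); ring.
rewrite -mulr_sumr -big_mkcond /= -(big_map (fun n => n - n0) (fun k => k != 0)
  (fun k => (`|k%:~R|^-1 : R) ^+ 2)).
apply: (@le_trans _ _ (d ^+ 2 / 4 * 4)); last by rewrite divfK.
apply: ler_wpM2l; first by rewrite divr_ge0// sqr_ge0.
by apply: sum_inv_sq_int; rewrite map_inj_uniq//; exact: addIr.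
Qed.

Lemma nodes_tend e : 0 < e -> exists N : nat, forall n : int, (N <= absz n)%N ->
  `|nd n - n%:~R| < e.
Proof.
move=> e0; have [N hN] : exists N : nat, 6 * D%:R ^+ 2 / e < N%:R.
  by exists (Num.truncn (6 * D%:R ^+ 2 / e)).+1; exact: truncnS_gt.
exists (D * N)%N => n hn; rewrite /node addrC addKr.
have /andP[e1 e2] := eta_bounds R W q3 n.
have e3 : 0 < et n by apply: lt_le_trans e1; exact: rho_gt0.
rewrite gtr0_norm//; apply: le_lt_trans e2 _.
have NX : (N <= X (sh n).+1)%N.
  apply: leq_trans (radius_mono W q0 (leqnSn _)).
  by have := leq_trans hn (shellP n (ltnW q3) W0); rewrite leq_pmul2l// expn_gt0 q0.
have xp := X0 (sh n).+1; have {}NX : N%:R <= (X (sh n).+1)%:R :> R by rewrite ler_nat.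
rewrite /rho expRN; move: (X (sh n).+1)%:R xp NX => x xp NX.
apply: (@lt_le_trans _ _ (D%:R * (x / (6 * D%:R))^-1)).
  rewrite ltr_pM2l// ltf_pV2 ?posrE ?expR_gt0 ?divr_gt0 ?mulr_gt0//.
  by apply: lt_le_trans (expR_ge1Dx _); rewrite ltrDr.
rewrite invf_div mulrA ler_pdivrMr// mulrC -ler_pdivrMl//.
by apply: le_trans NX; rewrite ltW//; apply: le_lt_trans hN; apply: le_of_eq; field; rewrite gt_eqF.
Qed.

End NodeFunction.

(** * Spectra of small measure *)

Lemma nodes_uniformly_discrete R (W q : nat) : (2 < q)%N -> (0 < W)%N ->
  (q ^ 2)%:R * rho R W q 0 <= 8^-1 -> uniformly_discrete (range (node R W q)).
Proof.
move=> q3 W0 small0; apply: (@lt_le_trans _ _ (2^-1)%:E); first by rewrite lte_fin invr_gt0.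
apply: le_ereal_inf_tmp => _ [x [y [[m _ <-] [n _ <-] xy ->]]]; rewrite lee_fin.
have mn : m != n by apply/eqP => mn; apply: xy; rewrite mn.
apply: le_trans (node_dist q3 W0 small0 mn); rewrite -[leLHS]mul1r ler_wpM2r ?invr_ge0//.
by rewrite -intr_norm -[1]/(1%:~R) ler_int; move: mn; rewrite -subr_eq0 => /eqP; lia.
Qed.

(** First [q] makes the slow zeros affordable, then [W] makes the outer shells
    negligible and the perturbations small. *)
Lemma parameters R (eps d : R) : 0 < eps -> 0 < d ->
  exists q W : nat, [/\ (2 < q)%N, (0 < W)%N, (q ^ 2)%:R * rho R W q 0 <= 8^-1,
    12 * (7 * 8 * 32 / eps) <= q%:R /\ 7 * 8 * 32 / eps * q%:R <= expR (q%:R / 36) &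
    (8 * (q ^ 2)%:R) ^+ (3 * q ^ 2) * expR (- (W%:R / 2)) <= d * bandwidth q eps / 4].
Proof.
move=> e0 d0; set K := 7 * 8 * 32 / eps.
have K0 : 0 < K by rewrite divr_gt0// !mulr_gt0.
have [q hq] : exists q : nat, 3 + 2 * 36 ^+ 2 * K < q%:R.
  by exists (Num.truncn (3 + 2 * 36 ^+ 2 * K)).+1; exact: truncnS_gt.
have K1 : 0 <= 2 * 36 ^+ 2 * K by rewrite mulr_ge0 ?(ltW K0)// mulr_ge0// exprn_ge0.
have q3 : (2 < q)%N by rewrite -(ltr_nat R); lra.
have q0 : 0 < q%:R :> R by lra.
have D0 : 0 < (q ^ 2)%:R :> R by rewrite ltr0n expn_gt0 (ltnW (ltnW q3)).
have expV x : 0 < x -> expR (- x) <= x^-1 :> R.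
  move=> x0; rewrite expRN lef_pV2 ?posrE ?expR_gt0//.
  by apply: le_trans (expR_ge1Dx _); rewrite lerDr.
pose B := (8 * (q ^ 2)%:R) ^+ (3 * q ^ 2) : R; pose c := d * bandwidth q eps / 4.
have B0 : 0 < B by rewrite exprn_gt0// mulr_gt0.
have c0 : 0 < c by rewrite divr_gt0// mulr_gt0// divr_gt0// mulr_gt0.
have [W hW] : exists W : nat, 48 * (q ^ 2)%:R ^+ 2 + 2 * B / c < W%:R.
  by exists (Num.truncn (48 * (q ^ 2)%:R ^+ 2 + 2 * B / c)).+1; exact: truncnS_gt.
have w1 : 0 <= 48 * (q ^ 2)%:R ^+ 2 :> R by rewrite mulr_ge0// exprn_ge0// ltW.
have w2 : 0 <= 2 * B / c by rewrite !mulr_ge0 ?invr_ge0// ltW.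
have WR : 0 < W%:R :> R by lra.
exists q, W; split; [by []|by rewrite -(ltr0n R)| | |].
- rewrite /rho /radius expn0 muln1; apply: le_trans (ler_wpM2l (ltW D0) (expV _ _)) _.
    by rewrite divr_gt0// mulr_gt0.
  rewrite invf_div mulrA ler_pdivrMr// mulrC -ler_pdivrMl ?invr_gt0// invrK.
  apply: (@le_trans _ _ (48 * (q ^ 2)%:R ^+ 2)); last by lra.
  by apply: le_of_eq; ring.
- split; first by lra.
  have q36 : 0 <= q%:R / 36 :> R by rewrite divr_ge0// ltW.
  have h := @expR_ge1Dxn _ _ 1%N q36.
  apply: (@le_trans _ _ ((q%:R / 36) ^+ 2 / 2`!%:R)); last by apply: le_trans h; rewrite lerDr.
  rewrite (_ : 2`!%:R = 2 :> R)// ler_pdivlMr// expr_div_n ler_pdivlMr ?exprn_gt0//.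
  have KE (k : R) : k * q%:R * 2 * 36 ^+ 2 = q%:R * (2 * 36 ^+ 2 * k) by ring.
  rewrite KE.
  by rewrite expr2 ler_wpM2l ?(ltW q0)//; lra.
- rewrite -/B -/c; apply: le_trans (ler_wpM2l (ltW B0) (expV _ _)) _; first by rewrite divr_gt0.
  rewrite ler_pdivrMr ?divr_gt0//.
  have : 2 * B / c < W%:R by lra.
  by rewrite ltr_pdivrMr// [W%:R * c]mulrC => h; lra.
Qed.

(** The bands have total measure at most [28 q ^ 2] times [bandwidth], which
    is below [eps]. *)
Theorem sparse_spectrum R (d : R) : 0 < d < 1 ->
  forall eps : R, 0 < eps ->
     exists (S : set R) (lambda : int -> R) (f : R -> R -> R[i]) (C : R),
       let Lambda : set R := range lambda in
       [/\ compact S /\ (lebesgue_measure S < eps%:E)%E,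
           injective lambda /\ uniformly_discrete Lambda,
           forall e : R, 0 < e -> exists N : nat, forall n : int,
             (N <= absz n)%N -> `|lambda n - n%:~R| < e,
           0 < C &
           forall xi, Lambda xi ->
             [/\ PW S (f xi),
                 (l2norm Lambda (fun l => f xi l - kronecker xi l)%R <= d%:E)%E &
                 (L2norm (f xi) <= (C * expR `|xi|)%:E)%E]].
Proof.
move=> /andP[d0 _] eps0 eps00; pose eps := Num.min eps0 1.
have e0 : 0 < eps by rewrite lt_min eps00 ltr01.
have e1 : eps <= 1 by rewrite ge_min lexx orbT.
have [q [W [q3 W0 small0 [qK qexp] small]]] := parameters e0 d0.
pose nd := node R W q; have ni := node_inj q3 W0 small0.
have D0 : 0 < (q ^ 2)%:R :> R by rewrite ltr0n expn_gt0 (ltnW (ltnW q3)).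
have b0 : 0 < bandwidth q eps by rewrite divr_gt0// mulr_gt0.
have [g gK] : exists g : R -> int, cancel nd g.
  exists (fun x => if pselect (exists n, nd n = x) is left h then projT1 (cid h) else 0%R) => n.
  case: pselect => [h|[]]; last by exists n.
  by apply: ni; exact: projT2 (cid h).
exists (bands (3 * q ^ 2) (2 * bandwidth q eps)), nd,
  (fun xi x => (node_fun W q eps (g xi) x)%:C), (cost_const W q eps + 1) => Lambda.
have cc0 : 0 <= cost_const W q eps.
  by rewrite /cost_const !mulr_ge0 ?exprn_ge0 ?expR_ge0 ?sqrtr_ge0.
split.
- split; first exact: bands_compact.
  apply: le_lt_trans (bands_measure _ _) _; first by rewrite mulr_ge0// ltW.
  rewrite lte_fin; apply: (@lt_le_trans _ _ eps); last by rewrite ge_min lexx.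
  have D1 : 1 <= (q ^ 2)%:R :> R by rewrite ler1n -(ltr0n R).
  rewrite -natr1 -muln2 [(3 * _ * 2)%:R]natrM [(3 * _)%:R]natrM /bandwidth.
  rewrite (_ : _ * (2 * _) = eps * ((24 * (q ^ 2)%:R + 4) / (32 * (q ^ 2)%:R))); last first.
    by move: ((q ^ 2)%:R : R) D0 => D Dp; field; rewrite gt_eqF.
  rewrite -[ltRHS]mulr1 ltr_pM2l// ltr_pdivrMr ?mulr_gt0// mul1r; lra.
- by split; [exact: ni|exact: nodes_uniformly_discrete].
- exact: nodes_tend.
- by rewrite ltr_pwDr.
- move=> _ [n _ <-]; rewrite gK.
  have [h1 h2] := node_fun_PW q3 W0 small0 e0 e1 erefl qK qexp n.
  split; [exact: h1|exact: (node_fun_error q3 W0 small0 e0 e1 erefl qK qexp d0 small n)|].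
  apply: le_trans h2 _; rewrite lee_fin ler_wpM2r ?expR_ge0//; lra.
Qed.

(** * The theorem *)

Local Close Scope complex_scope.

Theorem theorem2 (R : realType) (d : R) (hd : 0 < d < 1) :
  (forall (S Lambda : set R) (f : R -> R -> R[i]) (C gamma : R),
     compact S -> uniformly_discrete Lambda ->
     0 < C -> 0 < gamma < 1 ->
     (forall xi, Lambda xi ->
        [/\ PW S (f xi),
            (l2norm Lambda (fun l => f xi l - kronecker xi l)%R <= d%:E)%E &
            (L2norm (f xi) <= (C * expR (`|xi| `^ gamma))%:E)%E]) ->
     ((2 * pi * (1 - d ^+ 2))%:E * upper_density Lambda
        <= lebesgue_measure S)%E)
  /\
  (forall eps : R, 0 < eps ->
     exists (S : set R) (lambda : int -> R) (f : R -> R -> R[i]) (C : R),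
       let Lambda : set R := range lambda in
       [/\ compact S /\ (lebesgue_measure S < eps%:E)%E,
           injective lambda /\ uniformly_discrete Lambda,
           forall e : R, 0 < e -> exists N : nat, forall n : int,
             (N <= absz n)%N -> `|lambda n - n%:~R| < e,
           0 < C &
           forall xi, Lambda xi ->
             [/\ PW S (f xi),
                 (l2norm Lambda (fun l => f xi l - kronecker xi l)%R <= d%:E)%E &
                 (L2norm (f xi) <= (C * expR `|xi|)%:E)%E]]).
Proof.
split; last exact: sparse_spectrum.
by move=> S Lambda f C gamma cS ud C0 hg Hf; exact: density_bound hd cS ud C0 hg Hf.
Qed.
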